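(* Let $\Omega\subseteq\mathbb{R}^n$ be a (bounded) $C^{1,1}$ domain, let $T$ be the associated reflection operator, and let $\alpha\ge1$ be the Lipschitz constant of $T$. Let $\nu$ be a L\'evy measure which has an isotropic density $v(x)=\rho(|x|)$ with respect to Lebesgue measure, $\rho:(0,\infty)\to[0,\infty)$, for which there exists a constant $C_\alpha$ such that for every $\beta\in[\alpha^{-1}\wedge\frac13,\alpha]$ and every $t>0$ we have $\rho(\beta t)\le C_\alpha\rho(t)$. Then the extension operator $A$ is a continuous operator from $H_\nu(\Omega^c)$ to $H_\nu(\mathbb{R}^n)$.
   Context: All functions are real-valued; $\Omega^c=\mathbb{R}^n\setminus\Omega$; $a\wedge b=\min\{a,b\}$. A L\'evy measure is a nonnegative Borel measure $\nu$ on $\mathbb{R}^n$ with $\nu(\{0\})=0$, $\nu(-A)=\nu(A)$ for Borel $A$, and $\int_{\mathbb{R}^n}(1\wedge|y|^2)\,d\nu(y)<\infty$; $\nu_x(A)=\nu(A-x)$. Function spaces: for $D\subseteq\mathbb{R}^n$, $H_\nu(D)$ is the space of $u\in L^2(D)$ with $\int_D\int_D(u(x)-u(y))^2\,d\nu_x(y)\,dx<\infty$, normed by $\big(\|u\|_{L^2(D)}^2+\int_D\int_D(u(x)-u(y))^2\,d\nu_x(y)\,dx\big)^{1/2}$. $C^{1,1}$ domains: an open, bounded, connected $\Omega\subseteq\mathbb{R}^n$ is a $C^{1,1}$ domain at scale $s>0$ if for every $\tilde x\in\partial\Omega$ there exist $x\in\Omega$ and $x'\in\Omega^c$ such that $B(x,s)\subseteq\Omega$,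 $B(x',s)\cap\Omega=\emptyset$ and $\overline{B(x,s)}\cap\overline{B(x',s)}=\{\tilde x\}$. Let $\Omega$ be a $C^{1,1}$ domain at scale $2r>0$ (it is then one at every smaller scale). It is known that there exist $\delta>0$ and $\lambda\ge0$ such that for every $\tilde x\in\partial\Omega$ the tangent hyperplane $S_{\tilde x}\partial\Omega$ to $\partial\Omega$ at $\tilde x$ exists and, with $\vec n_{\tilde x}$ a unit normal vector at $\tilde x$, there is a $C^1$ function $\varphi:S_{\tilde x}\partial\Omega\to\mathbb{R}$ such that, with $\Phi(x)=x+\varphi(x)\vec n_{\tilde x}$: $|\nabla\varphi(x)-\nabla\varphi(y)|\le\lambda|x-y|$ for all $x,y\in S_{\tilde x}\partial\Omega$; $\Phi[B(\tilde x,\delta)\cap S_{\tilde x}\partial\Omega]\subseteq\partial\Omega$; and $B(\tilde x,\delta)\cap\partial\Omega\subseteq\Phi[B(\tilde x,\delta)\cap S_{\tilde x}\partial\Omega]$. Fix such $r,\lambda,\delta$. Reflection operator: put $\varepsilon=r\wedge\frac1{6\lambda}\wedge\frac\delta3$ (with $\frac1{6\lambda}=\infty$ if $\lambda=0$) and $V=\{x\in\mathbb{R}^n:\operatorname{dist}(x,\partial\Omega)<\varepsilon\}$. For $0<s<2r$ and $\tilde x\in\partial\Omega$ let $\psi_s(\tilde x)\in\Omega$ and $\chi_s(\tilde x)\in\Omega^c$ be the centers of the interior and exterior balls of radius $s$ tangent to $\partial\Omega$ at $\tilde x$; both maps are injective. The reflection $T:V\to V$ is $Tx=\chi_s(\psi_s^{-1}(x))$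 with $s=\operatorname{dist}(x,\Omega^c)$ for $x\in\Omega\cap V$; $Tx=\psi_s(\chi_s^{-1}(x))$ with $s=\operatorname{dist}(x,\Omega)$ for $x\in\operatorname{Int}(\Omega^c)\cap V$; and $Tx=x$ for $x\in\partial\Omega$. (Equivalently $Tx=2\tilde x-x$, where $\tilde x$ is the point of $\partial\Omega$ nearest to $x$.) $T$ is Lipschitz on $V$ and $T=T^{-1}$. Extension operator: let $W=V\cap\Omega$ and fix $\phi\in C^\infty(\mathbb{R}^n)$ with $0\le\phi\le1$, $\phi\equiv1$ in $\Omega^c$ and $\phi\equiv0$ in $\Omega\setminus W$. For $g\in H_\nu(\Omega^c)$, $A(g)=\tilde g$, where $\tilde g(x)=g(x)$ for $x\in\Omega^c$, $\tilde g(x)=g(Tx)\phi(x)$ for $x\in W$, and $\tilde g(x)=0$ for $x\in\Omega\setminus W$. *)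

(* Defs.v *)
From HB Require Import structures.
From mathcomp Require Import all_boot all_order all_algebra.
From mathcomp Require Import all_classical all_reals all_analysis.
From mathcomp Require Import measurable_realfun.

Set Implicit Arguments.
Unset Strict Implicit.
Unset Printing Implicit Defensive.

Import Order.TTheory GRing.Theory Num.Theory.
Import numFieldNormedType.Exports.

Local Open Scope classical_set_scope.
Local Open Scope ring_scope.

(* R^n is 'rV[R]_n, whose library topology is that of the sup norm, hence the
   Euclidean one; its measurable sets are the Borel sets. *)
Section borel_rV.
Variables (R : realType) (n : nat).

HB.instance Definition _ := @isMeasurable.Build
  (sigma_display (@open 'rV[R]_n)) 'rV[R]_n <<s @open 'rV[R]_n >>
  (@sigma_algebra0 _ setT _) (@sigma_algebraC _ _)
  (@sigma_algebra_bigcup _ setT _).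

Lemma open_measurable_rV (A : set 'rV[R]_n) : open A -> measurable A.
Proof. exact: sub_sigma_algebra. Qed.

Lemma measurable_coord (i : 'I_n) :
  measurable_fun setT (fun x : 'rV[R]_n => x ord0 i).
Proof.
apply: (measurability _ (RGenOpens.measurableE R)).
move=> _ [_ [a [b ->] <-]]; rewrite setTI.
apply: open_measurable_rV; apply: open_comp; last exact: interval_open.
by move=> x _; exact: coord_continuous.
Qed.

Lemma measurable_fun_rVP d (T : measurableType d) (f : T -> 'rV[R]_n) :
  measurable_fun setT f <->
  forall i, measurable_fun setT (fun t => f t ord0 i).
Proof.
split=> [mf i|mf].
  exact: (measurableT_comp (measurable_coord i) mf).
have mball (q : 'rV[rat]_n) k :
    measurable (f @^-1` ball (map_mx ratr q : 'rV[R]_n) k.+1%:R^-1).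
  rewrite (_ : _ @^-1` _ = \bigcap_(i in [set: 'I_n])
      ((fun t => f t ord0 i) @^-1` ball (ratr (q ord0 i) : R) k.+1%:R^-1)).
    apply: fin_bigcap_measurable => // i _; rewrite -[X in measurable X]setTI.
    by apply: mf => //; exact: measurable_ball.
  apply/seteqP; split=> t /=.
    by move=> [_ h] i _; have := h ord0 i; rewrite mxE.
  move=> h; split; first by rewrite invr_gt0.
  by move=> i j; rewrite ord1 mxE; apply: h.
apply: (@measurability _ _ _ _ setT f (@open 'rV[R]_n)) => //.
move=> _ [U oU <-]; rewrite setTI.
pose B (p : 'rV[rat]_n * nat) : set 'rV[R]_n :=
  ball (map_mx ratr p.1 : 'rV[R]_n) p.2.+1%:R^-1.
rewrite (_ : _ @^-1` _ = \bigcup_(p in setT)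
    (if `[< B p `<=` U >] then f @^-1` B p else set0)).
  apply: countable_bigcupT_measurable; first exact: countableP.
  by move=> p; case: ifPn => // _; exact: mball.
apply/seteqP; split=> [t /= Ut|t [p _ /=]]; last first.
  by case: ifPn => // /asboolP BU /BU.
have /nbhs_ballP[e /= e0 eU] : nbhs (f t) U by exact: open_nbhs_nbhs.
pose k := Num.truncn (2 / e).
have ke : 2 * k.+1%:R^-1 < e.
  rewrite ltr_pdivrMr// mulrC -ltr_pdivrMr//.
  by have /andP[] := truncn_itv (ltW (divr_gt0 (ltr0n R 2) e0)).
have k0 : 0 < k.+1%:R^-1 :> R by rewrite invr_gt0.
have hq i : exists q : rat, ball (ratr q : R) k.+1%:R^-1 (f t ord0 i).
  have /rat_in_itvoo[q qP] :
      f t ord0 i - k.+1%:R^-1 < f t ord0 i + k.+1%:R^-1.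
    by rewrite ltrD2l (lt_trans _ k0)// oppr_lt0.
  exists q; rewrite -ball_normE/= distrC ltr_distlC.
  by move: qP; rewrite in_itv.
pose q : 'rV[rat]_n := \row_i xget 0 [set q : rat |
  ball (ratr q : R) k.+1%:R^-1 (f t ord0 i)].
have Bt : B (q, k) (f t).
  split=> // i j; rewrite ord1 !mxE.
  by have [r rP] := hq j; case: xgetP => [? _ //|/(_ r)].
exists (q, k) => //=; rewrite ifT//; apply/asboolP.
move=> y By; apply: eU; apply: (le_ball (ltW ke)).
by rewrite mulr_natl mulr2n; apply: ball_triangle By; exact: ball_sym.
Qed.

End borel_rV.

Section lebesgue_rV.
Variable R : realType.

Definition rV_cons n (p : R * 'rV[R]_n) : 'rV[R]_n.+1 :=
  row_mx (p.1%:M : 'rV_1) p.2.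

Lemma rV_cons0 n (p : R * 'rV[R]_n) : rV_cons p ord0 ord0 = p.1.
Proof.
transitivity (row_mx (p.1%:M : 'rV_1) p.2 ord0 (lshift n ord0)).
  by congr (row_mx _ _ _ _); exact: val_inj.
by rewrite row_mxEl mxE eqxx mulr1n.
Qed.

Lemma rV_consS n (p : R * 'rV[R]_n) i : rV_cons p ord0 (lift ord0 i) = p.2 ord0 i.
Proof.
transitivity (row_mx (p.1%:M : 'rV_1) p.2 ord0 (rshift 1 i)).
  by congr (row_mx _ _ _ _); exact: val_inj.
by rewrite row_mxEr.
Qed.

Lemma measurable_rV_cons n : measurable_fun setT (@rV_cons n).
Proof.
apply/measurable_fun_rVP => i; case: (unliftP ord0 i) => [j|] ->.
  under eq_fun do rewrite rV_consS.
  by apply: (measurableT_comp (measurable_coord j)) => //; exact: measurable_snd.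
by under eq_fun do rewrite rV_cons0; exact: measurable_fst.
Qed.

Section step.
Variables (n : nat) (m : {sigma_finite_measure set 'rV[R]_n -> \bar R}).

Definition lebesgue_step : set 'rV[R]_n.+1 -> \bar R :=
  pushforward (@lebesgue_measure R \x m)%E (@rV_cons n).

Let mcons A : measurable A -> measurable (@rV_cons n @^-1` A).
Proof.
by move=> mA; rewrite -[X in measurable X]setTI; exact: (@measurable_rV_cons n).
Qed.

Let step0 : lebesgue_step set0 = 0%E.
Proof. by rewrite /lebesgue_step /pushforward preimage_set0 measure0. Qed.

Let step_ge0 A : (0 <= lebesgue_step A)%E.
Proof. exact: (measure_ge0 (lebesgue_measure \x m)%E). Qed.

Let step_additive : semi_sigma_additive lebesgue_step.
Proof.
move=> F mF tF mUF; rewrite /lebesgue_step /pushforward preimage_bigcup.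
apply: measure_semi_sigma_additive.
- by move=> k; exact: mcons.
- apply/trivIsetP => /= i j _ _ ij; rewrite -preimage_setI.
  by move/trivIsetP : tF => /(_ _ _ _ _ ij) ->//; rewrite preimage_set0.
- by rewrite -preimage_bigcup; exact: mcons.
Qed.

HB.instance Definition _ := isMeasure.Build _ _ _ lebesgue_step
  step0 step_ge0 step_additive.

Let step_sigma_finite : sigma_finite setT lebesgue_step.
Proof.
have [F [UF ndF mF]] := (sigma_finiteP _ _).1 (sigma_finiteT (@lebesgue_measure R)).
have [G [UG ndG mG]] := (sigma_finiteP _ _).1 (sigma_finiteT m).
pose tl (x : 'rV[R]_n.+1) : 'rV[R]_n := \row_i x ord0 (lift ord0 i).
pose H k := ((fun x : 'rV[R]_n.+1 => x ord0 ord0) @^-1` F k) `&` (tl @^-1` G k).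
have mtl : measurable_fun setT tl.
  apply/measurable_fun_rVP => i; under eq_fun do rewrite mxE.
  exact: measurable_coord.
exists H.
  apply/seteqP; split=> // x _.
  have [i _ Fi] : (\bigcup_i F i) (x ord0 ord0) by rewrite -UF.
  have [j _ Gj] : (\bigcup_i G i) (tl x) by rewrite -UG.
  exists (maxn i j) => //; split.
    by apply/(subsetPset _ _ (ndF _ _ (leq_maxl i j))).
  by apply/(subsetPset _ _ (ndG _ _ (leq_maxr i j))).
move=> k; have [mFk Fk] := mF k; have [mGk Gk] := mG k; split.
  apply: measurableI; rewrite -[X in measurable X]setTI.
    exact: measurable_coord.
  exact: mtl.
rewrite /lebesgue_step /pushforward (_ : _ @^-1` _ = F k `*` G k).
  by rewrite product_measure1E// lte_mul_pinfty// ge0_fin_numE.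
apply/seteqP; split=> -[a v]; rewrite /H /=.
  move=> []; rewrite rV_cons0/= => ? h; split=> //; move: h.
  by congr (G k _); apply/rowP => i; rewrite mxE rV_consS.
move=> [Fa Gv]; rewrite rV_cons0; split=> //.
by rewrite (_ : tl _ = v)//; apply/rowP => i; rewrite mxE rV_consS.
Qed.

HB.instance Definition _ :=
  Measure_isSigmaFinite.Build _ _ _ lebesgue_step step_sigma_finite.
End step.

(* Product of n copies of the Lebesgue measure of R; see lebesgue_rV_prod. *)
Fixpoint lebesgue_rV n : {sigma_finite_measure set 'rV[R]_n -> \bar R} :=
  if n is k.+1 then lebesgue_step (lebesgue_rV k) else \d_(0 : 'rV[R]_0).
End lebesgue_rV.

Lemma lebesgue_rV_prod (R : realType) n (A : 'I_n -> set R) :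
  (forall i, measurable (A i)) ->
  lebesgue_rV R n [set x | forall i, A i (x ord0 i)] =
  (\prod_(i < n) lebesgue_measure (A i))%E.
Proof.
elim: n A => [|n IH] A mA.
  by rewrite big_ord0 /= diracE mem_set//= => -[].
rewrite big_ord_recl -IH; last by move=> i; exact: mA.
have mB : measurable [set x : 'rV[R]_n | forall i, A (lift ord0 i) (x ord0 i)].
  rewrite [X in measurable X](_ : _ = \bigcap_(i in [set: 'I_n])
    ((fun x : 'rV[R]_n => x ord0 i) @^-1` A (lift ord0 i))).
    apply: fin_bigcap_measurable => // i _; rewrite -[X in measurable X]setTI.
    exact: measurable_coord.
  by apply/seteqP; split=> x /= h i; [move=> _|]; exact: h.
rewrite [LHS]/= /lebesgue_step /pushforward -product_measure1E//; last exact: mA.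
congr ((_ \x _)%E _); apply/seteqP; split=> -[a v] /=.
  move=> h; split; first by have := h ord0; rewrite rV_cons0.
  by move=> i; have := h (lift ord0 i); rewrite rV_consS.
by move=> [Aa Av] i; case: (unliftP ord0 i) => [j|] ->; rewrite ?rV_consS ?rV_cons0.
Qed.

Section euclidean.
Variables (R : realType) (n : nat).
Local Notation Rn := 'rV[R]_n.
Implicit Types (x y xt nv : Rn) (A Omega : set Rn) (s lambda delta : R).

Definition dotr x y : R := \sum_(i < n) x ord0 i * y ord0 i.

(* The library norm `|x| of a row vector is the sup norm. *)
Definition enorm x : R := Num.sqrt (dotr x x).

Definition eball x s : set Rn := [set y | enorm (y - x) < s].

Definition dist_to A x : \bar R := ereal_inf [set (enorm (x - a))%:E | a in A].

Definition boundary A : set Rn := closure A `\` A°.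

Definition partials (f : Rn -> R) (l : seq 'I_n) : Rn -> R :=
  foldr (fun i g => 'D_(delta_mx ord0 i) g) f l.

Definition smooth (f : Rn -> R) : Prop := forall l,
  continuous (partials f l) /\
  forall x i, derivable (partials f l) x (delta_mx ord0 i).

Definition tangent_balls Omega s xt x x' : Prop :=
  [/\ Omega x, ~ Omega x', eball x s `<=` Omega, eball x' s `&` Omega = set0 &
      closure (eball x s) `&` closure (eball x' s) = [set xt]].

Definition C11_domain Omega s : Prop :=
  [/\ open Omega, bounded_set Omega, connected Omega &
      forall xt, boundary Omega xt ->
        exists x x', tangent_balls Omega s xt x x'].

Definition hyperplane xt nv : set Rn := [set x | dotr (x - xt) nv = 0].

Definition tangent_hyperplane A xt nv : Prop := forall e, 0 < e ->
  \forall y \near within A (nbhs xt),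
    `|dotr (y - xt) nv| <= e * enorm (y - xt).

(* A real function on a hyperplane is represented by a function on R^n of
   which only the values on the hyperplane matter: the derivatives below are
   taken along directions parallel to it. *)
Definition C1_on_hyperplane xt nv (f : Rn -> R) (grad : Rn -> Rn) : Prop :=
  (forall x, hyperplane xt nv x -> dotr (grad x) nv = 0 /\
    forall v, dotr v nv = 0 -> is_derive x v f (dotr (grad x) v)) /\
  {within hyperplane xt nv, continuous grad}.

Definition C11_charts Omega lambda delta : Prop :=
  forall xt, boundary Omega xt -> exists nv : Rn,
  [/\ enorm nv = 1, tangent_hyperplane (boundary Omega) xt nv &
  exists (f : Rn -> R) (grad : Rn -> Rn),
    let S := hyperplane xt nv in
    let Phi x := x + f x *: nv in
    [/\ C1_on_hyperplane xt nv f grad,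
        forall x y, S x -> S y ->
          enorm (grad x - grad y) <= lambda * enorm (x - y),
        Phi @` (eball xt delta `&` S) `<=` boundary Omega &
        eball xt delta `&` boundary Omega `<=` Phi @` (eball xt delta `&` S)]].

(* The bound 1 / (6 lambda) counts as +oo when lambda = 0. *)
Definition collar_width r lambda delta : R :=
  if lambda == 0 then Num.min r (delta / 3)
  else Num.min (Num.min r (6 * lambda)^-1) (delta / 3).

Definition collar Omega (eps : R) : set Rn :=
  [set x | (dist_to (boundary Omega) x < eps%:E)%E].

Definition int_center Omega s xt : Rn :=
  xget 0 [set x | exists x', tangent_balls Omega s xt x x'].

Definition ext_center Omega s xt : Rn :=
  xget 0 [set x' | exists x, tangent_balls Omega s xt x x'].

(* With s the distance of x to the other side, x is mapped from the center of
   the interior (exterior) ball of radius s to the center of the exterior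
   (interior) one; only meaningful on the collar of a C^{1,1} domain. *)
Definition reflection Omega x : Rn :=
  if x \in Omega then
    let s := fine (dist_to (~` Omega) x) in
    ext_center Omega s
      ('pinv_(fun=> 0) (boundary Omega) (int_center Omega s) x)
  else if x \in ((~` Omega)° : set Rn) then
    let s := fine (dist_to Omega x) in
    int_center Omega s
      ('pinv_(fun=> 0) (boundary Omega) (ext_center Omega s) x)
  else x.

Definition cutoff Omega eps (phi : Rn -> R) : Prop :=
  [/\ smooth phi, forall x, 0 <= phi x <= 1,
      forall x, ~ Omega x -> phi x = 1 &
      forall x, Omega x -> ~ collar Omega eps x -> phi x = 0].

Definition extension Omega eps (phi g : Rn -> R) : Rn -> R := fun x =>
  if x \in ~` Omega then g x
  else if x \in collar Omega eps then g (reflection Omega x) * phi x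
  else 0.

End euclidean.

Section function_spaces.
Variables (R : realType) (n : nat).
Local Notation Rn := 'rV[R]_n.
Local Notation leb := (lebesgue_rV R n).
Implicit Types (nu : {measure set Rn -> \bar R}) (D : set Rn) (u : Rn -> R).

Definition levy_measure nu : Prop :=
  [/\ nu [set 0] = 0%E,
      forall A : set Rn, measurable A -> nu [set - y | y in A] = nu A &
      (\int[nu]_y (Num.min 1 (enorm y ^+ 2))%:E < +oo)%E].

Definition isotropic_density nu (rho : R -> R) : Prop :=
  [/\ measurable_fun [set t : R | 0 < t] rho,
      forall t, 0 < t -> 0 <= rho t &
      forall A : set Rn, measurable A ->
        nu A = (\int[leb]_(x in A) (rho (enorm x))%:E)%E].

(* nu_x(A) = nu(A - x) *)
Definition translated nu (x : Rn) : set Rn -> \bar R :=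
  pushforward nu (fun y : Rn => y + x).

Definition L2_sqr D u : \bar R := (\int[leb]_(x in D) (u x ^+ 2)%:E)%E.

Definition nu_form nu D u : \bar R :=
  (\int[leb]_(x in D) \int[translated nu x]_(y in D) ((u x - u y) ^+ 2)%:E)%E.

(* Functions on D are represented by functions on R^n, whose values outside D
   are ignored, and are not quotiented by almost everywhere equality, so that
   H_norm is a seminorm. *)
Definition H_space nu D : set (Rn -> R) :=
  [set u | [/\ measurable_fun D u, (L2_sqr D u < +oo)%E &
               (nu_form nu D u < +oo)%E]].

Definition H_norm nu D u : \bar R := sqrte (L2_sqr D u + nu_form nu D u)%E.

Definition continuous_operator nu D1 D2 (F : (Rn -> R) -> (Rn -> R)) : Prop :=
  [/\ forall g, H_space nu D1 g -> H_space nu D2 (F g),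
      forall (a : R) g h, H_space nu D1 g -> H_space nu D1 h ->
        F (fun x => a * g x + h x) = (fun x => a * F g x + F h x) &
      forall g0, H_space nu D1 g0 -> forall e : R, 0 < e ->
        exists2 d : R, 0 < d & forall g, H_space nu D1 g ->
          (H_norm nu D1 (fun x => (g x - g0 x)%R) < d%:E)%E ->
          (H_norm nu D2 (fun x => (F g x - F g0 x)%R) < e%:E)%E].

End function_spaces.

(* Main.v *)
From HB Require Import structures.
Require Import Defs.
From mathcomp Require Import all_boot all_order all_algebra.
From mathcomp Require Import all_classical all_reals all_analysis.
From mathcomp Require Import measurable_realfun.
From mathcomp Require Import ring lra.

Set Implicit Arguments.
Unset Strict Implicit.
Unset Printing Implicit Defensive.

Import Order.TTheory GRing.Theory Num.Theory.
Import numFieldNormedType.Exports.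

Local Open Scope classical_set_scope.
Local Open Scope ring_scope.

(** Write [D] for the complement of the domain, [W] for the part of the collar
    inside the domain and [k] for the radial kernel of [nu]. Let [S] be the map
    that is the reflection on [W] and the identity on [D]. The extension of [g]
    is [h * phi], where [h] is [g] composed with [S] on the union of [D] and
    [W], and [0] elsewhere. The theorem says that this linear operator is
    bounded, which comes down to three estimates ([extension_bound]).

    Change of variables. The reflection is bilipschitz on [W], because it is
    Lipschitz and an involution. Hence the preimage of a cube under [S] has
    measure at most a constant times that of the cube, and a measure that is
    bounded by a multiple of the Lebesgue measure on cubes is bounded by it on
    Borel sets ([cube_bounded_le_lebesgue]); integrals of nonnegative functions
    composed with [S] are controlled by integrals over [D]
    ([integral_comp_le], [fold_integral_le]). This bounds the L2 norm.

    Cutoff. By the Leibniz rule ([cutoff_product_sqr]) the form of [h * phi] is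
    at most that of [h] plus integrals of [h x ^+ 2 * (phi x - phi y) ^+ 2]
    against the kernel. As [phi] is Lipschitz and bounded, the latter is at most
    an L2 norm times the integral in the definition of a Levy measure
    ([cutoff_form_le]).

    Folding. There remains the integral of [(g (S x) - g (S y)) ^+ 2] against
    [k (enorm (x - y))] over the union of [D] and [W] ([folded_form_le]). Where
    [enorm (x - y)] and [enorm (S x - S y)] are comparable, doubling replaces
    one by the other in [k], and the change of variables in [x] and [y] gives
    the form of [g] on [D]. Comparability fails only when [x] is in [D], [y] is
    in [W], and [x] is much closer to [S y] than the distance [s] from [y] to
    [D] (or with [x] and [y] exchanged). In that case
    [(g x - g (S y)) ^+ 2 <= 2 * (g x - g w) ^+ 2 + 2 * (g w - g (S y)) ^+ 2]
    is averaged over relay points [w] that fill a cube of size about [s] in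
    [D], at distance about [s] from both [x] and [S y]; the exterior ball of
    radius [s] about [S y] provides the room for them. Then the kernel at
    [x - y] is comparable to that at [x - w] and at [w - S y], and integrating
    out [y], respectively [x], leaves the form of [g] on [D]
    ([relay_integral_y], [relay_integral_x]).

    Comparing the kernel at distances whose ratio is any bounded number, above
    or below [1], requires [1 < alpha] ([comparable_of_doubling]). This holds
    since a reflection in the boundary of a bounded domain expands some
    distance ([reflection_expands]). *)

(** * The Euclidean norm *)

Section euclidean_norm.
Variables (R : realType) (n : nat).
Implicit Types (x y z u v : 'rV[R]_n) (a b s t : R).

Lemma dotrC x y : dotr x y = dotr y x.
Proof. by apply: eq_bigr => i _; rewrite mulrC. Qed.

Lemma dotrDl x y z : dotr (x + y) z = dotr x z + dotr y z.
Proof.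
by rewrite -big_split; apply: eq_bigr => i _; rewrite mxE mulrDl.
Qed.

Lemma dotrZl a x y : dotr (a *: x) y = a * dotr x y.
Proof. by rewrite mulr_sumr; apply: eq_bigr => i _; rewrite mxE mulrA. Qed.

Lemma dotrDr x y z : dotr x (y + z) = dotr x y + dotr x z.
Proof. by rewrite dotrC dotrDl !(dotrC x). Qed.

Lemma dotrZr a x y : dotr x (a *: y) = a * dotr x y.
Proof. by rewrite dotrC dotrZl dotrC. Qed.

Lemma dotrNl x y : dotr (- x) y = - dotr x y.
Proof. by rewrite -scaleN1r dotrZl mulN1r. Qed.

Lemma dotrNr x y : dotr x (- y) = - dotr x y.
Proof. by rewrite dotrC dotrNl dotrC. Qed.

Lemma dotrr_ge0 x : 0 <= dotr x x.
Proof. by apply: sumr_ge0 => i _; rewrite -expr2 sqr_ge0. Qed.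

Lemma enorm_ge0 x : 0 <= enorm x.
Proof. exact: sqrtr_ge0. Qed.

Lemma enorm_sqr x : enorm x ^+ 2 = dotr x x.
Proof. by rewrite sqr_sqrtr// dotrr_ge0. Qed.

Lemma enormN x : enorm (- x) = enorm x.
Proof. by rewrite /enorm dotrNl dotrNr opprK. Qed.

Lemma enorm_distC x y : enorm (x - y) = enorm (y - x).
Proof. by rewrite -enormN opprB. Qed.

Lemma enormZ a x : enorm (a *: x) = `|a| * enorm x.
Proof.
by rewrite /enorm dotrZl dotrZr mulrA -expr2 sqrtrM ?sqr_ge0// sqrtr_sqr.
Qed.

Lemma enorm0 : enorm (0 : 'rV[R]_n) = 0.
Proof. by rewrite -(scale0r (0 : 'rV[R]_n)) enormZ normr0 mul0r. Qed.

Lemma coord_enorm x i : `|x ord0 i| <= enorm x.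
Proof.
rewrite -sqrtr_sqr /enorm ler_sqrt ?dotrr_ge0// /dotr (bigD1 i)//= -expr2.
by rewrite lerDl sumr_ge0// => j _; rewrite -expr2 sqr_ge0.
Qed.

Lemma enorm_eq0 x : enorm x = 0 -> x = 0.
Proof.
move=> x0; apply/rowP => i; rewrite mxE; apply/eqP; rewrite -normr_le0 -x0.
exact: coord_enorm.
Qed.

Lemma enorm_gt0 x : (0 < enorm x) = (x != 0).
Proof.
rewrite lt_def enorm_ge0 andbT; congr (~~ _).
by apply/eqP/eqP => [/enorm_eq0|->] //; rewrite enorm0.
Qed.

Lemma dotr_le x y : dotr x y <= enorm x * enorm y.
Proof.
have [->|y0] := eqVneq y 0.
  by rewrite enorm0 mulr0 /dotr big1// => i _; rewrite mxE mulr0.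
have Y0 : 0 < enorm y by rewrite enorm_gt0.
have := dotrr_ge0 (enorm y *: x - enorm x *: y).
rewrite !(dotrDl, dotrDr, dotrNl, dotrNr, dotrZl, dotrZr) -!enorm_sqr.
rewrite (dotrC y x) => h.
have [->|x0] := eqVneq x 0.
  by rewrite enorm0 mul0r /dotr big1// => i _; rewrite mxE mul0r.
have X0 : 0 < enorm x by rewrite enorm_gt0.
have P0 := mulr_gt0 X0 Y0.
rewrite -(ler_pM2l P0); nra.
Qed.

Lemma ler_enormD x y : enorm (x + y) <= enorm x + enorm y.
Proof.
have h := dotr_le x y.
rewrite -(@ler_pXn2r _ 2)// ?nnegrE ?addr_ge0 ?enorm_ge0//.
rewrite enorm_sqr sqrrD !enorm_sqr dotrDl !dotrDr (dotrC y x) mulr2n.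
by lra.
Qed.

Lemma ler_enorm_dist z x y : enorm (x - y) <= enorm (x - z) + enorm (z - y).
Proof. by rewrite -[x - y](subrKA z); exact: ler_enormD. Qed.

Lemma norm_le_enorm x : `|x| <= enorm x.
Proof.
rewrite [leLHS]/Num.norm /= mx_normrE; apply: bigmax_le => [|[i j] _].
  exact: enorm_ge0.
by rewrite ord1; exact: coord_enorm.
Qed.

Lemma coord_norm x i : `|x ord0 i| <= `|x|.
Proof.
by rewrite [leRHS]/Num.norm /= mx_normrE; apply: (le_bigmax _ _ (ord0, i)).
Qed.

Lemma enorm_le_norm x : enorm x <= n%:R * `|x|.
Proof.
have h0 : 0 <= n%:R * `|x| by rewrite mulr_ge0.
rewrite -(ler_pXn2r (n := 2))// ?nnegrE ?enorm_ge0// enorm_sqr.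
apply: (@le_trans _ _ (n%:R * `|x| ^+ 2)).
  rewrite /dotr (le_trans (y := \sum_(i < n) `|x| ^+ 2))//; last first.
    by rewrite sumr_const card_ord mulr_natl.
  apply: ler_sum => i _; rewrite -expr2 -real_normK ?num_real//.
  by rewrite ler_pXn2r ?nnegrE//; exact: coord_norm.
rewrite exprMn; apply: ler_wpM2r; first exact: sqr_ge0.
by rewrite -natrX ler_nat; case: (n) => // k; rewrite expnS leq_pmulr.
Qed.

(** The case of equality in the triangle inequality. Every geometric
    uniqueness statement below (centers, tangency points) comes from it. *)
Lemma collinear_of_enormD {u v a b} : 0 <= a -> 0 <= b ->
  enorm u <= a -> enorm v <= b -> a + b <= enorm (u + v) -> b *: u = a *: v.
Proof.
move=> a0 b0 ua vb ab; apply/subr0_eq/enorm_eq0/eqP.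
rewrite -sqrf_eq0 eq_le sqr_ge0 andbT.
have ab2 : (a + b) ^+ 2 <= enorm (u + v) ^+ 2.
  by rewrite ler_pXn2r// ?nnegrE ?enorm_ge0 ?addr_ge0.
have ua2 : enorm u ^+ 2 <= a ^+ 2 by rewrite ler_pXn2r// ?nnegrE ?enorm_ge0.
have vb2 : enorm v ^+ 2 <= b ^+ 2 by rewrite ler_pXn2r// ?nnegrE ?enorm_ge0.
move: ab2; rewrite !enorm_sqr in ua2 vb2 *.
rewrite !(dotrDl, dotrDr, dotrNl, dotrNr, dotrZl, dotrZr) (dotrC v u).
set p := dotr u u in ua2 *; set q := dotr v v in vb2 *; set c := dotr u v.
move=> ab2.
have A : b * p <= b * a ^+ 2 by rewrite ler_wpM2l.
have B : a * q <= a * b ^+ 2 by rewrite ler_wpM2l.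
have C : a * b * (a + b) ^+ 2 <= a * b * (p + c + (c + q)).
  by rewrite ler_wpM2l// mulr_ge0.
have D : (a + b) * (b * p + a * q) <= (a + b) * (b * a ^+ 2 + a * b ^+ 2).
  by rewrite ler_wpM2l ?addr_ge0// lerD.
by nra.
Qed.

Lemma eball_open x s : open (eball x s).
Proof.
rewrite openE => y; rewrite /eball/= => ys.
have n0 : 0 < n.+1%:R :> R by [].
apply/nbhs_ballP; exists ((s - enorm (y - x)) / n.+1%:R) => /=.
  by rewrite divr_gt0// subr_gt0.
move=> z; rewrite -ball_normE/= ltr_pdivlMr// => yz.
rewrite (le_lt_trans (ler_enorm_dist y _ _))// -ltrBrDr.
rewrite (le_lt_trans _ yz)// enorm_distC (le_trans (enorm_le_norm _))//.
by rewrite mulrC ler_wpM2l// ler_nat.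
Qed.

Lemma eball_nbhs x s : 0 < s -> nbhs x (eball x s).
Proof.
move=> s0; apply: open_nbhs_nbhs; split; first exact: eball_open.
by rewrite /eball/= subrr enorm0.
Qed.

Lemma nbhs_eballP x (A : set 'rV[R]_n) :
  nbhs x A <-> exists2 s, 0 < s & eball x s `<=` A.
Proof.
split=> [/nbhs_ballP[s /= s0 sA]|[s s0 sA]]; last first.
  by apply: filterS sA _; exact: eball_nbhs.
exists s => // y; rewrite /eball/= => ys; apply: sA.
rewrite -ball_normE/= distrC.
exact: le_lt_trans (norm_le_enorm _) ys.
Qed.

Lemma closure_eballP x (A : set 'rV[R]_n) :
  closure A x <-> forall s, 0 < s -> exists2 y, A y & enorm (y - x) < s.
Proof.
split=> [cA s s0|h B /nbhs_eballP[s s0 sB]].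
  by have [y [Ay sy]] := cA _ (eball_nbhs x s0); exists y.
by have [y Ay ys] := h _ s0; exists y; split => //; exact: sB.
Qed.

Lemma closure_eball {x s y} : closure (eball x s) y -> enorm (y - x) <= s.
Proof.
move=> /closure_eballP h; rewrite leNgt; apply/negP => lt_s.
have [z zs zy] := h (enorm (y - x) - s) ltac:(by rewrite subr_gt0).
have := ler_enorm_dist z y x; rewrite (enorm_distC y z).
by rewrite /eball/= in zs; lra.
Qed.

Lemma eball_closure {x s y} : 0 < s -> enorm (y - x) <= s ->
  closure (eball x s) y.
Proof.
move=> s0 ys; apply/closure_eballP => e e0.
pose t := Num.min (2^-1) (e / (2 * s)).
have t0 : 0 < t by rewrite lt_min !divr_gt0// ?mulr_gt0// andbT invr_gt0.
have t1 : t <= 2^-1 by rewrite ge_min lexx.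
have te : t * s <= e / 2.
  rewrite -ler_pdivlMr// (le_trans (y := e / (2 * s)))//; last first.
    by rewrite invfM mulrA.
  by rewrite ge_min lexx orbT.
have ts : t * enorm (y - x) <= t * s by rewrite ler_wpM2l// ltW.
exists (y - t *: (y - x)).
  rewrite /eball/= addrAC -[X in X - _]scale1r -scalerBl enormZ.
  rewrite ger0_norm; last by lra.
  rewrite (le_lt_trans (y := (1 - t) * s))//; first by rewrite ler_wpM2l//; lra.
  by nra.
rewrite addrAC subrr add0r enormN enormZ ger0_norm ?ltW//.
lra.
Qed.

Lemma eball_disjoint {x y a b} : 0 < a -> 0 < b ->
  eball x a `&` eball y b = set0 -> a + b <= enorm (x - y).
Proof.
move=> a0 b0 dis; rewrite leNgt; apply/negP => xy.
have ab : 0 < a + b by rewrite addr_gt0.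
have ab1 : (a + b) / (a + b) = 1 by rewrite divff// gt_eqF.
have hlt c : 0 < c -> enorm ((c / (a + b)) *: (x - y)) < c.
  move=> c0; rewrite enormZ ger0_norm ?divr_ge0 ?ltW//.
  by rewrite mulrAC ltr_pdivrMr// ltr_pM2l.
have : (eball x a `&` eball y b) (x - (a / (a + b)) *: (x - y)).
  split; rewrite /eball/=.
    by rewrite addrAC subrr add0r enormN; exact: hlt.
  rewrite addrAC -[X in X - _]scale1r -scalerBl -ab1 -mulrBl addrAC subrr add0r.
  exact: hlt.
by rewrite dis.
Qed.

Lemma bounded_set_enorm (A : set 'rV[R]_n) :
  bounded_set A -> exists M, forall x, A x -> enorm x <= M.
Proof.
move=> [M [_ hM]]; exists (n%:R * (M + 1)) => x Ax.
rewrite (le_trans (enorm_le_norm _))// ler_wpM2l//.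
by apply: (hM (M + 1)) => //; rewrite ltrDl.
Qed.

Lemma enorm_continuous y : continuous (fun x : 'rV[R]_n => enorm (x - y)).
Proof.
move=> x; apply/(@cvgrPdist_lt _ _ _ (nbhs x) (nbhs_filter x)) => e e0.
apply: (filterS _ (eball_nbhs x e0)) => z; rewrite /eball/= => zx.
have := ler_enorm_dist z x y; have := ler_enorm_dist x z y.
rewrite ltr_norml (enorm_distC x z) => h1 h2; apply/andP; split; lra.
Qed.

End euclidean_norm.

(** * Nearest points and tangent balls *)

Section distance.
Variables (R : realType) (n : nat).
Implicit Types (x y a : 'rV[R]_n) (A : set 'rV[R]_n) (s t : R).

Lemma dist_to_le A x a : A a -> (dist_to A x <= (enorm (x - a))%:E)%E.
Proof. by move=> Aa; apply: ereal_inf_lbound; exists a. Qed.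

Lemma dist_toE A x a s : closure A a -> enorm (x - a) <= s ->
  (forall b, A b -> s <= enorm (x - b)) -> dist_to A x = s%:E.
Proof.
move=> /closure_eballP cA xa sA; apply/eqP; rewrite eq_le; apply/andP; split.
  apply/lee_addgt0Pr => e e0; have [y Ay ye] := cA _ e0.
  rewrite (le_trans (dist_to_le _ Ay))// -EFinD lee_fin.
  rewrite (le_trans (ler_enorm_dist a _ _))// lerD// enorm_distC.
  exact: ltW.
by apply: le_ereal_inf_tmp => _ [b Ab <-]; rewrite lee_fin; exact: sA.
Qed.

Lemma closed_nearest A x : closed A -> A !=set0 ->
  exists2 a, A a & forall b, A b -> enorm (x - a) <= enorm (x - b).
Proof.
move=> cA [b0 Ab0]; pose B := A `&` [set b | enorm (b - x) <= enorm (b0 - x)].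
have cB : compact B.
  apply: bounded_closed_compact.
    exists (enorm (b0 - x) + enorm x); split; first exact: num_real.
    move=> M ltM b [_ /= bx].
    rewrite (le_trans (norm_le_enorm _))// (le_trans _ (ltW ltM))//.
    rewrite -[leLHS](_ : enorm (b - x + x) = _); last by rewrite subrK.
    by rewrite (le_trans (ler_enormD _ _))// lerD2r.
  apply: closedI => //.
  have := @closed_comp _ _ (fun b : 'rV[R]_n => enorm (b - x))
    [set t | t <= enorm (b0 - x)].
  apply; last exact: closed_le.
  by move=> b _; exact: enorm_continuous.
have B0 : B !=set0 by exists b0; split => /=.
have [|c] := EVT_min_rV B0 cB (f := fun b => enorm (b - x)).
  by apply: continuous_subspaceT => b; exact: enorm_continuous.
rewrite inE => -[Ac cx] minc; exists c => // b Ab.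
rewrite -!(enorm_distC _ x).
have [bb0|/ltW bb0] := leP (enorm (b - x)) (enorm (b0 - x)).
  by apply: minc; rewrite inE.
exact: le_trans cx bb0.
Qed.

End distance.

Section tangency.
Variables (R : realType) (n : nat) (Omega : set 'rV[R]_n).
Hypothesis oO : open Omega.
Implicit Types (x y a b p : 'rV[R]_n) (s r : R).

Lemma eq_ler (s t : R) : s = t -> s <= t.
Proof. by move=> ->. Qed.

Lemma reflect_subr a x : a *+ 2 - x - a = a - x.
Proof. by rewrite mulr2n; apply/rowP => i; rewrite !mxE; ring. Qed.

Lemma boundary_open : boundary Omega = closure Omega `\` Omega.
Proof. by rewrite /boundary; congr (_ `\` _); apply/interior_id. Qed.

(** The two balls are disjoint, so their centers are at least [s + r] apart,
    and the path from [x] to [y] through [a] is a segment: an inner and an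
    outer ball that touch the same point sit on opposite sides of it. *)
Lemma tangent_antipodal {x y a s r} : 0 < s -> 0 < r ->
    eball x s `<=` Omega -> eball y r `&` Omega = set0 ->
    enorm (a - x) <= s -> enorm (y - a) <= r ->
  r *: (a - x) = s *: (y - a).
Proof.
move=> s0 r0 xO yO ax ya; apply: collinear_of_enormD => //; try exact: ltW.
rewrite [_ - _ + _]addrC subrKA enorm_distC; apply: eball_disjoint => //.
apply/seteqP; split => // z [/xO zO zy].
by rewrite -yO.
Qed.

(** The ball of radius [s] about [c] lies in the larger ball of radius [r]
    about [p], so it meets the outside of that ball in one point at most.
    This is what makes the nearest boundary point of a collar point unique. *)
Lemma touch_unique {a b c p s r} : 0 <= s -> s < r ->
    enorm (a - c) <= s -> enorm (b - c) <= s -> enorm (c - p) <= r - s ->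
    r <= enorm (a - p) -> r <= enorm (b - p) -> a = b.
Proof.
move=> s0 sr ac bc cp ap bp; have rs : 0 < r - s by rewrite subr_gt0.
have h d : enorm (d - c) <= s -> r <= enorm (d - p) ->
    (r - s) *: (d - c) = s *: (c - p).
  move=> dc dp; apply: collinear_of_enormD => //; first exact: ltW.
  by rewrite subrKA addrC subrK.
have : (r - s) *: (a - c) = (r - s) *: (b - c) by rewrite !h.
by move/(scalerI (lt0r_neq0 rs))/addIr.
Qed.

Lemma tangent_center {s a x y} : 0 < s -> tangent_balls Omega s a x y ->
  [/\ boundary Omega a, enorm (a - x) = s, y = a *+ 2 - x &
      eball x s `<=` Omega /\ eball y s `&` Omega = set0].
Proof.
move=> s0 [Ox nOy xO yO cl].
have [/closure_eball ax /closure_eball ay] :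
    (closure (eball x s) `&` closure (eball y s)) a by rewrite cl.
have ya : enorm (y - a) <= s by rewrite enorm_distC.
have e1 := tangent_antipodal s0 s0 xO yO ax ya.
have {}e1 := scalerI (lt0r_neq0 s0) e1.
have yE : y = a *+ 2 - x.
  by rewrite mulr2n -addrA e1 addrC subrK.
split=> //.
- rewrite boundary_open; split.
    have : closure (eball x s) a by exact: eball_closure.
    exact: closure_subset.
  move=> Oa; have /closure_eballP : closure (eball y s) a.
    exact: eball_closure.
  have /nbhs_eballP[e e0 eO] : nbhs a Omega by exact: open_nbhs_nbhs.
  move=> /(_ e e0) [z zy za].
  suff : (eball y s `&` Omega) z by rewrite yO.
  by split => //; exact: eO.
- apply/eqP; rewrite eq_le ax /=.
  have : s + s <= enorm (x - y).
    apply: eball_disjoint => //; apply/seteqP; split => // z [/xO zO zy].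
    by rewrite -yO.
  have -> : x - y = - ((a - x) *+ 2).
    by rewrite yE !mulr2n !opprD !opprK; apply/rowP => i; rewrite !mxE; ring.
  by rewrite enormN -scaler_nat enormZ ger0_norm//; lra.
Qed.

(** An inner ball through [a] is opposite to the outer ball of radius [r]
    there, hence the point reflection through [a] sends its center into that
    outer ball, at distance [r - s] from the center. *)
Lemma tangent_mk {s r a p q x} : 0 < s -> s < r ->
    tangent_balls Omega r a p q -> eball x s `<=` Omega ->
    enorm (a - x) <= s ->
  tangent_balls Omega s a x (a *+ 2 - x).
Proof.
move=> s0 sr tg xO ax; have r0 := lt_trans s0 sr.
have [ba ap qE [pO qO]] := tangent_center r0 tg.
have qa : enorm (q - a) = r.
  by rewrite qE reflect_subr.
have e1 := tangent_antipodal s0 r0 xO qO ax (eq_ler qa).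
have xe : a - x = (s / r) *: (q - a).
  by rewrite mulrC -scalerA -e1 scalerA mulVf ?scale1r// gt_eqF.
have yq : enorm (a *+ 2 - x - q) <= r - s.
  have -> : a *+ 2 - x - q = - ((1 - s / r) *: (q - a)).
    rewrite scalerBl -xe scale1r mulr2n.
    by apply/rowP => i; rewrite !mxE; ring.
  rewrite enormN enormZ qa ger0_norm; last first.
    by rewrite subr_ge0 ler_pdivrMr// mul1r ltW.
  by rewrite mulrBl mul1r divfK// gt_eqF.
have yO : eball (a *+ 2 - x) s `&` Omega = set0.
  apply/seteqP; split => // z [zy Oz]; rewrite -qO; split => //.
  rewrite /eball/= in zy *.
  rewrite (le_lt_trans (ler_enorm_dist (a *+ 2 - x) _ _))//.
  lra.
have s0' : eball x s x by rewrite /eball/= subrr enorm0.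
have ay : a - (a *+ 2 - x) = - (a - x).
  by rewrite mulr2n; apply/rowP => i; rewrite !mxE; ring.
split => //; first exact: xO.
- move=> Oy; suff : (eball (a *+ 2 - x) s `&` Omega) (a *+ 2 - x) by rewrite yO.
  by split => //; rewrite /eball/= subrr enorm0.
- apply/seteqP; split => [z [/closure_eball zx /closure_eball zy]|z ->] /=; last first.
    by split; apply: eball_closure => //; rewrite ay enormN.
  have nax : enorm (a - x) = s.
    rewrite xe enormZ qa ger0_norm ?divr_ge0 ?ltW// divfK// gt_eqF//.
  have := @collinear_of_enormD _ _ (z - x) (a *+ 2 - x - z) s s.
  rewrite (enorm_distC _ z) => /(_ (ltW s0) (ltW s0) zx zy).
  have -> : z - x + (a *+ 2 - x - z) = (a - x) *+ 2.
    by rewrite !mulr2n; apply/rowP => i; rewrite !mxE; ring.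
  rewrite -scaler_nat enormZ ger0_norm// nax mulr_natl mulr2n => /(_ (lexx _)).
  move/(scalerI (lt0r_neq0 s0)) => /rowP h; apply/rowP => i.
  by have := h i; rewrite mulr2n !mxE; lra.
Qed.

Lemma tangent_shrink {s r a p q} : 0 < s -> s < r ->
    tangent_balls Omega r a p q ->
  exists x, tangent_balls Omega s a x (a *+ 2 - x).
Proof.
move=> s0 sr tg; have r0 := lt_trans s0 sr.
have [ba ap qE [pO qO]] := tangent_center r0 tg.
have sr1 : s / r < 1 by rewrite ltr_pdivrMr// mul1r.
exists (a - (s / r) *: (a - p)); apply: (tangent_mk s0 sr tg).
  move=> z; rewrite /eball/= => zx; apply: pO; rewrite /eball/=.
  rewrite (le_lt_trans (ler_enorm_dist (a - (s / r) *: (a - p)) _ _))//.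
  have -> : a - (s / r) *: (a - p) - p = (1 - s / r) *: (a - p).
    by rewrite addrAC scalerBl scale1r.
  rewrite enormZ ap.
  rewrite ger0_norm ?subr_ge0 ?ltW// mulrBl mul1r divfK ?gt_eqF//.
  lra.
rewrite opprB addrC subrK enormZ ap ger0_norm; last by rewrite divr_ge0 ?ltW.
by rewrite divfK ?gt_eqF.
Qed.

Lemma tangent_unique {s a x y x' y'} : 0 < s ->
  tangent_balls Omega s a x y -> tangent_balls Omega s a x' y' ->
  x = x' /\ y = y'.
Proof.
move=> s0 t1 t2; have [_ ax yE [xO _]] := tangent_center s0 t1.
have [_ ax' yE' [_ yO']] := tangent_center s0 t2.
have ya' : enorm (y' - a) <= s.
  by rewrite yE' reflect_subr ax'.
have := tangent_antipodal s0 s0 xO yO' (eq_ler ax) ya'.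
move/(scalerI (lt0r_neq0 s0)).
rewrite yE' reflect_subr => /addrI/oppr_inj xx'.
by rewrite yE xx'.
Qed.

(** Both tangency points lie outside the inner ball of radius [r] at [a],
    which contains the ball of radius [s] about the common center [x]. *)
Lemma tangent_inj_int {s r a p q b x y y'} : 0 < s -> s < r ->
    tangent_balls Omega r a p q ->
    tangent_balls Omega s a x y -> tangent_balls Omega s b x y' -> a = b.
Proof.
move=> s0 sr t0 t1 t2; have r0 := lt_trans s0 sr.
have [_ ap qE [pO qO]] := tangent_center r0 t0.
have [_ ax _ [xO _]] := tangent_center s0 t1.
have [+ bx _ _] := tangent_center s0 t2; rewrite boundary_open => -[_ nOb].
have qa : enorm (q - a) <= r.
  by rewrite qE reflect_subr ap.
have := tangent_antipodal s0 r0 xO qO (eq_ler ax) qa.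
rewrite {1}qE reflect_subr => e1.
have xe : a - x = (s / r) *: (a - p).
  by rewrite mulrC -scalerA -e1 scalerA mulVf ?scale1r// gt_eqF.
apply: (@touch_unique a b x p s r) => //; rewrite ?ax ?bx ?ap//; first exact: ltW.
  have -> : x - p = (1 - s / r) *: (a - p).
    by rewrite scalerBl -xe scale1r; apply/rowP => i; rewrite !mxE; ring.
  rewrite enormZ ap ger0_norm; last by rewrite subr_ge0 ler_pdivrMr// mul1r ltW.
  by rewrite mulrBl mul1r divfK// gt_eqF.
by rewrite leNgt; apply/negP => /pO.
Qed.

Lemma tangent_inj_ext {s r a p q b x x' y} : 0 < s -> s < r ->
    tangent_balls Omega r a p q ->
    tangent_balls Omega s a x y -> tangent_balls Omega s b x' y -> a = b.
Proof.
move=> s0 sr t0 t1 t2; have r0 := lt_trans s0 sr.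
have [_ ap qE [pO qO]] := tangent_center r0 t0.
have [_ ax yE [xO yO]] := tangent_center s0 t1.
have [bb bx' yE' _] := tangent_center s0 t2.
have cOb : closure Omega b by move: bb; rewrite boundary_open => -[].
have aq : enorm (q - a) = r.
  by rewrite qE reflect_subr.
have := tangent_antipodal s0 r0 xO qO (eq_ler ax) (eq_ler aq) => e1.
have xe : a - x = (s / r) *: (q - a).
  by rewrite mulrC -scalerA -e1 scalerA mulVf ?scale1r// gt_eqF.
have ay : a - y = - (a - x).
  by rewrite yE mulr2n; apply/rowP => i; rewrite !mxE; ring.
have by_ : b - y = - (b - x').
  by rewrite yE' mulr2n; apply/rowP => i; rewrite !mxE; ring.
apply: (@touch_unique a b y q s r) => //; rewrite ?ay ?by_ ?enormN ?ax ?bx'//.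
- exact: ltW.
- have -> : y - q = - ((1 - s / r) *: (q - a)).
    rewrite scalerBl -xe scale1r yE mulr2n.
    by apply/rowP => i; rewrite !mxE; ring.
  rewrite enormN enormZ aq ger0_norm; last first.
    by rewrite subr_ge0 ler_pdivrMr// mul1r ltW.
  by rewrite mulrBl mul1r divfK// gt_eqF.
- by rewrite enorm_distC aq.
rewrite leNgt; apply/negP => bq.
have /closure_eballP/(_ (r - enorm (b - q))) := cOb.
rewrite subr_gt0 => /(_ bq)[z Oz zb].
suff : (eball q r `&` Omega) z by rewrite qO.
split => //; rewrite /eball/=.
by rewrite (le_lt_trans (ler_enorm_dist b _ _))//; lra.
Qed.

End tangency.

(** * Geometry of the reflection *)

Section reflection_geometry.
Variables (R : realType) (n : nat) (Omega : set 'rV[R]_n) (r eps : R).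
Hypothesis oO : open Omega.
Hypothesis tangents : forall a, boundary Omega a ->
  exists p q, tangent_balls Omega (2 * r) a p q.
Hypotheses (eps_gt0 : 0 < eps) (eps_le_r : eps <= r).
Implicit Types (x y a b : 'rV[R]_n) (s : R).

Local Notation T := (reflection Omega).

Lemma boundary_tangent_shrink {s a} : 0 < s -> s < 2 * r -> boundary Omega a ->
  exists x, tangent_balls Omega s a x (a *+ 2 - x).
Proof.
by move=> s0 sr /tangents[p [q /(tangent_shrink oO s0 sr)]].
Qed.

Lemma int_centerE {s a x y} : 0 < s -> tangent_balls Omega s a x y ->
  int_center Omega s a = x.
Proof.
move=> s0 t; rewrite /int_center; apply: xget_unique; first by exists y.
by move=> z [w tz]; have [] := tangent_unique oO s0 tz t.
Qed.

Lemma ext_centerE {s a x y} : 0 < s -> tangent_balls Omega s a x y ->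
  ext_center Omega s a = y.
Proof.
move=> s0 t; rewrite /ext_center; apply: xget_unique; first by exists x.
by move=> z [w tz]; have [] := tangent_unique oO s0 tz t.
Qed.

Lemma int_center_inj s : 0 < s -> s < 2 * r ->
  {in boundary Omega &, injective (int_center Omega s)}.
Proof.
move=> s0 sr a b; rewrite !inE => ba bb.
have [x tx] := boundary_tangent_shrink s0 sr ba.
have [y ty] := boundary_tangent_shrink s0 sr bb.
rewrite (int_centerE s0 tx) (int_centerE s0 ty) => xy; rewrite xy in tx.
have [p [q tp]] := tangents ba.
exact: (tangent_inj_int oO s0 sr tp tx ty).
Qed.

Lemma ext_center_inj s : 0 < s -> s < 2 * r ->
  {in boundary Omega &, injective (ext_center Omega s)}.
Proof.
move=> s0 sr a b; rewrite !inE => ba bb.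
have [x tx] := boundary_tangent_shrink s0 sr ba.
have [y ty] := boundary_tangent_shrink s0 sr bb.
rewrite (ext_centerE s0 tx) (ext_centerE s0 ty) => xy; rewrite xy in tx.
have [p [q tp]] := tangents ba.
exact: (tangent_inj_ext oO s0 sr tp tx ty).
Qed.

Lemma reflection_int {s a x y} : 0 < s -> s < 2 * r ->
  tangent_balls Omega s a x y -> T x = y.
Proof.
move=> s0 sr t; have [ba ax yE [xO yO]] := tangent_center oO s0 t.
have Ox : Omega x by apply: xO; rewrite /eball/= subrr enorm0.
have dx : dist_to (~` Omega) x = s%:E.
  apply: (@dist_toE _ _ _ _ a).
  - by apply: subset_closure; move: ba; rewrite boundary_open// => -[].
  - by rewrite enorm_distC ax.
  - move=> b nOb; rewrite enorm_distC leNgt; apply/negP => bx.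
    by apply: nOb; exact: xO.
rewrite /reflection mem_set// dx /= -[in X in ext_center _ _ X](int_centerE s0 t).
rewrite pinvKV ?inE//; first exact: (ext_centerE s0 t).
exact: int_center_inj.
Qed.

Lemma reflection_ext {s a x y} : 0 < s -> s < 2 * r ->
  tangent_balls Omega s a x y -> T y = x.
Proof.
move=> s0 sr t; have [ba ax yE [xO yO]] := tangent_center oO s0 t.
have Ey : eball y s y by rewrite /eball/= subrr enorm0.
have nO z : eball y s z -> ~ Omega z.
  by move=> yz Oz; suff : (eball y s `&` Omega) z by rewrite yO.
have ay : enorm (y - a) = s by rewrite yE reflect_subr.
have dy : dist_to Omega y = s%:E.
  apply: (@dist_toE _ _ _ _ a).
  - by move: ba; rewrite boundary_open// => -[].
  - by rewrite ay.
  - move=> b Ob; rewrite enorm_distC leNgt; apply/negP => byy.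
    by apply: (nO b).
rewrite /reflection memNset; last exact: nO.
rewrite mem_set; last by apply/nbhs_eballP; exists s.
rewrite dy /= -[in X in int_center _ _ X](ext_centerE s0 t).
rewrite pinvKV ?inE//; first exact: (int_centerE s0 t).
exact: ext_center_inj.
Qed.

Lemma reflection_boundary a : boundary Omega a -> T a = a.
Proof.
rewrite boundary_open// => -[/closure_eballP ca nOa].
rewrite /reflection !memNset// => /nbhs_eballP[s s0 sO].
by have [z Oz az] := ca s s0; apply: (sO z).
Qed.

(** A collar point is the center of the inner ball that touches the boundary
    at a nearest point of the complement. *)
Lemma collar_tangent x : Omega x -> collar Omega eps x ->
  exists s a, [/\ 0 < s, s < eps & tangent_balls Omega s a x (a *+ 2 - x)].
Proof.
move=> Ox; rewrite /collar/= => /ereal_inf_lt[_ [b bb <-]]; rewrite lte_fin => bx.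
have cD : closed (~` Omega) by exact: open_closedC.
have nOb : ~ Omega b by move: bb; rewrite boundary_open// => -[].
have [|a nOa amin] := @closed_nearest _ _ _ x cD; first by exists b.
have s0 : 0 < enorm (x - a).
  by rewrite enorm_gt0 subr_eq0; apply/eqP => xa; apply: nOa; rewrite -xa.
have xO : eball x (enorm (x - a)) `<=` Omega.
  move=> z; rewrite /eball/= => zx; apply: contrapT => nOz.
  by have := amin _ nOz; rewrite (enorm_distC x z) leNgt zx.
have ax : enorm (a - x) <= enorm (x - a) by rewrite enorm_distC.
have ba : boundary Omega a.
  rewrite boundary_open//; split=> //.
  by apply: (closure_subset xO); exact: eball_closure.
have seps : enorm (x - a) < eps by exact: le_lt_trans (amin _ nOb) bx.
exists (enorm (x - a)), a; split => //.
have [p [q tp]] := tangents ba.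
apply: (tangent_mk oO s0 _ tp) => //.
by have := eps_gt0; have := eps_le_r; lra.
Qed.

Lemma tangent_collar {s a x y} : 0 < s -> s < eps ->
  tangent_balls Omega s a x y -> collar Omega eps x /\ collar Omega eps y.
Proof.
move=> s0 seps t; have [ba ax yE _] := tangent_center oO s0 t.
by split; apply: (le_lt_trans (dist_to_le _ ba)); rewrite lte_fin;
  rewrite ?yE ?reflect_subr ?(enorm_distC x) ax.
Qed.

Lemma reflection_collar x : Omega x -> collar Omega eps x ->
  exists s, [/\ 0 < s, enorm (x - T x) = 2 * s,
    eball x s `<=` Omega, eball (T x) s `&` Omega = set0 &
    collar Omega eps (T x) /\ T (T x) = x].
Proof.
move=> Ox cx; have [s [a [s0 seps t]]] := collar_tangent Ox cx.
have sr : s < 2 * r by have := eps_gt0; have := eps_le_r; lra.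
have [ba ax _ [xO yO]] := tangent_center oO s0 t.
have [_ cy] := tangent_collar s0 seps t.
exists s; rewrite (reflection_int s0 sr t); split => //.
  have -> : x - (a *+ 2 - x) = - ((a - x) *+ 2).
    by rewrite !mulr2n; apply/rowP => i; rewrite !mxE; ring.
  by rewrite enormN -scaler_nat enormZ ger0_norm// ax.
by split => //; exact: (reflection_ext s0 sr t).
Qed.

(** The point of the closure that is farthest from a boundary point [b]
    has an inner ball of radius [s], whose center [x] is therefore closer to
    [b] by [s]. If the reflection did not expand distances, the mirror image of
    [x] would be as close to the fixed point [b] as [x] is, and so would be the
    farthest point, which is the midpoint. *)
Lemma reflection_expands alpha b : bounded_set Omega -> boundary Omega b ->
  (forall x y, collar Omega eps x -> collar Omega eps y ->
     enorm (T x - T y) <= alpha * enorm (x - y)) -> 1 < alpha.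
Proof.
move=> /bounded_set_enorm[M OM] bb lip; rewrite ltNge; apply/negP => alpha1.
have ccO : compact (closure Omega).
  apply: bounded_closed_compact; last exact: closed_closure.
  exists (M + 1); split; first exact: num_real.
  move=> N ltN z /closure_eballP/(_ 1 ltr01)[y Oy yz] /=.
  rewrite (le_trans (norm_le_enorm _))// (le_trans _ (ltW ltN))//.
  rewrite -[leLHS](_ : enorm (y + (z - y)) = _); last by rewrite addrC subrK.
  rewrite (le_trans (ler_enormD _ _))// lerD ?OM//.
  by rewrite enorm_distC ltW.
have [cOb nOb] : closure Omega b /\ ~ Omega b.
  by move: bb; rewrite boundary_open// => -[].
have cO0 : closure Omega !=set0 by exists b.
have [|a] := EVT_max_rV cO0 ccO (f := fun z => enorm (z - b)).
  by apply: continuous_subspaceT => z; exact: enorm_continuous.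
rewrite inE => cOa maxa.
have far z : Omega z -> enorm (z - b) <= enorm (a - b).
  by move=> Oz; apply: maxa; rewrite inE; exact: subset_closure.
have nOa : ~ Omega a.
  move=> Oa; have ab : 0 < enorm (a - b).
    by rewrite enorm_gt0 subr_eq0; apply/eqP => ab; apply: nOb; rewrite -ab.
  have /nbhs_eballP[e e0 eO] : nbhs a Omega by exact: open_nbhs_nbhs.
  pose t := e / (2 * enorm (a - b)).
  have t0 : 0 < t by rewrite divr_gt0// mulr_gt0.
  have te : t * enorm (a - b) = e / 2.
    by rewrite /t invfM mulrA mulfVK// gt_eqF.
  have /far : Omega (a + t *: (a - b)).
    apply: eO; rewrite /eball/= addrAC subrr add0r enormZ ger0_norm ?ltW// te.
    by lra.
  have -> : a + t *: (a - b) - b = (1 + t) *: (a - b).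
    by rewrite scalerDl scale1r addrAC.
  by rewrite enormZ ger0_norm; nra.
have ba : boundary Omega a by rewrite boundary_open.
pose s := eps / 2.
have s0 : 0 < s by rewrite divr_gt0.
have seps : s < eps by rewrite /s; have := eps_gt0; lra.
have sr : s < 2 * r by have := eps_gt0; have := eps_le_r; lra.
have [x t] := boundary_tangent_shrink s0 sr ba.
have [_ ax _ [xO _]] := tangent_center oO s0 t.
have [cx _] := tangent_collar s0 seps t.
have cb : collar Omega eps b.
  by apply: (le_lt_trans (dist_to_le _ bb)); rewrite lte_fin subrr enorm0.
have Ox : Omega x by apply: xO; rewrite /eball/= subrr enorm0.
have xb : enorm (x - b) <= enorm (a - b) - s.
  rewrite leNgt; apply/negP => lt_xb.
  have xb0 : 0 < enorm (x - b).
    by rewrite enorm_gt0 subr_eq0; apply/eqP => xb; apply: nOb; rewrite -xb.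
  have farx := far _ Ox.
  pose c := (enorm (a - b) - enorm (x - b) + s) / 2.
  pose u := c / enorm (x - b).
  have uc : u * enorm (x - b) = c by rewrite divfK// gt_eqF.
  have c0 : 0 < c by rewrite /c; lra.
  have u0 : 0 < u by rewrite divr_gt0.
  have /far : Omega (x + u *: (x - b)).
    apply: xO; rewrite /eball/= addrAC subrr add0r enormZ ger0_norm ?ltW// uc.
    by rewrite /c; lra.
  have -> : x + u *: (x - b) - b = (1 + u) *: (x - b).
    by rewrite scalerDl scale1r addrAC.
  rewrite enormZ ger0_norm; last by lra.
  by rewrite mulrDl mul1r uc /c; lra.
have := lip _ _ cx cb; rewrite (reflection_int s0 sr t) (reflection_boundary bb).
have := enorm_ge0 (x - b) => xb0 Txb.
have {}Txb : enorm (a *+ 2 - x - b) <= enorm (x - b) by nra.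
have := ler_enormD (x - b) (a *+ 2 - x - b).
have -> : x - b + (a *+ 2 - x - b) = 2 *: (a - b).
  by rewrite scaler_nat !mulr2n; apply/rowP => i; rewrite !mxE; ring.
by rewrite enormZ ger0_norm//; lra.
Qed.

End reflection_geometry.

(** * Borel measures bounded on cubes *)

Section sigma_finite_measure_of.
Context d (T : measurableType d) (R : realType) (mu : {measure set T -> \bar R}).

(** A copy of [mu] that carries a proof of sigma-finiteness, so that Tonelli's
    theorem applies to it. *)
Definition sf_measure (_ : sigma_finite setT mu) : set T -> \bar R := mu.

Hypothesis mu_sf : sigma_finite setT mu.
HB.instance Definition _ := Measure.on (sf_measure mu_sf).
HB.instance Definition _ := Measure_isSigmaFinite.Build _ _ _
  (sf_measure mu_sf) mu_sf.
End sigma_finite_measure_of.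

Section borel_measures.
Variables (R : realType) (n : nat).
Local Notation Rn := 'rV[R]_n.
Local Notation leb := (lebesgue_rV R n).
Implicit Types (x y z : Rn) (a e K : R) (A B F G : set Rn).

Lemma closed_measurable_rV A : closed A -> measurable A.
Proof.
move=> cA; rewrite -[A]setCK; apply: measurableC; apply: open_measurable_rV.
exact: closed_openC.
Qed.

Lemma continuous_measurable_rV (f : Rn -> R) :
  continuous f -> measurable_fun setT f.
Proof.
move=> cf; apply: (measurability _ (RGenOpens.measurableE R)).
move=> _ [_ [a [b ->] <-]]; rewrite setTI.
apply: open_measurable_rV; apply: open_comp; last exact: interval_open.
by move=> x _; exact: cf.
Qed.

Lemma measurable_rVB d (T : measurableType d) (f g : T -> Rn) :
  measurable_fun setT f -> measurable_fun setT g ->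
  measurable_fun setT (fun t => f t - g t).
Proof.
move=> /measurable_fun_rVP mf /measurable_fun_rVP mg.
apply/measurable_fun_rVP => i; under eq_fun do rewrite !mxE.
exact: measurable_funB.
Qed.

Lemma measurable_rVD d (T : measurableType d) (f g : T -> Rn) :
  measurable_fun setT f -> measurable_fun setT g ->
  measurable_fun setT (fun t => f t + g t).
Proof.
move=> /measurable_fun_rVP mf /measurable_fun_rVP mg.
apply/measurable_fun_rVP => i; under eq_fun do rewrite !mxE.
exact: measurable_funD.
Qed.

Lemma measurable_normrV : measurable_fun setT (fun x : Rn => `|x|).
Proof. by apply: continuous_measurable_rV; exact: norm_continuous. Qed.

Lemma measurable_enorm : measurable_fun setT (@enorm R n).
Proof.
have -> : @enorm R n = (fun x => enorm (x - 0)).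
  by apply/funext => x; rewrite subr0.
by apply: continuous_measurable_rV; exact: enorm_continuous.
Qed.

(** The balls of the sup norm, whose Lebesgue measure is explicit. *)
Definition cube z a : set Rn := [set y | `|y - z| < a].

Lemma cubeE z a : 0 < a -> cube z a = [set y : Rn | forall i, ball (z ord0 i) a (y ord0 i)].
Proof.
move=> a0; apply/seteqP; split => y; rewrite /cube/=.
  move=> ya i; rewrite -ball_normE/= distrC.
  by rewrite (le_lt_trans _ ya)//; have := coord_norm (y - z) i; rewrite !mxE.
move=> h; rewrite [ltLHS]/Num.norm /= mx_normrE; apply/bigmax_ltP; split => //.
by move=> [i j] _; rewrite ord1 !mxE distrC; have := h j; rewrite -ball_normE.
Qed.

Lemma lebesgue_cube z a : 0 < a -> leb (cube z a) = ((2 * a) ^+ n)%:E.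
Proof.
move=> a0; rewrite cubeE// (@lebesgue_rV_prod R n (fun i => ball (z ord0 i) a)); last first.
  by move=> i; exact: measurable_ball.
rewrite (eq_bigr (fun=> (2 * a)%:E)); last first.
  by move=> i _; rewrite lebesgue_measure_ball ?ltW// mulr_natl.
by rewrite prodEFin prodr_const card_ord.
Qed.

Lemma cube_open z a : open (cube z a).
Proof.
have -> : cube z a = (fun y : Rn => `|y - z|) @^-1` [set t | t < a] by [].
apply: open_comp; last exact: open_lt.
move=> y _; apply: (@continuous_comp _ _ _ (fun y : Rn => y - z) (@Num.norm _ Rn)).
  by apply: continuousB => //; exact: cst_continuous.
exact: norm_continuous.
Qed.

Lemma measurable_cube z a : measurable (cube z a).
Proof. by apply: open_measurable_rV; exact: cube_open. Qed.

Lemma eball_cube z a : eball z a `<=` cube z a.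
Proof. by move=> y; exact: le_lt_trans (norm_le_enorm _). Qed.

(** The inner parallel set of [G]. These closed sets increase to [G] when [G]
    is open, which serves both for regularity and for the comparison of
    measures below. *)
Definition erosion G a : set Rn := [set x | cube x a `<=` G].

Lemma erosion_sub G a : 0 < a -> erosion G a `<=` G.
Proof. by move=> a0 x; apply; rewrite /cube/= subrr normr0. Qed.

Lemma erosion_closed G a : closed (erosion G a).
Proof.
rewrite -[erosion G a]setCK; apply: open_closedC; rewrite openE => x /= nx.
have [y yx nGy] : exists2 y, cube x a y & ~ G y.
  by apply: contrapT => h; apply: nx => y xy; apply: contrapT => nGy; apply: h; exists y.
have : nbhs x (cube y a).
  apply: open_nbhs_nbhs; split; first exact: cube_open.
  by rewrite /cube/= distrC.
apply: filterS => z zy zG; apply: nGy; apply: zG.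
by rewrite /cube/= distrC.
Qed.

Lemma inv_nat_lt e : 0 < e -> exists k, k.+1%:R^-1 < e.
Proof.
move=> e0; exists (Num.truncn e^-1).
rewrite -[ltRHS]invrK ltf_pV2 ?posrE ?invr_gt0//.
by have /andP[] := truncn_itv (ltW (etrans (invr_gt0 e) e0)).
Qed.

Lemma erosion_bigcup G : open G -> \bigcup_k erosion G k.+1%:R^-1 = G.
Proof.
move=> oG; apply/seteqP; split => [x [k _]|x Gx].
  by apply: erosion_sub; rewrite invr_gt0.
have /nbhs_ballP[e /= e0 eG] : nbhs x G by exact: open_nbhs_nbhs.
have [k ke] := inv_nat_lt e0.
exists k => // y; rewrite /cube/= => yx; apply: eG.
by rewrite -ball_normE/= distrC; apply: lt_trans yx _.
Qed.

Lemma erosion_nondecreasing G :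
  {homo (fun k => erosion G k.+1%:R^-1) : k l / (k <= l)%N >-> (k <= l)%O}.
Proof.
move=> k l kl; apply/subsetPset => x xG y; rewrite /cube/= => yx; apply: xG.
by rewrite /cube/= (lt_le_trans yx)// lef_pV2 ?posrE// ler_nat ltnS.
Qed.

(** Sets squeezed between a closed and an open set that differ by little
    measure form a sigma-algebra containing the open sets. *)
Lemma borel_regular (mu : {measure set Rn -> \bar R}) A e :
    (mu setT < +oo)%E -> measurable A -> 0 < e ->
  exists F G, [/\ closed F, open G, F `<=` A, A `<=` G &
    (mu (G `\` F) < e%:E)%E].
Proof.
move=> muT mA; move: e.
pose C := [set A : set Rn | forall e : R, 0 < e -> exists F G,
  [/\ closed F, open G, F `<=` A, A `<=` G & (mu (G `\` F) < e%:E)%E]].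
have mD F G : closed F -> open G -> measurable (G `\` F).
  move=> cF oG; apply: measurableD; first exact: open_measurable_rV.
  exact: closed_measurable_rV.
suff : C A by [].
have fin B : measurable B -> (mu B < +oo)%E.
  move=> mB; apply: le_lt_trans muT; apply: le_measure; rewrite ?inE//. 
have small (D : nat -> set Rn) (e : R) : (forall k, measurable (D k)) ->
    {homo D : k l / (k <= l)%N >-> (l <= k)%O} ->
    (mu (\bigcap_k D k) < e%:E)%E -> exists k, (mu (D k) < e%:E)%E.
  move=> mDk ndD De.
  have mcap : measurable (\bigcap_k D k) by exact: bigcapT_measurable.
  have cv := nonincreasing_cvg_mu (fin _ (mDk 0)) mDk mcap ndD.
  apply: contrapT => hk; move: De; rewrite ltNge => /negP; apply.
  rewrite -(cvg_lim _ cv)//; apply: lime_ge; first by apply/cvg_ex; eexists; exact: cv.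
  apply: nearW => k /=; rewrite leNgt; apply/negP => ?; apply: hk.
  by exists k.
have Copen G : open G -> C G.
  move=> oG e e0.
  have [||| k ke] := small (fun k => G `\` erosion G k.+1%:R^-1) e.
  - by move=> k; apply: mD => //; exact: erosion_closed.
  - move=> k l /(erosion_nondecreasing G)/subsetPset h; apply/subsetPset.
    by apply: setDS.
  - by rewrite bigcupDr// erosion_bigcup// setDv measure0.
  exists (erosion G k.+1%:R^-1), G; split => //.
  + exact: erosion_closed.
  + by apply: erosion_sub; rewrite invr_gt0.
apply: (@smallest_sub _ (sigma_algebra setT) _ C _ _ A mA) => //.
split => [| B CB e e0 | B CB e e0].
- exact: Copen open0.
- have [F [G [cF oG FB BG GF]]] := CB e e0.
  exists (~` G), (~` F); split.
  + exact: open_closedC.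
  + exact: closed_openC.
  + by rewrite setTD; apply: subsetC.
  + by rewrite setTD; apply: subsetC.
  + by rewrite setDE setCK setIC -setDE.
- have e20 k : 0 < e / 2 / (2 ^ k.+1)%:R by rewrite !divr_gt0// ltr0n expn_gt0.
  have /choice[F /choice[G FG]] := fun k => CB k _ (e20 k).
  have mF k : measurable (F k).
    by apply: closed_measurable_rV; have [] := FG k.
  have mG k : measurable (G k).
    by apply: open_measurable_rV; have [] := FG k.
  have mUF N : measurable (\bigcup_(i < N) F i).
    by apply: bigcup_measurable => i _.
  have UF : \bigcup_N \bigcup_(i < N) F i = \bigcup_i F i.
    apply/seteqP; split => x; first by move=> [N _ [i _ Fi]]; exists i.
    by move=> [i _ Fi]; exists i.+1 => //; exists i => /=.
  have [||| N Ne] := small (fun N => \bigcup_i G i `\` \bigcup_(i < N) F i) e.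
  + by move=> N; apply: measurableD; first exact: bigcupT_measurable.
  + move=> k l kl; apply/subsetPset; apply: setDS => x [i /= ik Fi].
    by exists i => //=; exact: leq_trans ik kl.
  + rewrite bigcupDr// UF.
    apply: (@le_lt_trans _ _ (e / 2)%:E); last first.
      by rewrite lte_fin ltr_pdivrMr// mulr_natr mulr2n ltrDl.
    apply: le_trans (epsilon_trick0 xpredT (ltW (divr_gt0 e0 (ltr0n R 2)))).
    apply: (@le_trans _ _ (\sum_(0 <= k <oo) mu (G k `\` F k))%E); last first.
      apply: lee_nneseries => [k *|k *]; first exact: measure_ge0.
      by apply: ltW; have [] := FG k.
    apply: measure_sigma_subadditive => //.
    * by move=> k; apply: measurableD.
    * by apply: measurableD; exact: bigcupT_measurable.
    * move=> x [[k _ Gk] nF]; exists k => //; split => // Fk.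
      by apply: nF; exists k.
  exists (\bigcup_(i < N) F i), (\bigcup_i G i); split => //.
  + apply: closed_bigcup => [|k _]; first exact: finite_II.
    by have [] := FG k.
  + by apply: bigcup_open => k _; have [] := FG k.
  + move=> x [k _ Fk]; exists k => //; have [_ _ FB _ _] := FG k.
    exact: FB.
  + move=> x [k _ Bk]; exists k => //; have [_ _ _ BG _] := FG k.
    exact: BG.
Qed.


Section cube_bounded_measure.
Variables (mu : {measure set Rn -> \bar R}) (K : R).
Hypothesis K_ge0 : 0 <= K.
Hypothesis mu_cube : forall z a, 0 < a ->
  (mu (cube z a) <= (K * (2 * a) ^+ n)%:E)%E.

Lemma cube_bounded_sigma_finite : sigma_finite setT mu.
Proof.
exists (fun k => cube 0 k.+1%:R).
  apply/seteqP; split=> // x _; exists (Num.truncn `|x|) => //.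
  rewrite /cube/= subr0.
  by have /andP[] := truncn_itv (normr_ge0 x).
move=> k; split; first exact: measurable_cube.
by apply: (le_lt_trans (mu_cube _ _)); rewrite ?ltry.
Qed.

Lemma measurable_dist a :
  measurable [set p : Rn * Rn | `|p.2 - p.1| < a].
Proof.
have mf : measurable_fun setT (fun p : Rn * Rn => `|p.2 - p.1|).
  apply: (measurableT_comp measurable_normrV).
  by apply: measurable_rVB; [exact: measurable_snd|exact: measurable_fst].
have := mf measurableT _ (measurable_itv `]-oo, a[).
by rewrite setTI; congr measurable; apply/seteqP; split => p /=; rewrite in_itv.
Qed.

(** Averaging the indicator of [cube x a] over [x] in two orders compares
    [mu] with the Lebesgue measure on the points whose cube stays in [G]. *)
Lemma cube_bounded_erosion G a : open G -> 0 < a ->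
  (mu (erosion G a) <= K%:E * leb G)%E.
Proof.
move=> oG a0.
have mE : measurable (erosion G a).
  by apply: closed_measurable_rV; exact: erosion_closed.
have mG : measurable G by exact: open_measurable_rV.
have c0 : 0 < (2 * a) ^+ n by rewrite exprn_gt0// mulr_gt0.
pose A := [set p : Rn * Rn | erosion G a p.1 /\ `|p.2 - p.1| < a].
have mA : measurable A.
  apply: measurableI; last exact: measurable_dist.
  rewrite -[X in measurable X]setTI.
  exact: (@measurable_fst _ _ Rn Rn).
pose f (p : Rn * Rn) : \bar R := (\1_A p)%:E.
have mf : measurable_fun setT f.
  by apply/measurable_EFinP; exact: measurable_indic.
have f0 p : (0 <= f p)%E by rewrite lee_fin.
have := @fubini_tonelli _ _ Rn Rn R (sf_measure cube_bounded_sigma_finite)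
  leb f mf f0.
have -> : (\int[sf_measure cube_bounded_sigma_finite]_x \int[leb]_y f (x, y) =
           ((2 * a) ^+ n)%:E * mu (erosion G a))%E.
  rewrite -[in RHS](setIT (erosion G a)) -integral_indic// -ge0_integralZl_EFin//=; last 2 first.
  - by apply/measurable_EFinP; exact: measurable_indic.
  - exact: ltW.
  apply: eq_integral => x _; rewrite /f.
  have [xE|xE] := pselect (erosion G a x).
    rewrite indicE mem_set// mule1 -(lebesgue_cube x a0).
    rewrite -[in RHS](setIT (cube x a)) -integral_indic//; last exact: measurable_cube.
    apply: eq_integral => y _; rewrite !indicE; congr ((nat_of_bool _)%:R%:E); apply/idP/idP;
      by rewrite !inE => //; case.
  rewrite indicE memNset// mule0 integral0_eq// => y _.
  by rewrite indicE memNset// => -[].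
move=> eqI; have : (((2 * a) ^+ n)%:E * mu (erosion G a) <=
    ((2 * a) ^+ n)%:E * (K%:E * leb G))%E.
  rewrite eqI -[in leRHS](setIT G) -integral_indic//.
  rewrite muleA -EFinM -ge0_integralZl_EFin//=; last 2 first.
  - by apply/measurable_EFinP; exact: measurable_indic.
  - by rewrite mulr_ge0// ltW.
  apply: ge0_le_integral => //.
  - by move=> y _; apply: integral_ge0.
  - exact: (measurable_fun_fubini_tonelli_G 
      (m1 := sf_measure cube_bounded_sigma_finite) f mf f0).
  - by apply: measurable_funeM; apply/measurable_EFinP; exact: measurable_indic.
  move=> y _.
  have [Gy|nGy] := pselect (G y); last first.
    rewrite integral0_eq ?indicE ?memNset ?mule0// => x _; rewrite /f indicE memNset//.
    by move=> [/= xE yx]; apply: nGy; exact: xE.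
  rewrite indicE mem_set// mule1 mulrC.
  apply: le_trans (mu_cube y a0).
  rewrite -[in leRHS](setIT (cube y a)).
  rewrite -(@integral_indic _ _ _ mu); [|exact: measurableT|exact: measurable_cube].
  apply: ge0_le_integral => //.
  - by apply/measurable_EFinP; apply: measurableT_comp => //; exact: measurable_indic.
  - by apply/measurable_EFinP; apply: measurable_indic; exact: measurable_cube.
  move=> x _; rewrite lee_fin !indicE ler_nat.
  by case: (boolP ((x, y) \in A)) => //; rewrite inE => -[_ /= yx]; rewrite mem_set// /cube/= distrC.
by rewrite lee_pmul2l ?fin_numE// lte_fin.
Qed.

Lemma cube_bounded_open G : open G -> (mu G <= K%:E * leb G)%E.
Proof.
move=> oG; rewrite -[in leLHS](erosion_bigcup oG).
have mE k : measurable (erosion G k.+1%:R^-1).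
  by apply: closed_measurable_rV; exact: erosion_closed.
have cv := nondecreasing_cvg_mu (mu := mu) mE (bigcupT_measurable _ mE)
  (@erosion_nondecreasing G).
rewrite -(cvg_lim _ cv)//; apply: lime_le; first by apply/cvg_ex; eexists; exact: cv.
by apply: nearW => k /=; apply: cube_bounded_erosion => //; rewrite invr_gt0.
Qed.

(** Outer regularity of the Lebesgue measure on bounded sets extends the
    comparison from open sets to Borel sets. *)
Lemma cube_bounded_le_lebesgue A : measurable A -> (mu A <= K%:E * leb A)%E.
Proof.
move=> mA.
pose Q k := cube (0 : Rn) k.+1%:R.
have mQ k : measurable (Q k) by exact: measurable_cube.
have bnd k : (mu (A `&` Q k) <= K%:E * leb A)%E.
  have finQ : (mrestr leb (mQ k) setT < +oo)%E.
    by rewrite /mrestr setTI lebesgue_cube ?ltry.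
  apply/lee_addgt0Pr => e e0.
  pose e' := e / (K + 1).
  have K1 : 0 < K + 1 by rewrite ltr_wpDl.
  have e'0 : 0 < e' by rewrite divr_gt0.
  have [F [G [cF oG FA AG GF]]] := borel_regular finQ mA e'0.
  have mG : measurable G by exact: open_measurable_rV.
  have mF : measurable F by exact: closed_measurable_rV.
  have oGQ : open (G `&` Q k) by apply: openI => //; exact: cube_open.
  apply: (@le_trans _ _ (mu (G `&` Q k))).
    by apply: le_measure; rewrite ?inE; [exact: measurableI|exact: measurableI|exact: setSI].
  apply: le_trans (cube_bounded_open oGQ) _.
  apply: (@le_trans _ _ (K%:E * (leb A + e'%:E)))%E.
    rewrite lee_wpmul2l// ?lee_fin//.
    apply: (@le_trans _ _ (leb (A `|` (G `\` F) `&` Q k))).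
      apply: le_measure; rewrite ?inE.
      - exact: measurableI.
      - by apply: measurableU => //; apply: measurableI => //; exact: measurableD.
      - move=> x [Gx Qx]; have [Fx|nFx] := pselect (F x); first by left; exact: FA.
        by right.
    apply: le_trans (measureU2 _ _ _) _ => //.
      by apply: measurableI => //; exact: measurableD.
    by rewrite leeD2l// ltW.
  rewrite ge0_muleDr ?lee_fin//; last exact: ltW.
  rewrite leeD2l// -EFinM lee_fin /e'.
  rewrite mulrA ler_pdivrMr// mulrC ler_wpM2l//; first exact: ltW.
  by rewrite lerDl.
have mAQ k : measurable (A `&` Q k) by exact: measurableI.
have AQ : \bigcup_k (A `&` Q k) = A.
  rewrite -setI_bigcupr; apply/setIidPl => x _; exists (Num.truncn `|x|) => //.
  by rewrite /Q /cube/= subr0; have /andP[] := truncn_itv (normr_ge0 x).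
have ndAQ : {homo (fun k => A `&` Q k) : k l / (k <= l)%N >-> (k <= l)%O}.
  move=> k l kl; apply/subsetPset; apply: setIS => x; rewrite /Q /cube/= => xk.
  by rewrite (lt_le_trans xk)// ler_nat.
have cv := nondecreasing_cvg_mu (mu := mu) mAQ (bigcupT_measurable _ mAQ) ndAQ.
rewrite -[in leLHS]AQ -(cvg_lim _ cv)//.
apply: lime_le; first by apply/cvg_ex; eexists; exact: cv.
by apply: nearW => k /=.
Qed.

End cube_bounded_measure.
End borel_measures.

(** * Densities and changes of variables *)

Section density.
Context d (T : measurableType d) (R : realType).
Variables (mu nu : {measure set T -> \bar R}) (w : T -> R).
Hypotheses (w_ge0 : forall x, 0 <= w x) (mw : measurable_fun setT w).
Hypothesis nuE : forall A, measurable A -> nu A = (\int[mu]_(x in A) (w x)%:E)%E.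

Import HBNNSimple.

Lemma integral_density (f : T -> \bar R) : (forall x, (0 <= f x)%E) ->
  measurable_fun setT f ->
  (\int[nu]_x f x = \int[mu]_x (f x * (w x)%:E))%E.
Proof.
move=> f0 mf; pose h := nnsfun_approx measurableT mf.
have mwE : measurable_fun setT (EFin \o w) by exact/measurable_EFinP.
have -> : (\int[nu]_x f x = lim (\int[nu]_x (h n x)%:E @[n --> \oo]))%E.
  rewrite -monotone_convergence//.
  - apply: eq_integral => x _; apply/esym/cvg_lim => //.
    exact: cvg_nnsfun_approx.
  - by move=> k; exact/measurable_EFinP.
  - by move=> k x _; rewrite lee_fin.
  - by move=> x _ a b ab; rewrite lee_fin; exact/lefP/nd_nnsfun_approx.
have -> : (\int[mu]_x (f x * (w x)%:E) =
    lim (\int[mu]_x ((h n x)%:E * (w x)%:E) @[n --> \oo]))%E.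
  rewrite -monotone_convergence//.
  - apply: eq_integral => x _; apply/esym/cvg_lim => //.
    by apply: cvgeZr => //; exact: cvg_nnsfun_approx.
  - by move=> k; apply: emeasurable_funM => //; exact/measurable_EFinP.
  - by move=> k x _; rewrite mule_ge0// lee_fin.
  - move=> x _ a b ab; rewrite lee_wpmul2r ?lee_fin//.
    exact/lefP/nd_nnsfun_approx.
suff suf k : (\int[nu]_x (h k x)%:E = \int[mu]_x ((h k x)%:E * (w x)%:E))%E.
  by under eq_fun do rewrite suf.
have mpre r : measurable (h k @^-1` [set r]) by [].
under eq_integral => x _ do rewrite fimfunE -fsumEFin//.
rewrite ge0_integral_fsum//; last 2 first.
- move=> r; apply/measurable_EFinP; apply: measurable_funM => //.
- by move=> r x _; exact: nnfun_muleindic_ge0.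
under [RHS]eq_integral => x _.
  rewrite fimfunE -fsumEFin// ge0_mule_fsuml; last first.
    by move=> r; exact: nnfun_muleindic_ge0.
  over.
rewrite ge0_integral_fsum//; last 2 first.
- move=> r; apply: emeasurable_funM => //; apply/measurable_EFinP.
  exact: measurable_funM.
- by move=> r x _; apply: mule_ge0; [exact: nnfun_muleindic_ge0|rewrite lee_fin].
apply: eq_fsbigr => r; rewrite inE => -[x0 _ hr].
have r0 : 0 <= r by rewrite -hr.
under eq_integral do rewrite EFinM.
rewrite ge0_integralZl_EFin//; last exact/measurable_EFinP.
under [RHS]eq_integral do rewrite EFinM -muleA.
rewrite ge0_integralZl_EFin//; last 2 first.
- by move=> x _; rewrite mule_ge0// lee_fin.
- by apply: emeasurable_funM => //; exact/measurable_EFinP.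
congr (_ * _)%E; rewrite integral_indic// setIT nuE// integral_mkcond.
apply: eq_integral => x _; rewrite patchE indicE.
by case: ifP => _; rewrite ?mul1e ?mul0e.
Qed.

End density.

Section lebesgue_images.
Variables (R : realType) (n : nat).
Local Notation Rn := 'rV[R]_n.
Local Notation leb := (lebesgue_rV R n).

(** A change of variables up to a constant, where an upper bound on the
    measure of the preimages of cubes takes the place of a Jacobian. *)
Lemma integral_comp_le (S : Rn -> Rn) (E : set Rn) (K : R) (f : Rn -> \bar R) :
    measurable_fun setT S -> measurable E -> 0 <= K ->
    (forall z a, 0 < a ->
      (leb (S @^-1` cube z a `&` E) <= (K * (2 * a) ^+ n)%:E)%E) ->
    (forall x, (0 <= f x)%E) -> measurable_fun setT f ->
  (\int[leb]_x (f (S x) * (\1_E x)%:E) <= K%:E * \int[leb]_x f x)%E.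
Proof.
move=> mS mE K0 SK f0 mf.
pose mu := pushforward (mrestr leb mE) S.
have muE : (\int[mu]_x f x = \int[leb]_x (f (S x) * (\1_E x)%:E))%E.
  rewrite (ge0_integral_pushforward mS)// preimage_setT.
  apply: (@integral_density _ _ _ leb (mrestr leb mE) (\1_E)) => //.
  - by move=> A mA; rewrite integral_indic// setIC.
  - by move=> x /=.
  - exact: measurableT_comp.
rewrite -muE -(@ge0_integral_mscale _ _ _ leb _ measurableT (NngNum K0))//.
apply: ge0_le_measure_integral => // A mA.
by apply: cube_bounded_le_lebesgue.
Qed.

Lemma lebesgue_translate_cube (b : Rn) z a : 0 < a ->
  leb ((fun x => x + b) @^-1` cube z a) = ((2 * a) ^+ n)%:E.
Proof.
move=> a0; rewrite -(lebesgue_cube (z - b) a0); congr (leb _).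
by apply/seteqP; split => x; rewrite /cube/= opprB addrA.
Qed.

(** Translating by [b] and by [- b] does not increase integrals. *)
Lemma integral_translate (b : Rn) (f : Rn -> \bar R) :
  (forall x, (0 <= f x)%E) -> measurable_fun setT f ->
  (\int[leb]_x f (x + b)%R = \int[leb]_x f x)%E.
Proof.
move=> f0 mf.
have mt c : measurable_fun setT (fun x : Rn => x + c).
  by apply: measurable_rVD => //; exact: measurable_cst.
have le c (g : Rn -> \bar R) : (forall x, (0 <= g x)%E) -> measurable_fun setT g ->
    (\int[leb]_x g (x + c)%R <= \int[leb]_x g x)%E.
  move=> g0 mg; rewrite -[leRHS]mul1e.
  have -> : (\int[leb]_x g (x + c)%R =
      \int[leb]_x (g (x + c)%R * (\1_[set: Rn] x)%:E))%E.
    by apply: eq_integral => x _; rewrite indicT mule1.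
  apply: (integral_comp_le (mt c)) => // z a a0.
  by rewrite setIT lebesgue_translate_cube// mul1r.
apply/eqP; rewrite eq_le le//=.
have mfb : measurable_fun setT (fun x : Rn => f (x + b)).
  exact: measurableT_comp.
have := le (- b) _ (fun x => f0 (x + b)) mfb; congr (_ <= _)%E.
by apply: eq_integral => x _; rewrite subrK.
Qed.

End lebesgue_images.

(** * Iterated integrals of nonnegative functions *)

Section nonnegative_integrals.
Context d (T : measurableType d) (R : realType).

Lemma measurable_set_lt (f g : T -> R) : measurable_fun setT f ->
  measurable_fun setT g -> measurable [set t | f t < g t].
Proof.
move=> mf mg; have := measurable_fun_ltr mf mg.
move=> /(_ measurableT [set true] I); rewrite setTI; congr measurable.
Qed.

Lemma measurable_inv (f : T -> R) : (forall t, 0 <= f t) ->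
  measurable_fun setT f -> measurable_fun setT (fun t => (f t)^-1).
Proof.
move=> f0 mf; have -> : (fun t => (f t)^-1) = (fun t => f t `^ (-1)).
  by apply/funext => t; rewrite powR_inv1.
exact: (measurableT_comp (measurable_powR (-1)) mf).
Qed.

Lemma le_integralT (mu : {measure set T -> \bar R}) (f g : T -> \bar R) :
  (forall x, (0 <= f x)%E) -> measurable_fun setT f -> measurable_fun setT g ->
  (forall x, (f x <= g x)%E) -> (\int[mu]_x f x <= \int[mu]_x g x)%E.
Proof.
move=> f0 mf mg fg; apply: ge0_le_integral => //.
Qed.

Lemma integral_ZD (mu : {measure set T -> \bar R}) (c : R) (f g : T -> \bar R) :
  0 <= c ->
  (forall x, (0 <= f x)%E) -> (forall x, (0 <= g x)%E) ->
  measurable_fun setT f -> measurable_fun setT g ->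
  (\int[mu]_x (c%:E * f x + g x) = c%:E * \int[mu]_x f x + \int[mu]_x g x)%E.
Proof.
move=> c0 f0 g0 mf mg; rewrite ge0_integralD//; last 2 first.
- by move=> x _; rewrite mule_ge0// lee_fin.
- exact: measurable_funeM.
by rewrite ge0_integralZl_EFin.
Qed.

End nonnegative_integrals.

Section tonelli.
Variables (R : realType) (n : nat).
Local Notation Rn := 'rV[R]_n.
Local Notation leb := (lebesgue_rV R n).

Lemma tonelli (f : Rn -> Rn -> \bar R) :
  (forall x y, (0 <= f x y)%E) ->
  measurable_fun setT (fun p : Rn * Rn => f p.1 p.2) ->
  (\int[leb]_x \int[leb]_y f x y = \int[leb]_y \int[leb]_x f x y)%E.
Proof.
move=> f0 mf.
exact: (@fubini_tonelli _ _ Rn Rn R leb leb (fun p => f p.1 p.2) mf (fun=> f0 _ _)).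
Qed.

Lemma measurable_partial_integral d (T : measurableType d) (f : T -> Rn -> \bar R) :
  (forall x y, (0 <= f x y)%E) ->
  measurable_fun setT (fun p : T * Rn => f p.1 p.2) ->
  measurable_fun setT (fun x => \int[leb]_y f x y)%E.
Proof.
move=> f0 mf.
exact: (@measurable_fun_fubini_tonelli_F _ _ T Rn R leb (fun p => f p.1 p.2) mf (fun=> f0 _ _)).
Qed.

Lemma integral2_ZD (c : R) (f g : Rn -> Rn -> \bar R) : 0 <= c ->
  (forall x y, (0 <= f x y)%E) -> (forall x y, (0 <= g x y)%E) ->
  measurable_fun setT (fun p : Rn * Rn => f p.1 p.2) ->
  measurable_fun setT (fun p : Rn * Rn => g p.1 p.2) ->
  (\int[leb]_x \int[leb]_y (c%:E * f x y + g x y) =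
   c%:E * \int[leb]_x \int[leb]_y f x y + \int[leb]_x \int[leb]_y g x y)%E.
Proof.
move=> c0 f0 g0 mf mg; rewrite -integral_ZD//.
- apply: eq_integral => x _; rewrite integral_ZD//.
  + exact: (measurable_fun_pair2 x mf).
  + exact: (measurable_fun_pair2 x mg).
- by move=> x; exact: integral_ge0.
- by move=> x; exact: integral_ge0.
- exact: measurable_partial_integral.
- exact: measurable_partial_integral.
Qed.

Lemma integral2_D (f g : Rn -> Rn -> \bar R) :
  (forall x y, (0 <= f x y)%E) -> (forall x y, (0 <= g x y)%E) ->
  measurable_fun setT (fun p : Rn * Rn => f p.1 p.2) ->
  measurable_fun setT (fun p : Rn * Rn => g p.1 p.2) ->
  (\int[leb]_x \int[leb]_y (f x y + g x y) =
   \int[leb]_x \int[leb]_y f x y + \int[leb]_x \int[leb]_y g x y)%E.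
Proof.
move=> f0 g0 mf mg; rewrite -[in RHS](mul1e (\int[leb]_x \int[leb]_y f x y)%E).
rewrite -integral2_ZD//.
by do 2 (apply: eq_integral => ? _); rewrite mul1e.
Qed.

Lemma integral2_Zl (c : R) (f : Rn -> Rn -> \bar R) : 0 <= c ->
  (forall x y, (0 <= f x y)%E) ->
  measurable_fun setT (fun p : Rn * Rn => f p.1 p.2) ->
  (\int[leb]_x \int[leb]_y (c%:E * f x y) =
   c%:E * \int[leb]_x \int[leb]_y f x y)%E.
Proof.
move=> c0 f0 mf; rewrite -ge0_integralZl_EFin//.
- apply: eq_integral => x _; rewrite ge0_integralZl_EFin//.
  exact: (measurable_fun_pair2 x mf).
- by move=> x _; exact: integral_ge0.
- exact: measurable_partial_integral.
Qed.

Lemma le_integral2 (f g : Rn -> Rn -> \bar R) :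
  (forall x y, (0 <= f x y)%E) ->
  measurable_fun setT (fun p : Rn * Rn => f p.1 p.2) ->
  measurable_fun setT (fun p : Rn * Rn => g p.1 p.2) ->
  (forall x y, (f x y <= g x y)%E) ->
  (\int[leb]_x \int[leb]_y f x y <= \int[leb]_x \int[leb]_y g x y)%E.
Proof.
move=> f0 mf mg fg; apply: le_integralT.
- by move=> x; exact: integral_ge0.
- exact: measurable_partial_integral.
- apply: measurable_partial_integral => // x y.
  exact: le_trans (f0 x y) (fg x y).
move=> x; apply: le_integralT => //.
- exact: (measurable_fun_pair2 x mf).
- exact: (measurable_fun_pair2 x mg).
Qed.

Variable f : Rn -> Rn -> Rn -> \bar R.
Hypothesis f_ge0 : forall x y z, (0 <= f x y z)%E.
Hypothesis mf : measurable_fun setT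
  (fun p : Rn * Rn * Rn => f p.1.1 p.1.2 p.2).

Lemma tonelli_xzy : (\int[leb]_x \int[leb]_y \int[leb]_z f x y z =
  \int[leb]_x \int[leb]_z \int[leb]_y f x y z)%E.
Proof.
apply: eq_integral => x _; apply: tonelli => //.
have mg : measurable_fun setT (fun p : Rn * Rn => ((x, p.1), p.2)).
  apply: measurable_fun_pair => //; apply: measurable_fun_pair => //.
exact: (measurableT_comp mf mg).
Qed.

Lemma tonelli_yzx : (\int[leb]_x \int[leb]_y \int[leb]_z f x y z =
  \int[leb]_y \int[leb]_z \int[leb]_x f x y z)%E.
Proof.
rewrite tonelli; last 2 first.
- by move=> x y; exact: integral_ge0.
- apply: (@measurable_partial_integral _ (Rn * Rn)%type
    (fun p z => f p.1 p.2 z)) => //.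
apply: eq_integral => y _; apply: tonelli => //.
have mg : measurable_fun setT (fun p : Rn * Rn => ((p.1, y), p.2)).
  apply: measurable_fun_pair => //; apply: measurable_fun_pair => //.
exact: (measurableT_comp mf mg).
Qed.

End tonelli.

(** * Pairs of points and relay points *)

Lemma indic_ge0 (R : realType) T (A : set T) (u : T) : 0 <= \1_A u :> R.
Proof. by rewrite indicE. Qed.

Lemma sqr_sub_le (R : realDomainType) (a b c : R) :
  (a - c) ^+ 2 <= 2 * (a - b) ^+ 2 + 2 * (b - c) ^+ 2.
Proof. by have := sqr_ge0 (a - b - (b - c)); rewrite !expr2; lra. Qed.

Section folded_form.
Variables (R : realType) (n : nat) (i0 : 'I_n).
Local Notation Rn := 'rV[R]_n.
Local Notation leb := (lebesgue_rV R n).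
Variables (D W : set Rn) (S : Rn -> Rn) (k : R -> R) (g : Rn -> R).
Variables (alpha B C : R).
Implicit Types (x y w : Rn) (s t : R).

Definition form_integrand x y : R :=
  \1_D x * \1_D y * (g x - g y) ^+ 2 * k (enorm (x - y)).
Local Notation q := form_integrand.

Definition fold_gap y : R := enorm (y - S y).

(** The pairs for which [x] is much closer to the image [S y] of [y] than to
    [y] itself. There the kernel at [x - y] is not controlled by the kernel at
    [x - S y]. *)
Definition mirror_pairs : set (Rn * Rn) :=
  [set p | [/\ D p.1, W p.2 & enorm (p.1 - S p.2) < fold_gap p.2 / 32]].

Definition mirror_integrand x y : R :=
  \1_mirror_pairs (x, y) * ((g x - g (S y)) ^+ 2 * k (enorm (x - y))).

(** The relay points of [y] fill a cube near [S y]. With [s] the distance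
    from [y] to [D], which is half of [fold_gap y], they are at distance about
    [s / 4] from [S y], hence still in [D] and at distance comparable to [s]
    from every [x] that is within [s / 16] of [S y]. The factor [n%:R] in the
    radius converts the sup norm to the Euclidean norm. *)
Definition relay_center y : Rn := S y + (fold_gap y / 8) *: delta_mx ord0 i0.

Definition relay_radius y : R := fold_gap y / (32 * n%:R).

Definition relays : set (Rn * Rn * Rn) :=
  [set p | mirror_pairs p.1 /\ cube (relay_center p.1.2) (relay_radius p.1.2) p.2].

Hypothesis S_id : forall x, D x -> S x = x.
Hypothesis S_fold : forall y, W y -> exists s, [/\ 0 < s,
  enorm (y - S y) = 2 * s, eball y s `<=` ~` D & eball (S y) s `<=` D].
Hypothesis S_lip : forall x y, W x -> W y ->
  enorm (S x - S y) <= alpha * enorm (x - y) /\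
  enorm (x - y) <= alpha * enorm (S x - S y).
Hypotheses (B_ge33 : 33 <= B) (B_ge_alpha : alpha <= B) (C_ge1 : 1 <= C).
Hypothesis k_ge0 : forall t, 0 <= k t.
Hypothesis k_comparable : W !=set0 -> forall s t, 0 < s -> 0 < t ->
  s <= B * t -> t <= B * s -> k s <= C * k t.

Lemma natr_gt0_of_ord : 0 < n%:R :> R.
Proof. by rewrite ltr0n; case: (n) i0 => // -[]. Qed.

Lemma form_integrand_ge0 x y : 0 <= q x y.
Proof.
rewrite mulr_ge0 ?k_ge0//; apply: mulr_ge0 (sqr_ge0 _).
by rewrite mulr_ge0 ?indic_ge0.
Qed.

Lemma form_integrandC x y : q x y = q y x.
Proof.
by rewrite /form_integrand enorm_distC -[g x - g y]opprB sqrrN [\1_D x * _]mulrC.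
Qed.

Lemma form_integrandE x y : D x -> D y ->
  q x y = (g x - g y) ^+ 2 * k (enorm (x - y)).
Proof. by move=> Dx Dy; rewrite /form_integrand !indicE !mem_set// !mul1r. Qed.

Lemma mirror_integrand_ge0 x y : 0 <= mirror_integrand x y.
Proof.
rewrite mulr_ge0 ?indic_ge0//; exact: mulr_ge0 (sqr_ge0 _) (k_ge0 _).
Qed.

Lemma fold_in_D x : (D `|` W) x -> D (S x).
Proof.
move=> [Dx|/S_fold[s [s0 _ _]]]; first by rewrite S_id.
by apply; rewrite /eball/= subrr enorm0.
Qed.

(** For the remaining mixed pairs the two distances are comparable: with [s]
    the distance from [y] to [D], they differ by at most [2 * s], while
    [enorm (x - y)] is at least [s] and [enorm (x - S y)] at least [s / 16];
    hence the ratio 33. *)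
Let far_mixed x y : D x -> W y -> ~ mirror_pairs (x, y) ->
  (g x - g (S y)) ^+ 2 * k (enorm (x - y)) <= C * q x (S y).
Proof.
move=> Dx Wy nbad; have [s [s0 ys yD SyD]] := S_fold Wy.
have {nbad} : 2 * s / 32 <= enorm (x - S y).
  by rewrite -ys leNgt; apply/negP => lt; apply: nbad; split.
have xy : s <= enorm (x - y).
  by rewrite leNgt; apply/negP => /yD; exact.
have := ler_enorm_dist (S y) x y; have := ler_enorm_dist y x (S y).
rewrite (enorm_distC (S y) y) ys => h1 h2 h3.
rewrite form_integrandE//; last by apply: fold_in_D; right.
rewrite mulrCA ler_wpM2l ?sqr_ge0// k_comparable//; have := B_ge33.
- by exists y.
- by lra.
- by lra.
- by move=> B33; nra.
- by move=> B33; nra.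
Qed.

(** Away from mirror pairs, folding changes distances by bounded factors, and
    the kernel by a bounded factor. *)
Lemma fold_pair_le x y : (D `|` W) x -> (D `|` W) y ->
  (g (S x) - g (S y)) ^+ 2 * k (enorm (x - y)) <=
  C * q (S x) (S y) + mirror_integrand x y + mirror_integrand y x.
Proof.
have b0 u v := mirror_integrand_ge0 u v; have C1 := C_ge1.
have Cq0 u v : 0 <= C * q u v.
  by rewrite mulr_ge0 ?form_integrand_ge0// (le_trans ler01).
have mixed u v : D u -> W v -> (g u - g (S v)) ^+ 2 * k (enorm (u - v)) <=
    C * q u (S v) + mirror_integrand u v + mirror_integrand v u.
  move=> Du Wv; have [buv|nbuv] := pselect (mirror_pairs (u, v)).
    rewrite /mirror_integrand [\1_mirror_pairs (u, v)]indicE mem_set// mul1r.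
    by rewrite addrAC lerDr addr_ge0//; exact: b0.
  by have := far_mixed Du Wv nbuv; have := b0 u v; have := b0 v u; lra.
move=> [Dx|Wx] [Dy|Wy].
- rewrite !S_id// form_integrandE// -addrA -[leLHS]addr0 lerD ?addr_ge0//.
  by rewrite ler_peMl// mulr_ge0 ?sqr_ge0.
- by rewrite (S_id Dx); exact: mixed.
- rewrite (S_id Dy) -[_ - g y]opprB sqrrN enorm_distC form_integrandC addrAC.
  exact: mixed.
- have [->|xy] := eqVneq x y.
    by rewrite subrr expr0n/= mul0r !addr_ge0.
  have xy0 : 0 < enorm (x - y) by rewrite enorm_gt0 subr_eq0.
  have [l1 l2] := S_lip Wx Wy.
  have Sxy0 : 0 < enorm (S x - S y).
    rewrite lt_neqAle enorm_ge0 andbT eq_sym; apply/eqP => S0.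
    by move: l2; rewrite S0 mulr0 leNgt xy0.
  rewrite -addrA -[leLHS]addr0 lerD ?addr_ge0//.
  rewrite form_integrandE; [|by apply: fold_in_D; right|by apply: fold_in_D; right].
  rewrite mulrCA ler_wpM2l ?sqr_ge0// k_comparable//.
  + by exists x.
  + by apply: (le_trans l2); rewrite ler_wpM2r// ltW.
  + by apply: (le_trans l1); rewrite ler_wpM2r// ltW.
Qed.

Lemma enorm_delta : enorm (delta_mx ord0 i0 : Rn) = 1.
Proof.
rewrite /enorm /dotr (bigD1 i0)//= big1 ?addr0 ?mxE ?eqxx ?mulr1 ?sqrtr1//.
by move=> i ii0; rewrite mxE (negbTE ii0) mulr0.
Qed.

(** All the distances between [x], [y], [S y] and a relay point [w] are
    comparable to [s], except for the one from [x] to [S y]: a jump from [x] to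
    [S y] can be replaced by two jumps of length about [s] through [w]. *)
Lemma relay_distances x y w s : mirror_pairs (x, y) ->
    0 < s -> enorm (y - S y) = 2 * s -> eball y s `<=` ~` D ->
    cube (relay_center y) (relay_radius y) w ->
  [/\ 3 * s / 16 <= enorm (w - S y) <= 5 * s / 16,
      s / 8 <= enorm (x - w) <= 3 * s / 8,
      s <= enorm (x - y) <= 33 * s / 16 & enorm (x - S y) < s / 16].
Proof.
move=> [/= Dx Wy xSy] s0 ys yD wc; rewrite /fold_gap ys in xSy.
have n0 := natr_gt0_of_ord.
have wr : enorm (w - relay_center y) <= s / 16.
  rewrite (le_trans (enorm_le_norm _))//.
  move: wc; rewrite /cube/= /relay_radius /fold_gap ys => /ltW wc.
  rewrite -ler_pdivlMl// (le_trans wc)//.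
  rewrite [leLHS](_ : _ = n%:R^-1 * (s / 16))//.
  by field; rewrite gt_eqF.
have cS : enorm (relay_center y - S y) = s / 4.
  rewrite /relay_center addrAC subrr add0r enormZ enorm_delta mulr1 /fold_gap ys.
  by rewrite ger0_norm; lra.
have xy : s <= enorm (x - y).
  by rewrite leNgt; apply/negP => /yD; exact.
have := ler_enorm_dist (relay_center y) w (S y).
have := ler_enorm_dist w (relay_center y) (S y).
rewrite (enorm_distC (relay_center y) w) cS => h1 h2.
have := ler_enorm_dist (S y) x w.
have := ler_enorm_dist x w (S y).
rewrite (enorm_distC (S y) w) (enorm_distC w x) => h3 h4.
have := ler_enorm_dist (S y) x y; rewrite (enorm_distC (S y) y) ys => h5.
have := enorm_ge0 (x - S y) => h6.
split; try (apply/andP; split); lra.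
Qed.

Lemma relay_in_D x y w : relays (x, y, w) -> D w.
Proof.
move=> [[/= Dx Wy xSy] wc]; have [s [s0 ys yD SyD]] := S_fold Wy.
have bp : mirror_pairs (x, y) by split.
have [/andP[_ ws] _ _ _] := relay_distances bp s0 ys yD wc.
by apply: SyD; rewrite /eball/=; lra.
Qed.

Lemma mirror_relay_le x y w : relays (x, y, w) ->
  mirror_integrand x y <= 2 * C * (q x w + q w (S y)).
Proof.
move=> xyw; have Dw := relay_in_D xyw; move: (xyw) => [bp wc].
have [/= Dx Wy xSy] := bp; have [s [s0 ys yD SyD]] := S_fold Wy.
have [/andP[d1 d2] /andP[d3 d4] /andP[d5 d6] d7] :=
  relay_distances bp s0 ys yD wc.
have DSy : D (S y) by apply: fold_in_D; right.
rewrite /mirror_integrand indicE mem_set// mul1r !form_integrandE//.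
have W0 : W !=set0 by exists y.
have B33 := B_ge33; have C1 := C_ge1.
have k1 : k (enorm (x - y)) <= C * k (enorm (x - w)).
  by apply: k_comparable => //; nra.
have k2 : k (enorm (x - y)) <= C * k (enorm (w - S y)).
  by apply: k_comparable => //; nra.
have kk := k_ge0 (enorm (x - y)).
have a2 : (g x - g (S y)) ^+ 2 <= 2 * (g x - g w) ^+ 2 + 2 * (g w - g (S y)) ^+ 2.
  exact: sqr_sub_le.
have := ler_wpM2l (sqr_ge0 (g x - g w)) k1.
have := ler_wpM2l (sqr_ge0 (g w - g (S y))) k2.
have := ler_wpM2r kk a2.
move: (k _) (k _) (k _) => p1 p2 p3; nra.
Qed.

End folded_form.

(** * The form of a folded function *)

Lemma mule_folded_constant (R : realDomainType) (a b c : R) (F : \bar R) :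
  0 <= a -> 0 <= b -> 0 <= c ->
  ((a * b + (c + c))%:E * F =
   a%:E * (b%:E * F) + (c%:E * F + c%:E * F))%E.
Proof.
move=> a0 b0 c0; have ab0 : 0 <= a * b by exact: mulr_ge0.
have cc0 : 0 <= c + c by exact: addr_ge0.
by rewrite EFinD ge0_muleDl ?lee_fin// EFinM muleA EFinD ge0_muleDl ?lee_fin.
Qed.

Section folded_form_integral.
Variables (R : realType) (n : nat) (i0 : 'I_n).
Local Notation Rn := 'rV[R]_n.
Local Notation leb := (lebesgue_rV R n).
Variables (D W : set Rn) (S : Rn -> Rn) (k : R -> R) (g : Rn -> R).
Variables (alpha B C K : R).
Implicit Types (x y w : Rn) (s t : R).

Hypothesis S_id : forall x, D x -> S x = x.
Hypothesis S_fold : forall y, W y -> exists s, [/\ 0 < s,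
  enorm (y - S y) = 2 * s, eball y s `<=` ~` D & eball (S y) s `<=` D].
Hypothesis S_lip : forall x y, W x -> W y ->
  enorm (S x - S y) <= alpha * enorm (x - y) /\
  enorm (x - y) <= alpha * enorm (S x - S y).
Hypotheses (B_ge33 : 33 <= B) (B_ge_alpha : alpha <= B) (C_ge1 : 1 <= C).
Hypothesis k_ge0 : forall t, 0 <= k t.
Hypothesis k_comparable : W !=set0 -> forall s t, 0 < s -> 0 < t ->
  s <= B * t -> t <= B * s -> k s <= C * k t.
Hypotheses (mD : measurable D) (mW : measurable W).
Hypotheses (mS : measurable_fun setT S) (mk : measurable_fun setT k).
Hypothesis mg : measurable_fun setT g.
Hypothesis K_ge0 : 0 <= K.
Hypothesis fold_le : forall f : Rn -> \bar R, (forall x, (0 <= f x)%E) ->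
  measurable_fun setT f ->
  (\int[leb]_x (f (S x) * (\1_(D `|` W) x)%:E) <= K%:E * \int[leb]_x f x)%E.

Local Notation q := (form_integrand D k g).
Local Notation mir := (mirror_integrand D W S k g).
Local Notation gap := (fold_gap S).
Local Notation P3 := (relays i0 D W S).

Let q0 x y : 0 <= q x y. Proof. exact: form_integrand_ge0. Qed.
Let bad0 x y : 0 <= mir x y. Proof. exact: mirror_integrand_ge0. Qed.
Let n0 : 0 < n%:R :> R. Proof. exact: natr_gt0_of_ord i0. Qed.

Let gap_ge0 y : 0 <= gap y. Proof. exact: enorm_ge0. Qed.

Lemma measurable_form_integrand d (T : measurableType d) (u v : T -> Rn) :
  measurable_fun setT u -> measurable_fun setT v ->
  measurable_fun setT (fun z => q (u z) (v z)).
Proof.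
move=> mu mv; apply: measurable_funM; last first.
  apply: (measurableT_comp mk); apply: (measurableT_comp (@measurable_enorm R n)).
  exact: measurable_rVB.
apply: measurable_funM.
  by apply: measurable_funM; apply: measurableT_comp => //; exact: measurable_indic.
apply: (@measurable_funX _ _ _ _ (fun z => g (u z) - g (v z))).
by apply: measurable_funB; exact: measurableT_comp.
Qed.

Lemma measurable_fold_gap : measurable_fun setT gap.
Proof.
apply: (measurableT_comp (@measurable_enorm R n)).
by apply: measurable_rVB.
Qed.

Lemma measurable_mirror_pairs : measurable (mirror_pairs D W S).
Proof.
have -> : mirror_pairs D W S = (fst @^-1` D) `&` (snd @^-1` W) `&`
    [set p | enorm (p.1 - S p.2) < gap p.2 / 32].
  by apply/seteqP; split => -[x y] /=; [case|case=> -[]].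
apply: measurableI; first apply: measurableI.
- by rewrite -[X in measurable X]setTI; exact: (@measurable_fst _ _ Rn Rn).
- by rewrite -[X in measurable X]setTI; exact: (@measurable_snd _ _ Rn Rn).
apply: measurable_set_lt.
  apply: (measurableT_comp (@measurable_enorm R n)).
  apply: measurable_rVB => //.
  exact: (measurableT_comp mS measurable_snd).
apply: measurable_funM => //.
exact: (measurableT_comp measurable_fold_gap measurable_snd).
Qed.

Lemma measurable_mirror_integrand :
  measurable_fun setT (fun p : Rn * Rn => mir p.1 p.2).
Proof.
apply: measurable_funM.
  rewrite (_ : (fun p => _) = \1_(mirror_pairs D W S)).
    by apply: measurable_indic; exact: measurable_mirror_pairs.
  by apply/funext => -[].
have m1 := @measurable_fst _ _ Rn Rn; have m2 := @measurable_snd _ _ Rn Rn.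
apply: measurable_funM.
  apply: (@measurable_funX _ _ _ _ (fun p : Rn * Rn => g p.1 - g (S p.2))).
  apply: measurable_funB; first exact: measurableT_comp.
  by apply: (measurableT_comp mg); exact: measurableT_comp.
apply: (measurableT_comp mk); apply: (measurableT_comp (@measurable_enorm R n)).
exact: measurable_rVB.
Qed.

Let m11 : measurable_fun setT (fun p : Rn * Rn * Rn => p.1.1).
Proof. exact: measurableT_comp. Qed.
Let m12 : measurable_fun setT (fun p : Rn * Rn * Rn => p.1.2).
Proof. exact: measurableT_comp. Qed.
Let m2 : measurable_fun setT (fun p : Rn * Rn * Rn => p.2).
Proof. exact: measurable_snd. Qed.

Lemma measurable_relays : measurable P3.
Proof.
apply: measurableI.
  rewrite -[X in measurable X]setTI.
  exact: (@measurable_fst _ _ (Rn * Rn)%type Rn measurableT _ measurable_mirror_pairs).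
apply: measurable_set_lt; last first.
  by apply: measurable_funM => //; exact: (measurableT_comp measurable_fold_gap m12).
apply: (measurableT_comp (@measurable_normrV R n)).
apply: measurable_rVB => //; apply: measurable_rVD.
  exact: (measurableT_comp mS m12).
apply/measurable_fun_rVP => i; under eq_fun do rewrite !mxE.
apply: measurable_funM => //; apply: measurable_funM => //.
exact: (measurableT_comp measurable_fold_gap m12).
Qed.

(** The inverse of the measure of the set of relay points of [y]. *)
Definition relay_weight y : R := ((2 * relay_radius S y) ^+ n)^-1.
Local Notation wt := relay_weight.

Lemma relay_radius_ge0 y : 0 <= relay_radius S y.
Proof. by rewrite divr_ge0// mulr_ge0. Qed.

Lemma relay_weight_ge0 y : 0 <= wt y.
Proof. by rewrite invr_ge0 exprn_ge0// mulr_ge0// relay_radius_ge0. Qed.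

Lemma measurable_relay_weight : measurable_fun setT wt.
Proof.
apply: measurable_inv.
  by move=> y; rewrite exprn_ge0// mulr_ge0// relay_radius_ge0.
apply: (@measurable_funX _ _ _ _ (fun y => 2 * relay_radius S y)).
apply: measurable_funM => //; apply: measurable_funM => //.
exact: measurable_fold_gap.
Qed.

(* The two jumps through a relay point, averaged over the relay points. *)
Let F1 x y w : R := \1_P3 (x, y, w) * wt y * q x w.
Let F2 x y w : R := \1_P3 (x, y, w) * wt y * q w (S y).

Let F10 x y w : 0 <= F1 x y w.
Proof. by rewrite mulr_ge0// mulr_ge0 ?relay_weight_ge0 ?indic_ge0. Qed.
Let F20 x y w : 0 <= F2 x y w.
Proof. by rewrite mulr_ge0// mulr_ge0 ?relay_weight_ge0 ?indic_ge0. Qed.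

Let m3wt : measurable_fun setT
  (fun p : Rn * Rn * Rn => \1_P3 (p.1.1, p.1.2, p.2) * wt p.1.2).
Proof.
apply: measurable_funM; last exact: (measurableT_comp measurable_relay_weight m12).
rewrite (_ : (fun p => _) = \1_P3).
  by apply: measurable_indic; exact: measurable_relays.
by apply/funext => -[[]].
Qed.

Let mF1 : measurable_fun setT
  (fun p : Rn * Rn * Rn => (F1 p.1.1 p.1.2 p.2)%:E).
Proof.
apply/measurable_EFinP; apply: measurable_funM => //.
exact: measurable_form_integrand.
Qed.

Let mF2 : measurable_fun setT
  (fun p : Rn * Rn * Rn => (F2 p.1.1 p.1.2 p.2)%:E).
Proof.
apply/measurable_EFinP; apply: measurable_funM => //.
by apply: measurable_form_integrand => //; exact: measurableT_comp.
Qed.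


Let slice (f : Rn -> Rn -> Rn -> \bar R) x y :
  measurable_fun setT (fun p : Rn * Rn * Rn => f p.1.1 p.1.2 p.2) ->
  measurable_fun setT (f x y).
Proof.
move=> mf; have mh : measurable_fun setT (fun w : Rn => ((x, y), w)).
  by apply: measurable_fun_pair.
exact: (measurableT_comp mf mh).
Qed.

Let slice1 (f : Rn -> Rn -> Rn -> \bar R) y w :
  measurable_fun setT (fun p : Rn * Rn * Rn => f p.1.1 p.1.2 p.2) ->
  measurable_fun setT (fun x => f x y w).
Proof.
move=> mf; have mh : measurable_fun setT (fun x : Rn => ((x, y), w)).
  by apply: measurable_fun_pair => //; apply: measurable_fun_pair.
exact: (measurableT_comp mf mh).
Qed.

Let slice2 (f : Rn -> Rn -> Rn -> \bar R) x w :
  measurable_fun setT (fun p : Rn * Rn * Rn => f p.1.1 p.1.2 p.2) ->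
  measurable_fun setT (fun y => f x y w).
Proof.
move=> mf; have mh : measurable_fun setT (fun y : Rn => ((x, y), w)).
  by apply: measurable_fun_pair => //; apply: measurable_fun_pair.
exact: (measurableT_comp mf mh).
Qed.

Let C2_ge0 : 0 <= 2 * C.
Proof. by rewrite mulr_ge0// (le_trans ler01). Qed.

Lemma integral_cube_cst (c : R) z a : 0 < a -> 0 <= c ->
  (\int[leb]_w (c%:E * (\1_(cube z a) w)%:E) = (c * (2 * a) ^+ n)%:E)%E.
Proof.
move=> a0 c0; rewrite ge0_integralZl_EFin//; last first.
  by apply/measurable_EFinP; apply: measurable_indic; exact: measurable_cube.
rewrite integral_indic//; last exact: measurable_cube.
by rewrite setIT EFinM; congr (_ * _)%E; exact: lebesgue_cube.
Qed.

Lemma mirror_le_relay_integral x y : ((mir x y)%:E <=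
  \int[leb]_w ((2 * C)%:E * ((F1 x y w)%:E + (F2 x y w)%:E)))%E.
Proof.
have int0 w : (0 <= (2 * C)%:E * ((F1 x y w)%:E + (F2 x y w)%:E))%E.
  by rewrite -EFinD -EFinM lee_fin mulr_ge0// addr_ge0.
have [bp|nbp] := pselect (mirror_pairs D W S (x, y)); last first.
  rewrite /mirror_integrand indicE memNset// mul0r.
  by apply: integral_ge0 => w _.
have [_ Wy _] := bp; have [s [s0 ys _ _]] := S_fold Wy.
have r0 : 0 < relay_radius S y.
  by rewrite divr_gt0 ?mulr_gt0// /fold_gap ys mulr_gt0.
have c0 : 0 < (2 * relay_radius S y) ^+ n by rewrite exprn_gt0// mulr_gt0.
have -> : mir x y = mir x y * wt y * (2 * relay_radius S y) ^+ n.
  by rewrite /relay_weight divfK// gt_eqF.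
rewrite -(integral_cube_cst (relay_center i0 S y))//; last first.
  by rewrite mulr_ge0// relay_weight_ge0.
apply: le_integralT.
- by move=> w; rewrite -EFinM lee_fin mulr_ge0 ?indic_ge0// mulr_ge0// relay_weight_ge0.
- apply: measurable_funeM; apply/measurable_EFinP.
  by apply: measurable_indic; exact: measurable_cube.
- apply: measurable_funeM; apply: emeasurable_funD.
    exact: (@slice (fun x y w => (F1 x y w)%:E)).
  exact: (@slice (fun x y w => (F2 x y w)%:E)).
move=> w; have [wc|nwc] := pselect (cube (relay_center i0 S y) (relay_radius S y) w);
  last by rewrite indicE memNset// mule0.
have xyw : P3 (x, y, w) by [].
rewrite -EFinD -!EFinM lee_fin indicE mem_set// mulr1 /F1 /F2 indicE mem_set// mul1r.
rewrite -mulrDr mulrCA [leLHS]mulrC ler_wpM2l ?relay_weight_ge0//.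
exact: (@mirror_relay_le _ _ i0 D W S k g B C S_id S_fold B_ge33 C_ge1 k_ge0
  k_comparable x y w xyw).
Qed.

(** With [x] and [w] fixed at distance [t], the points [y] of which [w] is a
    relay lie in a cube of radius [17 * t], and their weight is at most
    [(3 * n%:R / t) ^+ n]: the powers of [t] cancel. *)
Lemma relay_integral_y x w :
  (\int[leb]_y (F1 x y w)%:E <= ((102 * n%:R) ^+ n * q x w)%:E)%E.
Proof.
pose t := enorm (x - w); have t0 : 0 <= t := enorm_ge0 _.
have P3t y : P3 (x, y, w) -> [/\ 0 < t, t / (6 * n%:R) <= relay_radius S y &
    cube x (17 * t) y].
  move=> [bp wc]; have [_ Wy _] := bp; have [s [s0 ys yD _]] := S_fold Wy.
  have [_ /andP[d3 d4] /andP[d5 d6] _] := relay_distances bp s0 ys yD wc.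
  have t_gt0 : 0 < t by rewrite /t; lra.
  split => //.
    rewrite /relay_radius /fold_gap ys -/t in d3 d4 *.
    rewrite ler_pdivrMr ?mulr_gt0// mulrAC ler_pdivlMr ?mulr_gt0//.
    by have n1 := n0; nra.
  apply: eball_cube; rewrite /eball/= enorm_distC.
  by rewrite -/t in d3 d4; lra.
have [tz|tn0] := eqVneq t 0.
  rewrite integral0_eq => [|y _].
    by rewrite lee_fin; apply: mulr_ge0 (q0 _ _); rewrite exprn_ge0// mulr_ge0.
  rewrite /F1 indicE memNset ?mul0r// => /P3t[].
  by rewrite tz ltxx.
have t_gt0 : 0 < t by rewrite lt_neqAle eq_sym tn0.
have u0 : 0 < 2 * (t / (6 * n%:R)) by rewrite mulr_gt0// divr_gt0// mulr_gt0.
pose c := ((2 * (t / (6 * n%:R))) ^+ n)^-1 * q x w.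
have c0 : 0 <= c by rewrite mulr_ge0// invr_ge0 exprn_ge0// ltW.
apply: (@le_trans _ _ (\int[leb]_y (c%:E * (\1_(cube x (17 * t)) y)%:E))%E).
  apply: le_integralT.
  - by move=> y; rewrite lee_fin.
  - exact: (@slice2 (fun x y w => (F1 x y w)%:E)).
  - apply: measurable_funeM; apply/measurable_EFinP.
    by apply: measurable_indic; exact: measurable_cube.
  move=> y; rewrite -EFinM lee_fin /F1.
  have [xyw|nxyw] := pselect (P3 (x, y, w)); last first.
    by rewrite indicE memNset// !mul0r mulr_ge0 ?indic_ge0.
  have [_ tr yx] := P3t _ xyw.
  rewrite !indicE !mem_set// mul1r mulr1 ler_wpM2r//.
  have tr2 : 2 * (t / (6 * n%:R)) <= 2 * relay_radius S y by rewrite ler_wpM2l.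
  rewrite lef_pV2 ?posrE ?exprn_gt0//; last exact: lt_le_trans tr2.
  by rewrite lerXn2r// nnegrE ?(ltW u0)// (le_trans _ tr2)// ltW.
rewrite integral_cube_cst ?mulr_gt0// lee_fin /c mulrAC ler_wpM2r//.
rewrite -exprVn -exprMn lerXn2r ?nnegrE ?mulr_ge0 ?invr_ge0 ?(ltW u0)//.
rewrite [leLHS](_ : _ = 102 * n%:R)//; field.
by rewrite (gt_eqF t_gt0) gt_eqF.
Qed.

(** With [y] fixed, the points [x] lie in a cube whose radius is [n] times that
    of the cube of relay points, whose measure the weight inverts. *)
Lemma relay_integral_x y w : (\int[leb]_x (F2 x y w)%:E <=
  (n%:R ^+ n * (\1_(D `|` W) y * q w (S y)))%:E)%E.
Proof.
have [Wy|nWy] := pselect (W y); last first.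
  rewrite integral0_eq => [|x _].
    rewrite lee_fin mulr_ge0 ?exprn_ge0//.
    by apply: mulr_ge0 (q0 _ _); exact: indic_ge0.
  by rewrite /F2 indicE memNset ?mul0r// => -[[]].
have [s [s0 ys yD _]] := S_fold Wy.
have rE : 2 * relay_radius S y = s / (8 * n%:R).
  by rewrite /relay_radius /fold_gap ys; field; rewrite gt_eqF.
have r0 : 0 < 2 * relay_radius S y by rewrite rE divr_gt0// mulr_gt0.
pose c := wt y * q w (S y).
have c0 : 0 <= c by rewrite mulr_ge0// relay_weight_ge0.
apply: (@le_trans _ _ (\int[leb]_x (c%:E * (\1_(cube (S y) (s / 16)) x)%:E))%E).
  apply: le_integralT.
  - by move=> x; rewrite lee_fin.
  - exact: (@slice1 (fun x y w => (F2 x y w)%:E)).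
  - apply: measurable_funeM; apply/measurable_EFinP.
    by apply: measurable_indic; exact: measurable_cube.
  move=> x; rewrite -EFinM lee_fin /F2.
  have [xyw|nxyw] := pselect (P3 (x, y, w)); last first.
    by rewrite indicE memNset// !mul0r mulr_ge0 ?indic_ge0.
  have [bp wc] := xyw.
  have [_ _ _ xSy] := relay_distances bp s0 ys yD wc.
  rewrite !indicE mem_set// mem_set ?mul1r ?mulr1//.
  exact: eball_cube.
rewrite integral_cube_cst ?divr_gt0// lee_fin /c [\1_(D `|` W) y]indicE mem_set ?mul1r; last by right.
rewrite mulrAC ler_wpM2r// /relay_weight rE -exprVn -exprMn.
rewrite lerXn2r ?nnegrE ?mulr_ge0 ?invr_ge0 ?divr_ge0 ?mulr_ge0//; try exact: ltW.
rewrite [leLHS](_ : _ = n%:R)//; field.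
by rewrite (gt_eqF s0) gt_eqF.
Qed.

Let mq2 : measurable_fun setT (fun p : Rn * Rn => (q p.1 p.2)%:E).
Proof. by apply/measurable_EFinP; exact: measurable_form_integrand. Qed.

Let mbad2 : measurable_fun setT (fun p : Rn * Rn => (mir p.1 p.2)%:E).
Proof. by apply/measurable_EFinP; exact: measurable_mirror_integrand. Qed.

Local Notation form := (\int[leb]_x \int[leb]_y (q x y)%:E)%E.

Lemma relay_form1_le : (\int[leb]_x \int[leb]_y \int[leb]_w (F1 x y w)%:E <=
  ((102 * n%:R) ^+ n)%:E * form)%E.
Proof.
rewrite (@tonelli_xzy _ _ (fun x y w => (F1 x y w)%:E))//.
rewrite -integral2_Zl//.
apply: (@le_integral2 _ _ (fun x w => \int[leb]_y (F1 x y w)%:E)%E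
  (fun x w => ((102 * n%:R) ^+ n)%:E * (q x w)%:E)%E).
- by move=> x w; apply: integral_ge0 => y _; rewrite lee_fin.
- apply: (@measurable_partial_integral _ _ _ (Rn * Rn)%type
    (fun p y => (F1 p.1 y p.2)%:E)).
    by move=> p y; rewrite lee_fin.
  have mh : measurable_fun setT (fun p : Rn * Rn * Rn => ((p.1.1, p.2), p.1.2)).
    by apply: measurable_fun_pair => //; apply: measurable_fun_pair.
  exact: (measurableT_comp mF1 mh).
- exact: measurable_funeM.
- by move=> x w; rewrite -EFinM; exact: relay_integral_y.
Qed.

Lemma relay_form2_le : (\int[leb]_x \int[leb]_y \int[leb]_w (F2 x y w)%:E <=
  (n%:R ^+ n * K)%:E * form)%E.
Proof.
rewrite (@tonelli_yzx _ _ (fun x y w => (F2 x y w)%:E))//.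
pose h b := (\int[leb]_w (q w b)%:E)%E.
have h0 b : (0 <= h b)%E by apply: integral_ge0 => w _; rewrite lee_fin.
have msw : measurable_fun setT (fun p : Rn * Rn => (q p.2 p.1)%:E).
  by apply/measurable_EFinP; exact: measurable_form_integrand.
have mh : measurable_fun setT h.
  by apply: measurable_partial_integral => // x y; rewrite lee_fin.
have mE : measurable_fun setT (fun y => (\1_(D `|` W) y)%:E : \bar R).
  by apply/measurable_EFinP; apply: measurable_indic; exact: measurableU.
have nn0 : 0 <= n%:R ^+ n :> R by rewrite exprn_ge0.
have mhS : measurable_fun setT (fun y => h (S y) * (\1_(D `|` W) y)%:E)%E.
  exact: (emeasurable_funM (measurableT_comp mh mS) mE).
apply: (@le_trans _ _ (\int[leb]_y ((n%:R ^+ n)%:E *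
    (h (S y) * (\1_(D `|` W) y)%:E)))%E).
  apply: le_integralT.
  - by move=> y; do 2 (apply: integral_ge0 => ? _); rewrite lee_fin.
  - apply: measurable_partial_integral.
      by move=> y w; apply: integral_ge0 => x _; rewrite lee_fin.
    apply: (@measurable_partial_integral _ _ _ (Rn * Rn)%type
      (fun p x => (F2 x p.1 p.2)%:E)).
      by move=> p y; rewrite lee_fin.
    have mp : measurable_fun setT (fun p : Rn * Rn * Rn => ((p.2, p.1.1), p.1.2)).
      by apply: measurable_fun_pair => //; apply: measurable_fun_pair.
    exact: (measurableT_comp mF2 mp).
  - exact: measurable_funeM.
  move=> y.
  apply: (@le_trans _ _ (\int[leb]_w
      ((n%:R ^+ n * \1_(D `|` W) y)%:E * (q w (S y))%:E))%E).
    apply: le_integralT.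
    - by move=> w; apply: integral_ge0 => x _; rewrite lee_fin.
    - apply: (@measurable_partial_integral _ _ _ Rn (fun w x => (F2 x y w)%:E)).
        by move=> p x; rewrite lee_fin.
      have mp : measurable_fun setT (fun p : Rn * Rn => ((p.2, y), p.1)).
        by apply: measurable_fun_pair => //; apply: measurable_fun_pair.
      exact: (measurableT_comp mF2 mp).
    - apply: measurable_funeM; apply/measurable_EFinP.
      by apply: measurable_form_integrand => //; exact: measurable_cst.
    by move=> w; rewrite -EFinM -mulrA; exact: relay_integral_x.
  rewrite ge0_integralZl_EFin//.
  - by rewrite EFinM -muleA [(_ * h _)%E]muleC.
  - by move=> w _; rewrite lee_fin.
  - apply/measurable_EFinP.
    by apply: measurable_form_integrand => //; exact: measurable_cst.
rewrite ge0_integralZl_EFin//; last first.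
  by move=> y _; rewrite mule_ge0// lee_fin indic_ge0.
rewrite EFinM -muleA lee_wpmul2l ?lee_fin//.
apply: (@le_trans _ _ (K%:E * \int[leb]_b h b)%E).
  exact: (fold_le h0 mh).
apply: lee_wpmul2l; first by rewrite lee_fin.
rewrite /h (@tonelli _ _ (fun b w => (q w b)%:E))//.
by move=> x y; rewrite lee_fin.
Qed.

Lemma mirror_form_le : (\int[leb]_x \int[leb]_y (mir x y)%:E <=
  (2 * C * ((102 * n%:R) ^+ n + n%:R ^+ n * K))%:E * form)%E.
Proof.
have form0 : (0 <= form)%E by do 2 (apply: integral_ge0 => ? _); rewrite lee_fin.
pose G1 x y := (\int[leb]_w (F1 x y w)%:E)%E.
pose G2 x y := (\int[leb]_w (F2 x y w)%:E)%E.
have G10 x y : (0 <= G1 x y)%E by apply: integral_ge0 => w _; rewrite lee_fin.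
have G20 x y : (0 <= G2 x y)%E by apply: integral_ge0 => w _; rewrite lee_fin.
have mG1 : measurable_fun setT (fun p : Rn * Rn => G1 p.1 p.2).
  apply: (@measurable_partial_integral _ _ _ (Rn * Rn)%type
    (fun p w => (F1 p.1 p.2 w)%:E)) => // p w; by rewrite lee_fin.
have mG2 : measurable_fun setT (fun p : Rn * Rn => G2 p.1 p.2).
  apply: (@measurable_partial_integral _ _ _ (Rn * Rn)%type
    (fun p w => (F2 p.1 p.2 w)%:E)) => // p w; by rewrite lee_fin.
apply: (@le_trans _ _ (\int[leb]_x \int[leb]_y
    ((2 * C)%:E * G1 x y + (2 * C)%:E * G2 x y))%E).
  apply: le_integral2.
  - by move=> x y; rewrite lee_fin.
  - exact: mbad2.
  - exact: (emeasurable_funD (measurable_funeM _ mG1) (measurable_funeM _ mG2)).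
  move=> x y; apply: le_trans (mirror_le_relay_integral x y) _.
  have m1 : measurable_fun setT (fun w => (F1 x y w)%:E).
    exact: (@slice (fun x y w => (F1 x y w)%:E)).
  have m2' : measurable_fun setT (fun w => (F2 x y w)%:E).
    exact: (@slice (fun x y w => (F2 x y w)%:E)).
  rewrite ge0_integralZl_EFin//; last 2 first.
  - by move=> w _; rewrite -EFinD lee_fin addr_ge0.
  - exact: emeasurable_funD.
  have -> : (\int[leb]_w ((F1 x y w)%:E + (F2 x y w)%:E) = G1 x y + G2 x y)%E.
    by rewrite ge0_integralD// => w _; rewrite lee_fin.
  by rewrite (ge0_muleDr _ (G10 x y) (G20 x y)).
have CG20 x y : (0 <= (2 * C)%:E * G2 x y)%E by apply: mule_ge0; rewrite ?lee_fin.
rewrite (@integral2_ZD _ _ _ _ (fun x y => (2 * C)%:E * G2 x y)%E C2_ge0 G10 CG20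
  mG1 (measurable_funeM _ mG2)).
rewrite (@integral2_Zl _ _ _ _ C2_ge0 G20 mG2).
have I0 (G : Rn -> Rn -> \bar R) : (forall x y, (0 <= G x y)%E) ->
    (0 <= \int[leb]_x \int[leb]_y G x y)%E.
  by move=> G0; apply: integral_ge0 => x _; exact: integral_ge0.
rewrite -(ge0_muleDr _ (I0 _ G10) (I0 _ G20)).
rewrite [X in (_ <= X * _)%E]EFinM -muleA.
apply: lee_wpmul2l; first by rewrite lee_fin.
rewrite EFinD ge0_muleDl ?lee_fin.
- by apply: leeD; [exact: relay_form1_le|exact: relay_form2_le].
- by rewrite exprn_ge0// mulr_ge0.
- by rewrite mulr_ge0// exprn_ge0.
Qed.

Definition folded_integrand x y : R :=
  \1_(D `|` W) x * \1_(D `|` W) y * (g (S x) - g (S y)) ^+ 2 * k (enorm (x - y)).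

Lemma folded_integrand_ge0 x y : 0 <= folded_integrand x y.
Proof.
rewrite mulr_ge0 ?k_ge0//; apply: mulr_ge0 (sqr_ge0 _).
by rewrite mulr_ge0 ?indic_ge0.
Qed.

Lemma measurable_folded_integrand :
  measurable_fun setT (fun p : Rn * Rn => folded_integrand p.1 p.2).
Proof.
have m1 := @measurable_fst _ _ Rn Rn; have m2' := @measurable_snd _ _ Rn Rn.
have mE : measurable (D `|` W) by exact: measurableU.
apply: measurable_funM; last first.
  apply: (measurableT_comp mk); apply: (measurableT_comp (@measurable_enorm R n)).
  exact: measurable_rVB.
apply: measurable_funM.
  by apply: measurable_funM; apply: measurableT_comp => //; exact: measurable_indic.
apply: (@measurable_funX _ _ _ _ (fun p : Rn * Rn => g (S p.1) - g (S p.2))).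
by apply: measurable_funB; apply: (measurableT_comp mg); exact: measurableT_comp.
Qed.

Let Kb : R := 2 * C * ((102 * n%:R) ^+ n + n%:R ^+ n * K).

Let C_ge0 : 0 <= C. Proof. exact: le_trans ler01 C_ge1. Qed.

Let Kb_ge0 : 0 <= Kb.
Proof.
by rewrite mulr_ge0// addr_ge0 ?mulr_ge0// exprn_ge0// mulr_ge0.
Qed.

Definition folded_constant : R := C * (K * K) + (Kb + Kb).

Lemma folded_constant_ge0 : 0 <= folded_constant.
Proof.
exact: addr_ge0 (mulr_ge0 C_ge0 (mulr_ge0 K_ge0 K_ge0)) (addr_ge0 Kb_ge0 Kb_ge0).
Qed.

(** Comparable pairs are handled by changing variables in both arguments, and
    mirror pairs, which come in two symmetric families, by relay points. *)
Lemma folded_form_le :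
  (\int[leb]_x \int[leb]_y (folded_integrand x y)%:E <=
   folded_constant%:E * form)%E.
Proof.
have C0 := C_ge0; have Kb0 := Kb_ge0.
pose E x : R := \1_(D `|` W) x.
have E0 x : 0 <= E x by exact: indic_ge0.
have mE : measurable_fun setT (fun y => (E y)%:E : \bar R).
  by apply/measurable_EFinP; apply: measurable_indic; exact: measurableU.
have mE1 : measurable_fun setT (fun p : Rn * Rn => (E p.1)%:E : \bar R).
  exact: (measurableT_comp mE measurable_fst).
have mE2 : measurable_fun setT (fun p : Rn * Rn => (E p.2)%:E : \bar R).
  exact: (measurableT_comp mE measurable_snd).
have mbad2' : measurable_fun setT (fun p : Rn * Rn => (mir p.2 p.1)%:E).
  have mp : measurable_fun setT (fun p : Rn * Rn => (p.2, p.1)).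
    exact: measurable_fun_pair.
  exact: (measurableT_comp mbad2 mp).
pose H x y : \bar R := ((q (S x) (S y))%:E * (E y)%:E * (E x)%:E)%E.
have H0 x y : (0 <= H x y)%E.
  rewrite /H -!EFinM lee_fin; apply: mulr_ge0 (E0 _).
  exact: mulr_ge0 (q0 _ _) (E0 _).
have mqS : measurable_fun setT (fun p : Rn * Rn => (q (S p.1) (S p.2))%:E).
  apply/measurable_EFinP; apply: measurable_form_integrand.
    exact: (measurableT_comp mS measurable_fst).
  exact: (measurableT_comp mS measurable_snd).
have mH : measurable_fun setT (fun p : Rn * Rn => H p.1 p.2).
  by do 2 apply: emeasurable_funM => //.
have intH : (\int[leb]_x \int[leb]_y H x y <= (K * K)%:E * form)%E.
  pose h a := (\int[leb]_b (q a b)%:E)%E.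
  have h0 b : (0 <= h b)%E by apply: integral_ge0 => w _; rewrite lee_fin.
  have mh : measurable_fun setT h.
    by apply: measurable_partial_integral => // x y; rewrite lee_fin.
  apply: (@le_trans _ _ (\int[leb]_x (K%:E * (h (S x) * (E x)%:E)))%E).
    apply: le_integralT.
    - by move=> x; exact: integral_ge0.
    - exact: measurable_partial_integral.
    - apply: measurable_funeM; apply: emeasurable_funM => //.
      exact: (measurableT_comp mh mS).
    move=> x.
    have mqa : measurable_fun setT (fun b => (q (S x) b)%:E).
      by apply/measurable_EFinP; apply: measurable_form_integrand.
    have mqb : measurable_fun setT (fun y => (q (S x) (S y))%:E * (E y)%:E)%E.
      by apply: emeasurable_funM => //; exact: (measurableT_comp mqa mS).
    rewrite /H ge0_integralZr//; last 2 first.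
    - by move=> y _; rewrite -EFinM lee_fin mulr_ge0.
    - by rewrite lee_fin.
    rewrite muleA lee_wpmul2r ?lee_fin//.
    by apply: (fold_le (f := fun b => (q (S x) b)%:E)) => // b; rewrite lee_fin.
  rewrite ge0_integralZl_EFin//; last 2 first.
  - by move=> x _; rewrite mule_ge0// lee_fin.
  - by apply: emeasurable_funM => //; exact: (measurableT_comp mh mS).
  by rewrite EFinM -muleA lee_wpmul2l ?lee_fin// fold_le.
apply: (@le_trans _ _ (\int[leb]_x \int[leb]_y
    (C%:E * H x y + ((mir x y)%:E + (mir y x)%:E)))%E).
  apply: le_integral2.
  - by move=> x y; rewrite lee_fin folded_integrand_ge0.
  - by apply/measurable_EFinP; exact: measurable_folded_integrand.
  - by apply: emeasurable_funD; [exact: measurable_funeM|exact: emeasurable_funD].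
  move=> x y; rewrite /H -!EFinM -!EFinD lee_fin /folded_integrand -!/(E _).
  have rhs0 : 0 <= C * (q (S x) (S y) * E y * E x) + (mir x y + mir y x).
    apply: addr_ge0 (addr_ge0 (bad0 _ _) (bad0 _ _)); apply: mulr_ge0 => //.
    by have := H0 x y; rewrite /H -!EFinM lee_fin.
  have [Ex|nEx] := pselect ((D `|` W) x); last first.
    rewrite {1}/E indicE memNset// !mul0r.
    exact: rhs0.
  have [Ey|nEy] := pselect ((D `|` W) y); last first.
    rewrite {2}/E indicE memNset// mulr0 !mul0r.
    exact: rhs0.
  rewrite /E !indicE !mem_set// !mulr1 !mul1r.
  rewrite addrA.
  exact: (fold_pair_le (k:=k) g S_id S_fold S_lip B_ge33 B_ge_alpha C_ge1
    k_ge0 k_comparable Ex Ey).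
have badE0 x y : (0 <= (mir x y)%:E)%E by rewrite lee_fin.
have bad00 : (0 <= \int[leb]_x \int[leb]_y (mir x y)%:E)%E.
  by do 2 (apply: integral_ge0 => ? _); rewrite lee_fin.
rewrite integral2_ZD//; last 2 first.
- by move=> x y; rewrite -EFinD lee_fin addr_ge0.
- exact: emeasurable_funD.
pose b2 := (\int[leb]_x \int[leb]_y (mir x y)%:E)%E.
have b2C : (\int[leb]_x \int[leb]_y (mir y x)%:E)%E = b2 :=
  @tonelli _ _ (fun x y => (mir y x)%:E) (fun x y => badE0 y x) mbad2'.
have -> : (\int[leb]_x \int[leb]_y ((mir x y)%:E + (mir y x)%:E) = b2 + b2)%E.
  exact: (etrans (@integral2_D R n (fun x y => (mir x y)%:E)
    (fun x y => (mir y x)%:E) badE0 (fun x y => badE0 y x) mbad2 mbad2')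
    (congr1 (fun z => (b2 + z)%E) b2C)).
have form0 : (0 <= form)%E by do 2 (apply: integral_ge0 => ? _); rewrite lee_fin.
have -> : (folded_constant%:E * form =
    C%:E * ((K * K)%:E * form) + (Kb%:E * form + Kb%:E * form))%E.
  exact: (mule_folded_constant form C0 (mulr_ge0 K_ge0 K_ge0) Kb0).
have badb : (b2 <= Kb%:E * form)%E by exact: mirror_form_le.
apply: leeD; last exact: (leeD badb badb).
by apply: lee_wpmul2l intH; rewrite lee_fin.
Qed.

End folded_form_integral.

(** * The kernel of a Levy measure and cutoffs *)

Section levy_density.
Variables (R : realType) (n : nat).
Local Notation Rn := 'rV[R]_n.
Local Notation leb := (lebesgue_rV R n).
Variables (nu : {measure set Rn -> \bar R}) (rho : R -> R).
Hypotheses (n_gt0 : (0 < n)%N) (nu_rho : isotropic_density nu rho).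
Implicit Types (x y z : Rn) (t : R) (D : set Rn) (u : Rn -> R).

(** A density says something about positive arguments only; extending it by
    [0] gives a kernel that is nonnegative everywhere. *)
Definition profile (rho : R -> R) : R -> R := rho \_ [set t | 0 < t].
Local Notation k := (profile rho).

Lemma profile_gt0 t : 0 < t -> k t = rho t.
Proof. by move=> t0; rewrite /profile patchE mem_set. Qed.

Lemma profile_ge0 t : 0 <= k t.
Proof.
rewrite /profile patchE; case: ifPn => //; rewrite inE /= => t0.
by have [_ r0 _] := nu_rho; exact: r0.
Qed.

Lemma measurable_profile : measurable_fun setT k.
Proof.
have [mr _ _] := nu_rho; apply/(measurable_restrictT _ _).1 => //.
have := measurable_itv `]0, +oo[ : measurable (_ : set R).
by congr measurable; apply/seteqP; split => t /=; rewrite in_itv/= andbT.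
Qed.

Lemma measurable_kernel : measurable_fun setT (fun z : Rn => k (enorm z)).
Proof. exact: (measurableT_comp measurable_profile (@measurable_enorm R n)). Qed.

Lemma lebesgue_rV_point0 : leb [set (0 : Rn)] = 0%E.
Proof.
have -> : [set (0 : Rn)] = [set x : Rn | forall i, [set (0 : R)] (x ord0 i)].
  apply/seteqP; split => x /=; first by move=> -> i; rewrite mxE.
  by move=> h; apply/rowP => i; rewrite h mxE.
rewrite (@lebesgue_rV_prod R n (fun=> [set 0]))//.
by rewrite (bigD1 (Ordinal n_gt0))//= lebesgue_measure_set1 mul0e.
Qed.

Lemma nu_profile A : measurable A ->
  nu A = (\int[leb]_(z in A) (k (enorm z))%:E)%E.
Proof.
move=> mA; have [_ _ ->//] := nu_rho.
have m0 : measurable [set (0 : Rn)].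
  have -> : [set (0 : Rn)] = ~` [set z | 0 < enorm z].
    apply/seteqP; split => z /=; first by move=> ->; rewrite enorm0 ltxx.
    by rewrite enorm_gt0 => /negP/negPn/eqP.
  apply: measurableC; apply: measurable_set_lt => //.
  exact: measurable_enorm.
have rhoE : (fun z : Rn => rho (enorm z)) =
    (fun z => k (enorm z) + rho 0 * \1_[set (0 : Rn)] z).
  apply/funext => z; have [->|z0] := eqVneq z 0.
    rewrite enorm0 indicE mem_set// mulr1 /profile patchE memNset ?add0r//=.
    by rewrite ltxx.
  rewrite profile_gt0 ?enorm_gt0// indicE memNset ?mulr0 ?addr0//=.
  exact/eqP.
apply: ae_eq_integral => //.
- apply: measurable_funTS; apply/measurable_EFinP; rewrite rhoE.
  apply: measurable_funD; first exact: measurable_kernel.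
  by apply: measurable_funM => //; exact: measurable_indic.
- by apply: measurable_funTS; apply/measurable_EFinP; exact: measurable_kernel.
exists [set 0]; split => //; first exact: lebesgue_rV_point0.
move=> z /= h; apply: contrapT => z0; apply: h => _.
by rewrite profile_gt0// enorm_gt0; apply/eqP.
Qed.

Lemma integral_nu (f : Rn -> \bar R) : (forall z, (0 <= f z)%E) ->
  measurable_fun setT f ->
  (\int[nu]_z f z = \int[leb]_z (f z * (k (enorm z))%:E))%E.
Proof.
move=> f0 mf; apply: (integral_density (w := fun z => k (enorm z))) => //.
- by move=> z; exact: profile_ge0.
- exact: measurable_kernel.
- exact: nu_profile.
Qed.

Lemma integral_translated x (f : Rn -> \bar R) : (forall z, (0 <= f z)%E) ->
  measurable_fun setT f ->
  (\int[translated nu x]_y f y = \int[leb]_y (f y * (k (enorm (x - y)))%:E))%E.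
Proof.
move=> f0 mf.
have mt c : measurable_fun setT (fun y : Rn => y + c).
  by apply: measurable_rVD => //; exact: measurable_cst.
rewrite (ge0_integral_pushforward (mt x))// preimage_setT integral_nu//; last 2 first.
- by move=> z /=.
- exact: (measurableT_comp mf (mt x)).
pose h y : \bar R := (f y * (k (enorm (y - x)))%:E)%E.
have h0 y : (0 <= h y)%E by rewrite mule_ge0// lee_fin profile_ge0.
have mh : measurable_fun setT h.
  apply: emeasurable_funM => //; apply/measurable_EFinP.
  exact: (measurableT_comp measurable_kernel (mt (- x))).
transitivity (\int[leb]_y h (y + x)%R)%E.
  by apply: eq_integral => z _; rewrite /h addrK.
rewrite (integral_translate x h0 mh).
by apply: eq_integral => y _; rewrite /h enorm_distC.
Qed.

Lemma nu_formE D u : measurable D -> measurable_fun D u ->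
  nu_form nu D u =
  (\int[leb]_x \int[leb]_y (form_integrand D k (u \_ D) x y)%:E)%E.
Proof.
move=> mD mu; have mu' : measurable_fun setT (u \_ D).
  by apply/(measurable_restrictT _ _).1.
rewrite /nu_form integral_mkcond; apply: eq_integral => x _.
rewrite patchE; case: ifPn => [|nDx]; last first.
  rewrite integral0_eq// => y _.
  by rewrite /form_integrand indicE (negbTE nDx) !mul0r.
rewrite inE => Dx; rewrite integral_mkcond.
  by apply: measurable_rVD => //; exact: measurable_cst.
move=> mt; transitivity (\int[translated nu x]_y
    (\1_D y * ((u \_ D) x - (u \_ D) y) ^+ 2)%:E)%E.
  apply: eq_integral => y _; rewrite patchE indicE.
  case: ifPn => [|nDy]; last by rewrite mul0r.
  by rewrite inE => Dy; rewrite mul1r !patchE !mem_set.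
rewrite integral_translated.
- apply: eq_integral => y _; rewrite -EFinM /form_integrand [\1_D x]indicE.
  by rewrite mem_set// mul1r.
- by move=> y; rewrite lee_fin mulr_ge0 ?sqr_ge0 ?indic_ge0.
apply/measurable_EFinP; apply: measurable_funM; first exact: measurable_indic.
apply: (@measurable_funX _ _ _ _ (fun y => (u \_ D) x - (u \_ D) y)).
by apply: measurable_funB.
Qed.

Lemma levy_constant : levy_measure nu -> exists2 M : R, 0 <= M &
  forall x, (\int[leb]_y (Num.min 1 (enorm (x - y) ^+ 2) * k (enorm (x - y)))%:E
    <= M%:E)%E.
Proof.
move=> [_ _ fin]; pose f z : R := Num.min 1 (enorm z ^+ 2).
have f0 z : 0 <= f z by rewrite le_min ler01 sqr_ge0.
have mf : measurable_fun setT f.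
  apply: measurable_minr => //; apply: measurable_funX.
  exact: measurable_enorm.
have mfk : measurable_fun setT (fun z : Rn => (f z * k (enorm z))%:E).
  by apply/measurable_EFinP; apply: measurable_funM => //; exact: measurable_kernel.
have fk0 z : (0 <= (f z * k (enorm z))%:E)%E.
  by rewrite lee_fin mulr_ge0// profile_ge0.
move: fin; rewrite integral_nu//; last exact/measurable_EFinP.
under eq_integral do rewrite -EFinM.
set I := (X in (X < _)%E) => Ifin.
have I0 : (0 <= I)%E by apply: integral_ge0 => z _; exact: fk0.
exists (fine I); first exact: fine_ge0.
move=> x; rewrite fineK ?ge0_fin_numE//.
rewrite /I -(integral_translate (- x) fk0 mfk).
rewrite le_eqVlt; apply/orP; left; apply/eqP; apply: eq_integral => y _.
by rewrite enorm_distC.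
Qed.

(** The price of a cutoff: multiplying by a Lipschitz function costs an L2
    norm times the Levy integral. *)
Lemma cutoff_form_le (h phi : Rn -> R) (L M : R) :
  measurable_fun setT h -> measurable_fun setT phi -> 0 <= L -> 0 <= M ->
  (forall x y, (phi x - phi y) ^+ 2 <= L * Num.min 1 (enorm (x - y) ^+ 2)) ->
  (forall x, (\int[leb]_y (Num.min 1 (enorm (x - y) ^+ 2) *
     k (enorm (x - y)))%:E <= M%:E)%E) ->
  (\int[leb]_x \int[leb]_y (h x ^+ 2 * (phi x - phi y) ^+ 2 *
     k (enorm (x - y)))%:E <= (L * M)%:E * \int[leb]_x (h x ^+ 2)%:E)%E.
Proof.
move=> mh mphi L0 M0 phiL kM.
have mB : measurable_fun setT (fun p : Rn * Rn => p.1 - p.2).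
  by apply: measurable_rVB.
have mk : measurable_fun setT (fun p : Rn * Rn => k (enorm (p.1 - p.2))).
  exact: (measurableT_comp measurable_kernel mB).
have mmin : measurable_fun setT (fun p : Rn * Rn =>
    Num.min 1 (enorm (p.1 - p.2) ^+ 2)).
  apply: measurable_minr => //; apply: measurable_funX.
  exact: (measurableT_comp (@measurable_enorm R n) mB).
have mh2 : measurable_fun setT (fun x => (h x ^+ 2)%:E).
  by apply/measurable_EFinP; exact: measurable_funX.
have h20 x : (0 <= (h x ^+ 2)%:E)%E by rewrite lee_fin sqr_ge0.
have LM0 : 0 <= L * M by exact: mulr_ge0.
have int0 x y : 0 <= h x ^+ 2 * (phi x - phi y) ^+ 2 * k (enorm (x - y)).
  by rewrite mulr_ge0 ?profile_ge0// -exprMn sqr_ge0.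
have mint : measurable_fun setT (fun p : Rn * Rn =>
    (h p.1 ^+ 2 * (phi p.1 - phi p.2) ^+ 2 * k (enorm (p.1 - p.2)))%:E).
  apply/measurable_EFinP; apply: measurable_funM => //; apply: measurable_funM.
    apply: (@measurable_funX _ _ _ _ (fun p : Rn * Rn => h p.1)).
    exact: (measurableT_comp mh measurable_fst).
  apply: (@measurable_funX _ _ _ _ (fun p : Rn * Rn => phi p.1 - phi p.2)).
  apply: measurable_funB; first exact: (measurableT_comp mphi measurable_fst).
  exact: (measurableT_comp mphi measurable_snd).
rewrite -(ge0_integralZl_EFin _ measurableT (fun x _ => h20 x) mh2 LM0).
apply: le_integralT.
- by move=> x; apply: integral_ge0 => y _; rewrite lee_fin.
- apply: (@measurable_partial_integral _ _ _ Rn (fun x y =>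
    (h x ^+ 2 * (phi x - phi y) ^+ 2 * k (enorm (x - y)))%:E)); last exact: mint.
  by move=> x y; rewrite lee_fin.
- exact: measurable_funeM.
move=> x.
have hL0 : 0 <= h x ^+ 2 * L by rewrite mulr_ge0 ?sqr_ge0.
have m0 y : (0 <= (Num.min 1 (enorm (x - y) ^+ 2) * k (enorm (x - y)))%:E)%E.
  by rewrite lee_fin mulr_ge0 ?profile_ge0// le_min ler01 sqr_ge0.
have mm : measurable_fun setT (fun y =>
    (Num.min 1 (enorm (x - y) ^+ 2) * k (enorm (x - y)))%:E).
  apply/measurable_EFinP; apply: measurable_funM.
    exact: (measurable_fun_pair2 x mmin).
  exact: (measurable_fun_pair2 x mk).
apply: (@le_trans _ _ (\int[leb]_y ((h x ^+ 2 * L)%:E *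
    (Num.min 1 (enorm (x - y) ^+ 2) * k (enorm (x - y)))%:E))%E).
  apply: le_integralT.
  - by move=> y; rewrite lee_fin.
  - exact: (measurable_fun_pair2 x mint).
  - exact: measurable_funeM.
  move=> y; rewrite -EFinM lee_fin [leRHS]mulrA.
  apply: ler_wpM2r; first exact: profile_ge0.
  by rewrite -[leRHS]mulrA; apply: ler_wpM2l => //; exact: sqr_ge0.
rewrite (ge0_integralZl_EFin _ measurableT (fun y _ => m0 y) mm hL0).
rewrite -EFinM [(L * M * _)%R]mulrC mulrA [leRHS]EFinM.
by apply: lee_wpmul2l; rewrite ?lee_fin.
Qed.

End levy_density.

(** * Lipschitz continuity of the cutoff *)

Section cutoff_lipschitz.
Variables (R : realType) (n : nat) (phi : 'rV[R]_n -> R).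
Implicit Types (x y : 'rV[R]_n) (i : 'I_n).
Local Notation e_ i := (delta_mx ord0 i : 'rV[R]_n).

Lemma is_derive_axis x i t : derivable phi (x + t *: e_ i) (e_ i) ->
  is_derive t 1 (fun s => phi (x + s *: e_ i)) ('D_(e_ i) phi (x + t *: e_ i)).
Proof.
move=> dphi.
have E : (fun h : R => h^-1 *: (((fun s => phi (x + s *: e_ i)) \o shift t) (h *: (1 : R)) -
      phi (x + t *: e_ i))) =
    (fun h : R => h^-1 *: ((phi \o shift (x + t *: e_ i)) (h *: e_ i) -
      phi (x + t *: e_ i))).
  apply/funext => h /=; congr (_ *: (phi _ - _)).
  by rewrite /shift /= [h *: 1]mulr1 scalerDl addrCA.
apply: DeriveDef; first by rewrite /derivable E.
by rewrite /derive E.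
Qed.

Lemma axis_lipschitz C x i t : smooth phi ->
  (forall y, `|'D_(e_ i) phi y| <= C) ->
  `|phi (x + t *: e_ i) - phi x| <= C * `|t|.
Proof.
move=> sphi phiC; have [cphi dphi] := sphi [::].
pose f (s : R) := phi (x + s *: e_ i).
have df (s : R) : is_derive s 1 f ('D_(e_ i) phi (x + s *: e_ i)).
  by apply: is_derive_axis; exact: dphi.
have cf : continuous f.
  move=> s; apply/differentiable_continuous/derivable1_diffP.
  exact: (@ex_derive _ _ _ _ _ _ _ (df s)).
have main a b : a <= b -> `|f b - f a| <= C * `|b - a|.
  move=> ab.
  have [c _ ->] := @MVT_segment R f (fun s => 'D_(e_ i) phi (x + s *: e_ i))
    a b ab (fun s _ => df s) (continuous_subspaceT cf).
  by rewrite normrM ler_wpM2r.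
have -> : phi x = f 0 by rewrite /f scale0r addr0.
rewrite -[phi _]/(f t); have [t0|/ltW t0] := leP 0 t.
  by have := main 0 t t0; rewrite subr0.
by have := main t 0 t0; rewrite sub0r normrN distrC.
Qed.

(** Pass from [y] to [x] by changing one coordinate at a time. *)
Lemma smooth_lipschitz C : 0 <= C -> smooth phi ->
  (forall i y, `|'D_(e_ i) phi y| <= C) ->
  forall x y, `|phi x - phi y| <= n%:R * C * enorm (x - y).
Proof.
move=> C0 sphi phiC x y.
pose p (j : nat) : 'rV[R]_n := \row_i (if (i < j)%N then x ord0 i else y ord0 i).
have step (j : nat) : (j <= n)%N -> `|phi (p j) - phi y| <= j%:R * C * enorm (x - y).
  elim: j => [_|j IH jn].
    have -> : p 0 = y by apply/rowP => i; rewrite mxE ltn0.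
    by rewrite subrr normr0 !mul0r.
  pose i := Ordinal jn.
  have -> : p j.+1 = p j + (x - y) ord0 i *: e_ i.
    apply/rowP => l; rewrite !mxE eqxx /= ltnS leq_eqVlt.
    have [->|li] := eqVneq l i.
      by rewrite eqxx ltnn mulr1 addrC subrK.
    have -> : (l == j :> nat) = false by apply: negbTE.
    by rewrite mulr0 addr0.
  rewrite (le_trans (ler_distD (phi (p j)) _ _))//.
  have -> : j.+1%:R * C * enorm (x - y) =
      C * enorm (x - y) + j%:R * C * enorm (x - y).
    by rewrite -natr1; ring.
  apply: lerD; last exact: IH (ltnW jn).
  rewrite (le_trans (axis_lipschitz _ _ sphi (phiC i)))//.
  by rewrite ler_wpM2l// coord_enorm.
have := step n (leqnn n); have -> // : p n = x.
by apply/rowP => i; rewrite mxE ltn_ord.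
Qed.

(** The partial derivative is bounded on a ball by compactness, and vanishes
    outside of it, where [phi] is locally constant. *)
Lemma cutoff_partial_bounded i (M : R) : smooth phi ->
  (forall x, M < enorm x -> phi x = 1) ->
  exists2 C, 0 <= C & forall y, `|'D_(e_ i) phi y| <= C.
Proof.
move=> sphi phi1; have [cD _] := sphi [:: i].
pose B := [set x : 'rV[R]_n | enorm x <= Num.max 0 M].
have cB : compact B.
  apply: bounded_closed_compact.
    exists (Num.max 0 M); split; first exact: num_real.
    move=> N ltN x Bx /=.
    by rewrite (le_trans (norm_le_enorm _))// (le_trans _ (ltW ltN)).
  have := @closed_comp _ _ (fun b : 'rV[R]_n => enorm (b - 0))
    [set t | t <= Num.max 0 M].
  have -> : B = (fun b : 'rV[R]_n => enorm (b - 0)) @^-1` [set t | t <= Num.max 0 M].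
    by apply/seteqP; split => x; rewrite /B /= subr0.
  apply; last exact: closed_le.
  by move=> b _; exact: enorm_continuous.
have B0 : B !=set0 by exists 0; rewrite /B /= enorm0 le_max lexx.
have [|c] := EVT_max_rV B0 cB (f := fun y => `|'D_(e_ i) phi y|).
  apply: continuous_subspaceT => y.
  by apply: (@continuous_comp _ _ _ ('D_(e_ i) phi) (fun r : R => `|r|));
    [exact: cD|exact: norm_continuous].
move=> _ maxc; exists `|'D_(e_ i) phi c| => // y.
have [By|] := leP (enorm y) (Num.max 0 M); first by apply: maxc; rewrite inE.
rewrite gt_max => /andP[_ My].
suff -> : 'D_(e_ i) phi y = 0 by rewrite normr0.
have -> : 'D_(e_ i) phi y = 'D_(e_ i) (fun=> 1 : R) y.
  apply: near_eq_derive.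
  apply: (filterS _ (@eball_nbhs _ _ y (enorm y - M) _)); last by rewrite subr_gt0.
  move=> z; rewrite /eball/= => zy; apply: phi1.
  have := ler_enormD (y - z) z; rewrite subrK (enorm_distC y z); lra.
exact: derive_cst.
Qed.

End cutoff_lipschitz.

(** * Doubling *)

Section doubling.
Variables (R : realType) (rho : R -> R) (alpha : R).
Hypotheses (alpha_gt1 : 1 < alpha) (rho_ge0 : forall t, 0 < t -> 0 <= rho t).
Implicit Types (s t c : R).

Lemma expr_unbounded (a B : R) : 1 < a -> exists j : nat, B <= a ^+ j.
Proof.
move=> a1; have d0 : 0 < a - 1 by rewrite subr_gt0.
have bern (j : nat) : 1 + j%:R * (a - 1) <= a ^+ j.
  elim: j => [|j IH]; first by rewrite mul0r addr0 expr0.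
  have jd : 0 <= j%:R * (a - 1) by rewrite mulr_ge0// ltW.
  rewrite exprS -natr1; move: (a ^+ j) (j%:R) IH jd => z w IH jd; nra.
exists (Num.truncn (`|B| / (a - 1))).+1; apply: le_trans (bern _).
have /andP[_] := truncn_itv (divr_ge0 (normr_ge0 B) (ltW d0)).
rewrite ltr_pdivrMr// => h; have := ler_norm B; lra.
Qed.

(** The ratios [1 / 3] and [alpha] lie on both sides of [1], so that iterating
    the hypothesis reaches every bounded range of ratios. The ratios above
    [alpha] occur between a point of the collar and a point of the exterior. *)
Lemma comparable_of_doubling C B :
  (forall beta t, Num.min alpha^-1 (1 / 3) <= beta <= alpha -> 0 < t ->
     rho (beta * t) <= C * rho t) ->
  exists2 c, 1 <= c & forall s t, 0 < s -> 0 < t -> s <= B * t -> t <= B * s ->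
     rho s <= c * rho t.
Proof.
move=> dbl; pose c := Num.max 1 C; have c1 : 1 <= c by rewrite le_max lexx.
have c0 : 0 < c by exact: lt_le_trans ltr01 c1.
have a1 := alpha_gt1; have a0 : 0 < alpha by exact: lt_trans ltr01 a1.
have base s t : 0 < s -> 0 < t -> t <= 3 * s -> s <= alpha * t ->
    rho s <= c * rho t.
  move=> s0 t0 ts st.
  have -> : s = (s / t) * t by rewrite divfK// gt_eqF.
  apply: (le_trans (dbl _ _ _ t0)).
    rewrite ler_pdivrMr// st andbT ge_min; apply/orP; right.
    by rewrite ler_pdivlMr//; lra.
  by apply: ler_wpM2r; [exact: rho_ge0|rewrite le_max lexx orbT].
have mono j l t : (j <= l)%N -> 0 < t -> c ^+ j * rho t <= c ^+ l * rho t.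
  by move=> jl t0; apply: ler_wpM2r; [exact: rho_ge0|exact: ler_weXn2l].
have up j s t : 0 < t -> t <= s -> s <= alpha ^+ j * t ->
    rho s <= c ^+ j * rho t.
  elim: j s => [|j IH] s t0 ts.
    rewrite expr0 !mul1r => st; have -> // : s = t by apply/eqP; rewrite eq_le st.
  rewrite exprS -mulrA => st; have s0 := lt_le_trans t0 ts.
  have [sat|ats] := leP s (alpha * t).
    by rewrite (le_trans (base _ _ s0 t0 _ sat)) ?(mono 1)//; lra.
  have s'0 : 0 < s / alpha by rewrite divr_gt0.
  rewrite exprS -mulrA (le_trans (base s (s / alpha) s0 s'0 _ _))//.
  - by rewrite ler_pdivrMr//; nra.
  - by rewrite mulrC divfK// gt_eqF.
  rewrite ler_wpM2l ?(ltW c0)// IH//.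
  - by rewrite ler_pdivlMr// mulrC ltW.
  - by rewrite ler_pdivrMr// mulrC.
have down j s t : 0 < s -> s <= t -> t <= 3 ^+ j * s ->
    rho s <= c ^+ j * rho t.
  elim: j t => [|j IH] t s0 st.
    rewrite expr0 !mul1r => ts; have -> // : s = t by apply/eqP; rewrite eq_le st.
  rewrite exprS -mulrA => ts; have t0 := lt_le_trans s0 st.
  have [t3|t3] := leP t (3 * s).
    by rewrite (le_trans (base s t s0 t0 _ _)) ?(mono 1)//; nra.
  have t'0 : 0 < t / 3 by rewrite divr_gt0.
  rewrite exprSr -mulrA (le_trans (IH (t / 3) s0 _ _))//.
  - by rewrite ler_pdivlMr//; lra.
  - by rewrite ler_pdivrMr//; lra.
  rewrite ler_wpM2l ?exprn_ge0 ?(ltW c0)// base//; last by nra.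
  by rewrite mulrC divfK.
have [j jB] := expr_unbounded B alpha_gt1.
have [l lB] : exists l : nat, B <= 3 ^+ l by apply: expr_unbounded; lra.
exists (c ^+ maxn j l); first exact: exprn_ege1.
move=> s t s0 t0 st ts; have [ts'|/ltW st'] := leP t s.
  apply: le_trans (up j s t t0 ts' _) (mono _ _ _ (leq_maxl _ _) t0).
  by apply: (le_trans st); rewrite ler_wpM2r// ltW.
apply: le_trans (down l s t s0 st' _) (mono _ _ _ (leq_maxr _ _) t0).
by apply: (le_trans ts); rewrite ler_wpM2r// ltW.
Qed.

End doubling.

(** * Folding the inner collar onto the exterior *)

Section fold.
Variables (R : realType) (n : nat) (Omega : set 'rV[R]_n) (r eps alpha : R).
Local Notation Rn := 'rV[R]_n.
Local Notation leb := (lebesgue_rV R n).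
Hypothesis n_gt0 : (0 < n)%N.
Hypothesis oO : open Omega.
Hypothesis tangents : forall a, boundary Omega a ->
  exists p q, tangent_balls Omega (2 * r) a p q.
Hypotheses (eps_gt0 : 0 < eps) (eps_le_r : eps <= r) (alpha_ge1 : 1 <= alpha).
Local Notation T := (reflection Omega).
Hypothesis T_lip : forall x y, collar Omega eps x -> collar Omega eps y ->
  enorm (T x - T y) <= alpha * enorm (x - y).
Implicit Types (x y z : Rn).

Local Notation D := (~` Omega).

Definition inner_collar : set Rn := Omega `&` collar Omega eps.
Local Notation W := inner_collar.

(** It sends both the complement of the domain and the inner collar into the
    complement; there the extension of [g] is [g] composed with it, times the
    cutoff. *)
Definition fold x : Rn := if x \in W then T x else x.
Local Notation S := fold.

Let refl x : W x -> exists s, [/\ 0 < s, enorm (x - T x) = 2 * s,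
    eball x s `<=` Omega, eball (T x) s `&` Omega = set0 &
    collar Omega eps (T x) /\ T (T x) = x].
Proof.
by move=> [Ox cx]; exact: (reflection_collar oO tangents eps_gt0 eps_le_r).
Qed.

Lemma fold_id x : D x -> S x = x.
Proof. by move=> Dx; rewrite /S memNset// => -[]. Qed.

Lemma fold_collar x : W x -> S x = T x.
Proof. by move=> Wx; rewrite /S mem_set. Qed.

Lemma fold_balls y : W y -> exists s, [/\ 0 < s,
  enorm (y - S y) = 2 * s, eball y s `<=` ~` D & eball (S y) s `<=` D].
Proof.
move=> Wy; have [s [s0 ys yO yD _]] := refl Wy.
exists s; rewrite fold_collar//; split => //.
  by rewrite setCK.
by move=> z yz Oz; have : (eball (T y) s `&` Omega) z by []; rewrite yD.
Qed.

Lemma fold_bilipschitz x y : W x -> W y ->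
  enorm (S x - S y) <= alpha * enorm (x - y) /\
  enorm (x - y) <= alpha * enorm (S x - S y).
Proof.
move=> Wx Wy; rewrite !fold_collar//; split.
  by apply: T_lip; [case: Wx|case: Wy].
have [_ [_ _ _ _ [cTx TTx]]] := refl Wx; have [_ [_ _ _ _ [cTy TTy]]] := refl Wy.
by rewrite -{1}TTx -{1}TTy; exact: T_lip.
Qed.

Lemma collar_open : open (collar Omega eps).
Proof.
have -> : collar Omega eps = \bigcup_(b in boundary Omega) eball b eps.
  apply/seteqP; split => x; rewrite /collar/=.
    move=> /ereal_inf_lt[_ [b bb <-]]; rewrite lte_fin => xb.
    by exists b.
  move=> [b bb xb]; apply: (le_lt_trans (dist_to_le _ bb)).
  by rewrite lte_fin.
by apply: bigcup_open => b _; exact: eball_open.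
Qed.

Lemma inner_collar_open : open W.
Proof. exact: openI collar_open. Qed.

Lemma measurable_inner_collar : measurable W.
Proof. by apply: open_measurable_rV; exact: inner_collar_open. Qed.

Lemma measurable_exterior : measurable D.
Proof. by apply: measurableC; exact: open_measurable_rV. Qed.

Lemma measurable_fold : measurable_fun setT S.
Proof.
apply: (@measurability _ _ _ _ setT S (@open Rn)) => //.
move=> _ [U oU <-]; rewrite setTI.
have -> : S @^-1` U = (W `&` (T @^-1` U)) `|` (~` W `&` U).
  apply/seteqP; split => x /=; rewrite /S.
    by case: ifPn; rewrite ?inE ?notin_setE; [left|right].
  by move=> [[Wx Ux]|[nWx Ux]]; rewrite ?(mem_set Wx)// (memNset nWx).
apply: measurableU; last first.
  apply: measurableI; last exact: open_measurable_rV.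
  by apply: measurableC; exact: measurable_inner_collar.
apply: open_measurable_rV; rewrite openE => x [Wx Ux].
have /nbhs_eballP[e e0 eU] : nbhs (T x) U by exact: open_nbhs_nbhs.
have al0 : 0 < alpha by exact: lt_le_trans ltr01 alpha_ge1.
have ea0 : 0 < e / alpha by rewrite divr_gt0.
have nW : nbhs x W by apply: open_nbhs_nbhs; split => //; exact: inner_collar_open.
have : nbhs x (W `&` eball x (e / alpha)) by exact: filterI nW (eball_nbhs x ea0).
apply: filterS => z [Wz]; rewrite /eball/= => zx.
split => //=; apply: eU; rewrite /eball/=.
apply: le_lt_trans (T_lip _ _) _; [by case: Wz|by case: Wx|].
by rewrite mulrC -ltr_pdivlMr.
Qed.

(** On the collar the fold does not contract distances by more than [alpha],
    so the part of the collar that is sent into a cube lies in one cube of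
    proportional radius. *)
Lemma fold_cube_measure z a : 0 < a ->
  (leb (S @^-1` cube z a `&` (D `|` W)) <=
   ((1 + (2 * alpha * n%:R) ^+ n) * (2 * a) ^+ n)%:E)%E.
Proof.
move=> a0; have n0 : 0 < n%:R :> R by rewrite ltr0n.
have al0 : 0 < alpha by exact: lt_le_trans ltr01 alpha_ge1.
have mpre : measurable (S @^-1` cube z a).
  rewrite -[X in measurable X]setTI; apply: measurable_fold => //.
  exact: measurable_cube.
have mD := measurable_exterior; have mW := measurable_inner_collar.
rewrite setIUr.
apply: le_trans (measureU2 _ (measurableI _ _ mpre mD) (measurableI _ _ mpre mW)) _.
rewrite mulrDl mul1r EFinD; apply: leeD.
  apply: (@le_trans _ _ (leb (cube z a))); last by rewrite lebesgue_cube.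
  apply: le_measure; rewrite ?inE.
  - exact: measurableI.
  - exact: measurable_cube.
  - by move=> x [/= xz Dx]; rewrite /= fold_id in xz.
have [[y0 [/= y0z Wy0]]|none] := pselect ((S @^-1` cube z a `&` W) !=set0); last first.
  have -> : S @^-1` cube z a `&` W = set0.
    by apply/seteqP; split => // x xx; apply: none; exists x.
  rewrite measure0 lee_fin mulr_ge0 ?exprn_ge0//.
  - by rewrite !mulr_ge0// ltW.
  - by rewrite mulr_ge0// ltW.
have b0 : 0 < 2 * alpha * n%:R * a by rewrite !mulr_gt0.
apply: (@le_trans _ _ (leb (cube y0 (2 * alpha * n%:R * a)))); last first.
  by rewrite lebesgue_cube// -exprMn [2 * (_ * a)]mulrCA.
apply: le_measure; rewrite ?inE.
- exact: measurableI.
- exact: measurable_cube.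
move=> y [/= yz Wy]; rewrite /cube/=.
apply: le_lt_trans (norm_le_enorm _) _.
have [_ le1] := fold_bilipschitz Wy Wy0.
apply: (le_lt_trans le1).
have := enorm_le_norm (S y - S y0) => le2.
have : `|S y - S y0| < 2 * a.
  have -> : S y - S y0 = (S y - z) - (S y0 - z) by rewrite opprB addrA subrK.
  apply: (le_lt_trans (ler_normB _ _)).
  by rewrite mulr_natl mulr2n; apply: ltrD.
rewrite -(ltr_pM2l n0) => le3.
have := le_lt_trans le2 le3; rewrite -(ltr_pM2l al0) => /lt_le_trans; apply.
by rewrite le_eqVlt; apply/orP; left; apply/eqP; ring.
Qed.

Lemma fold_integral_le : exists2 K : R, 0 <= K &
  forall f : Rn -> \bar R, (forall x, (0 <= f x)%E) -> measurable_fun setT f ->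
  (\int[leb]_x (f (S x) * (\1_(D `|` W) x)%:E) <= K%:E * \int[leb]_x f x)%E.
Proof.
have K0 : 0 <= 1 + (2 * alpha * n%:R) ^+ n.
  by rewrite addr_ge0// exprn_ge0// !mulr_ge0// (le_trans ler01).
exists (1 + (2 * alpha * n%:R) ^+ n) => // f f0 mf.
apply: integral_comp_le => //.
- exact: measurable_fold.
- by apply: measurableU; [exact: measurable_exterior|exact: measurable_inner_collar].
- exact: fold_cube_measure.
Qed.

Lemma extension_factor phi g x : cutoff Omega eps phi ->
  extension Omega eps phi g x =
  \1_(D `|` W) x * (g \_ D) (S x) * phi x.
Proof.
move=> [_ _ phi1 phi0]; rewrite /extension.
have [Dx|nDx] := pselect (D x).
  rewrite mem_set// indicE mem_set; last by left.
  by rewrite fold_id// patchE mem_set// phi1// mulr1 mul1r.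
rewrite memNset//; have Ox : Omega x by exact: contrapT.
have [cx|ncx] := pselect (collar Omega eps x); last first.
  by rewrite memNset// phi0// mulr0.
have Wx : W x by [].
have [s [s0 _ _ SD]] := fold_balls Wx.
have DSx : D (S x) by apply: SD; rewrite /eball/= subrr enorm0.
rewrite mem_set// indicE mem_set; last by right.
by rewrite mul1r patchE mem_set// fold_collar.
Qed.

End fold.

(** * The bound on the extension *)

Section cutoff_product.
Variables (R : realType) (n : nat) (E : set 'rV[R]_n) (f phi : 'rV[R]_n -> R).
Hypotheses (phi01 : forall x, 0 <= phi x <= 1).
Hypothesis (phi_off : forall x, ~ E x -> phi x = 0).
Local Notation h := (fun x => \1_E x * f x).

(** The Leibniz rule for differences; when only [x] is in [E], the cutoff
    vanishes at [y] and [phi x] is itself the difference [phi x - phi y]. *)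
Lemma cutoff_product_sqr x y :
  (h x * phi x - h y * phi y) ^+ 2 <=
  2 * (\1_E x * \1_E y * (f x - f y) ^+ 2) +
  (2 * (h x ^+ 2 * (phi x - phi y) ^+ 2) +
   2 * (h y ^+ 2 * (phi y - phi x) ^+ 2)).
Proof.
have sq (a : R) := sqr_ge0 a.
have [Ex|nEx] := pselect (E x); have [Ey|nEy] := pselect (E y);
  rewrite /= ?[\1_E x]indicE ?[\1_E y]indicE ?(mem_set Ex) ?(mem_set Ey)
    ?(memNset nEx) ?(memNset nEy) ?(phi_off nEx) ?(phi_off nEy)
    ?mul1r ?mul0r ?mulr0 ?subr0 ?sub0r ?add0r ?addr0.
- have -> : f x * phi x - f y * phi y =
      phi y * (f x - f y) + f x * (phi x - phi y) by ring.
  have /andP[p0 p1] := phi01 y.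
  set a := f x - f y; set b := phi x - phi y.
  have -> : phi y - phi x = - b by rewrite /b opprB.
  rewrite sqrrN.
  have h1 : (phi y * a + f x * b) ^+ 2 <= 2 * (phi y * a) ^+ 2 + 2 * (f x * b) ^+ 2.
    by have := sq (phi y * a - f x * b); rewrite !expr2; lra.
  have h2 : (phi y * a) ^+ 2 <= a ^+ 2.
    by rewrite exprMn ler_piMl// exprn_ile1.
  have h3 : 0 <= f y ^+ 2 * b ^+ 2 by rewrite mulr_ge0.
  rewrite !exprMn in h1 h2 h3 *; lra.
- by rewrite exprMn sqrrN; have := mulr_ge0 (sq (f x)) (sq (phi x)); rewrite ?expr0n/= ?mul0r; lra.
- by rewrite sqrrN exprMn ?sqrrN; have := mulr_ge0 (sq (f y)) (sq (phi y)); rewrite ?expr0n/= ?mul0r; lra.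
- by rewrite ?expr0n/= ?mul0r ?mulr0 ?addr0.
Qed.

End cutoff_product.

Lemma lee_weighted_sum (R : realDomainType) (p q m : R) (a b : \bar R) :
  0 <= p -> 0 <= q -> 0 <= m -> (0 <= a)%E -> (0 <= b)%E ->
  (p%:E * a + (q%:E * b + m%:E * a) <= (p + (q + m))%:E * (a + b))%E.
Proof.
move=> p0 q0 m0 a0 b0; have qm0 : 0 <= q + m by exact: addr_ge0.
rewrite EFinD ge0_muleDl ?lee_fin// EFinD ge0_muleDl ?lee_fin//.
apply: leeD; first by apply: lee_wpmul2l; rewrite ?lee_fin// leeDl.
by apply: leeD; apply: lee_wpmul2l; rewrite ?lee_fin// ?leeDl// leeDr.
Qed.

Section extension_bound.
Variables (R : realType) (n : nat) (Omega : set 'rV[R]_n) (r eps alpha : R).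
Variables (phi : 'rV[R]_n -> R) (nu : {measure set 'rV[R]_n -> \bar R}).
Variable rho : R -> R.
Local Notation Rn := 'rV[R]_n.
Local Notation leb := (lebesgue_rV R n).
Local Notation D := (~` Omega).
Local Notation W := (inner_collar Omega eps).
Local Notation S := (fold Omega eps).
Local Notation k := (profile rho).
Hypothesis n_gt0 : (0 < n)%N.
Hypotheses (oO : open Omega) (bO : bounded_set Omega).
Hypothesis tangents : forall a, boundary Omega a ->
  exists p q, tangent_balls Omega (2 * r) a p q.
Hypotheses (eps_gt0 : 0 < eps) (eps_le_r : eps <= r) (alpha_ge1 : 1 <= alpha).
Hypothesis T_lip : forall x y, collar Omega eps x -> collar Omega eps y ->
  enorm (reflection Omega x - reflection Omega y) <= alpha * enorm (x - y).
Hypothesis phi_cutoff : cutoff Omega eps phi.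
Hypotheses (nu_levy : levy_measure nu) (nu_density : isotropic_density nu rho).
Hypothesis rho_doubling : exists C : R, forall beta t : R,
  Num.min alpha^-1 (1 / 3) <= beta <= alpha -> 0 < t ->
  rho (beta * t) <= C * rho t.
Implicit Types (x y : Rn) (g : Rn -> R).

(* 33 serves the mixed pairs, [alpha] the pairs inside the collar. *)
Let B : R := 33 + alpha.

Lemma profile_comparable : exists2 C : R, 1 <= C & W !=set0 ->
  forall s t, 0 < s -> 0 < t -> s <= B * t -> t <= B * s -> k s <= C * k t.
Proof.
have [[x [Ox]]|nW] := pselect (W !=set0); last by exists 1.
rewrite /collar/= => /ereal_inf_lt[_ [b bb _] _].
have a1 : 1 < alpha.
  exact: (reflection_expands oO tangents eps_gt0 eps_le_r bO bb T_lip).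
have [_ rho0 _] := nu_density; have [C0 dbl] := rho_doubling.
have [C C1 cmp] := comparable_of_doubling a1 rho0 B dbl.
by exists C => // _ s t s0 t0 st ts; rewrite !profile_gt0//; exact: cmp.
Qed.

Lemma cutoff_lipschitz_sqr : exists2 L : R, 0 <= L &
  forall x y, (phi x - phi y) ^+ 2 <= L * Num.min 1 (enorm (x - y) ^+ 2).
Proof.
have [sphi phi01 phi1 _] := phi_cutoff.
have [M OM] := bounded_set_enorm bO.
have phiM x : M < enorm x -> phi x = 1.
  by move=> Mx; apply: phi1 => /OM; rewrite leNgt Mx.
have /choice[c cP] : forall i, exists c, 0 <= c /\
    forall y, `|'D_(delta_mx ord0 i) phi y| <= c.
  by move=> i; have [c c0 cb] := cutoff_partial_bounded i sphi phiM; exists c.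
pose C := \sum_i c i.
have c0 i : 0 <= c i by have [] := cP i.
have C0 : 0 <= C by apply: sumr_ge0 => i _.
have DC i y : `|'D_(delta_mx ord0 i) phi y| <= C.
  have [_ h] := cP i; apply: (le_trans (h y)).
  by rewrite /C (bigD1 i)//= lerDl sumr_ge0.
have lip := smooth_lipschitz C0 sphi DC.
pose l := n%:R * C; have l0 : 0 <= l by rewrite mulr_ge0.
exists (1 + l ^+ 2); first by rewrite addr_ge0// sqr_ge0.
move=> x y; have d0 := enorm_ge0 (x - y).
have h1 : (phi x - phi y) ^+ 2 <= 1.
  rewrite -real_normK ?num_real// exprn_ile1// ler_norml.
  by have /andP[? ?] := phi01 x; have /andP[? ?] := phi01 y; lra.
have h2 : (phi x - phi y) ^+ 2 <= l ^+ 2 * enorm (x - y) ^+ 2.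
  rewrite -exprMn -real_normK ?num_real//.
  have ld0 : 0 <= l * enorm (x - y) by exact: mulr_ge0.
  by have := lip x y; rewrite -/l => lxy; apply: lerXn2r; rewrite ?nnegrE.
have l20 := sqr_ge0 l; have d20 := sqr_ge0 (enorm (x - y)).
by rewrite /Num.min; case: ifP => _; nra.
Qed.

(** By the Leibniz rule the form of the extension splits into the form of the
    folded function and the price of the cutoff, which is an L2 norm. *)
Lemma extension_bound : exists2 K : R, 0 <= K & forall g,
  measurable_fun D g ->
  measurable_fun setT (extension Omega eps phi g) /\
  (L2_sqr setT (extension Omega eps phi g) +
     nu_form nu setT (extension Omega eps phi g) <=
   K%:E * (L2_sqr D g + nu_form nu D g))%E.
Proof.
have [C C1 cmp] := profile_comparable.
have [L L0 phiL] := cutoff_lipschitz_sqr.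
have [M M0 kM] := levy_constant n_gt0 nu_density nu_levy.
have [K1 K10 foldK] :=
  fold_integral_le n_gt0 oO tangents eps_gt0 eps_le_r alpha_ge1 T_lip.
have mD : measurable D := measurable_exterior oO.
have mW : measurable W := measurable_inner_collar eps oO.
have mE : measurable (D `|` W) by exact: measurableU.
have mS : measurable_fun setT S := measurable_fold oO alpha_ge1 T_lip.
have mk := measurable_profile nu_density; have k0 := profile_ge0 nu_density.
have i0 : 'I_n := Ordinal n_gt0.
have [sphi phi01 phi1 phi0] := phi_cutoff.
have mphi : measurable_fun setT phi.
  by apply: continuous_measurable_rV; have [] := sphi [::].
have B33 : 33 <= B by rewrite /B lerDl (le_trans ler01).
have Balpha : alpha <= B by rewrite /B lerDr.
have [c c0 core] : exists2 c : R, 0 <= c & forall g, measurable_fun D g ->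
    (\int[leb]_x \int[leb]_y (folded_integrand D W S k (g \_ D) x y)%:E <=
     c%:E * nu_form nu D g)%E.
  exists (folded_constant n C K1); first exact: folded_constant_ge0.
  move=> g mg; have mu : measurable_fun setT (g \_ D).
    by apply/(measurable_restrictT _ _).1.
  rewrite (nu_formE n_gt0 nu_density mD mg).
  exact: (folded_form_le i0 (@fold_id _ _ Omega eps)
    (fold_balls oO tangents eps_gt0 eps_le_r)
    (fold_bilipschitz oO tangents eps_gt0 eps_le_r T_lip)
    B33 Balpha C1 k0 cmp mD mW mS mk mu K10 foldK).
exists (K1 + (2 * c + 4 * (L * M * K1))).
  by rewrite !addr_ge0 ?mulr_ge0.
move=> g mg; pose u := g \_ D.
have mu : measurable_fun setT u by apply/(measurable_restrictT _ _).1.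
pose h x : R := \1_(D `|` W) x * u (S x).
have mh : measurable_fun setT h.
  apply: measurable_funM; first exact: measurable_indic.
  exact: (measurableT_comp mu mS).
have AE : extension Omega eps phi g = fun x => h x * phi x.
  apply/funext => x.
  exact: (extension_factor oO tangents eps_gt0 eps_le_r _ _ phi_cutoff).
have mA : measurable_fun setT (extension Omega eps phi g).
  by rewrite AE; exact: measurable_funM.
split => //.
have phi_off x : ~ (D `|` W) x -> phi x = 0.
  move=> nE; have Ox : Omega x by apply: contrapT => nO; apply: nE; left.
  by apply: phi0 => // cx; apply: nE; right.
pose I2 := (\int[leb]_x (h x ^+ 2)%:E)%E.
have h2E x : h x ^+ 2 = u (S x) ^+ 2 * \1_(D `|` W) x.
  rewrite /h exprMn mulrC; congr (_ * _).
  by rewrite indicE; case: (x \in _); rewrite ?expr1n ?expr0n.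
have hL2 : (I2 <= K1%:E * L2_sqr D g)%E.
  have -> : L2_sqr D g = (\int[leb]_x (u x ^+ 2)%:E)%E.
    rewrite /L2_sqr integral_mkcond; apply: eq_integral => x _.
    rewrite /u !patchE; case: ifP => // _.
    by rewrite expr0n.
  have -> : I2 = (\int[leb]_x ((u (S x) ^+ 2)%:E * (\1_(D `|` W) x)%:E))%E.
    by apply: eq_integral => x _; rewrite h2E EFinM.
  apply: (foldK (fun x => (u x ^+ 2)%:E)).
    by move=> x; rewrite lee_fin sqr_ge0.
  by apply/measurable_EFinP; exact: measurable_funX.
have L2A : (L2_sqr setT (extension Omega eps phi g) <= I2)%E.
  apply: le_integralT.
  - by move=> x; rewrite lee_fin sqr_ge0.
  - by apply/measurable_EFinP; exact: measurable_funX.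
  - by apply/measurable_EFinP; exact: measurable_funX.
  move=> x; rewrite AE lee_fin exprMn ler_piMr ?sqr_ge0//.
  by have /andP[p0 p1] := phi01 x; exact: exprn_ile1.
pose F x y : R := folded_integrand D W S k u x y.
pose P x y : R := h x ^+ 2 * (phi x - phi y) ^+ 2 * k (enorm (x - y)).
have F0 x y : (0 <= (F x y)%:E)%E.
  by rewrite lee_fin; exact: folded_integrand_ge0.
have P0 x y : (0 <= (P x y)%:E)%E.
  by rewrite lee_fin mulr_ge0// -exprMn sqr_ge0.
have m1 := @measurable_fst _ _ Rn Rn; have m2 := @measurable_snd _ _ Rn Rn.
have mF : measurable_fun setT (fun p : Rn * Rn => (F p.1 p.2)%:E).
  by apply/measurable_EFinP; exact: measurable_folded_integrand.
have mP : measurable_fun setT (fun p : Rn * Rn => (P p.1 p.2)%:E).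
  apply/measurable_EFinP; apply: measurable_funM.
    apply: measurable_funM.
      apply: (@measurable_funX _ _ _ _ (fun p : Rn * Rn => h p.1)).
      exact: (measurableT_comp mh m1).
    apply: (@measurable_funX _ _ _ _ (fun p : Rn * Rn => phi p.1 - phi p.2)).
    apply: measurable_funB; first exact: (measurableT_comp mphi m1).
    exact: (measurableT_comp mphi m2).
  apply: (measurableT_comp (measurable_kernel nu_density)).
  exact: measurable_rVB.
have mP' : measurable_fun setT (fun p : Rn * Rn => (P p.2 p.1)%:E).
  have mp : measurable_fun setT (fun p : Rn * Rn => (p.2, p.1)).
    exact: measurable_fun_pair.
  exact: (measurableT_comp mP mp).
have two0 : 0 <= 2 :> R by [].
have zP0 x y : (0 <= 2%:E * (P x y)%:E)%E by rewrite mule_ge0// lee_fin.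
pose G x y : \bar R := (2%:E * (P x y)%:E + 2%:E * (P y x)%:E)%E.
have G0 x y : (0 <= G x y)%E by rewrite adde_ge0.
have mG : measurable_fun setT (fun p : Rn * Rn => G p.1 p.2).
  exact: (emeasurable_funD (measurable_funeM _ mP) (measurable_funeM _ mP')).
have formP : (\int[leb]_x \int[leb]_y (P x y)%:E <= (L * M)%:E * I2)%E.
  exact: (cutoff_form_le nu_density mh mphi L0 M0 phiL kM).
have formG : (\int[leb]_x \int[leb]_y G x y <= (4 * (L * M))%:E * I2)%E.
  have e1 : (\int[leb]_x \int[leb]_y G x y =
      2%:E * \int[leb]_x \int[leb]_y (P x y)%:E +
      \int[leb]_x \int[leb]_y (2%:E * (P y x)%:E))%E.
    exact: (@integral2_ZD R n 2 (fun x y => (P x y)%:E)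
      (fun x y => 2%:E * (P y x)%:E)%E two0 P0 (fun x y => zP0 y x)
      mP (measurable_funeM _ mP')).
  have e2 : (\int[leb]_x \int[leb]_y (2%:E * (P y x)%:E) =
      2%:E * \int[leb]_x \int[leb]_y (P x y)%:E)%E.
    apply: etrans (@integral2_Zl R n 2 (fun x y => (P y x)%:E) two0
      (fun x y => P0 y x) mP') _.
    apply: (congr1 (fun z => 2%:E * z)%E).
    exact: (@tonelli _ _ (fun x y => (P y x)%:E) (fun x y => P0 y x) mP').
  rewrite e1 e2.
  have I20 : (0 <= I2)%E by apply: integral_ge0 => x _; rewrite lee_fin sqr_ge0.
  have -> : ((4 * (L * M))%:E * I2 =
      2%:E * ((L * M)%:E * I2) + 2%:E * ((L * M)%:E * I2))%E.
    have LM0 : 0 <= L * M by exact: mulr_ge0.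
    rewrite !muleA -!EFinM -ge0_muleDl ?lee_fin ?mulr_ge0//.
    by rewrite -EFinD; congr (_%:E * _)%E; ring.
  by apply: leeD; apply: lee_wpmul2l.
have formA : (nu_form nu setT (extension Omega eps phi g) <=
    2%:E * (c%:E * nu_form nu D g) + (4 * (L * M))%:E * I2)%E.
  rewrite (nu_formE n_gt0 nu_density measurableT mA).
  apply: (@le_trans _ _ (\int[leb]_x \int[leb]_y (2%:E * (F x y)%:E + G x y))%E).
    apply: le_integral2.
    - by move=> x y; rewrite lee_fin; exact: form_integrand_ge0.
    - apply/measurable_EFinP; apply: measurable_form_integrand => //.
      by rewrite patch_setT.
    - exact: (emeasurable_funD (measurable_funeM _ mF) mG).
    move=> x y; rewrite /G -!EFinM -!EFinD lee_fin.
    rewrite /form_integrand !indicT !mul1r patch_setT AE.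
    have k00 := k0 (enorm (x - y)).
    have := ler_wpM2r k00 (@cutoff_product_sqr _ _ (D `|` W) (u \o S) phi
      phi01 phi_off x y).
    move=> /le_trans; apply; rewrite /F /P /folded_integrand /h /=.
    by rewrite [enorm (y - x)]enorm_distC le_eqVlt; apply/orP; left; apply/eqP; ring.
  have -> : (\int[leb]_x \int[leb]_y (2%:E * (F x y)%:E + G x y) =
    2%:E * \int[leb]_x \int[leb]_y (F x y)%:E + \int[leb]_x \int[leb]_y G x y)%E.
    exact: (@integral2_ZD R n 2 (fun x y => (F x y)%:E) G two0 F0 G0 mF mG).
  apply: leeD formG; apply: lee_wpmul2l => //.
  exact: core.
have N0 : (0 <= L2_sqr D g)%E.
  by apply: integral_ge0 => x _; rewrite lee_fin sqr_ge0.
have Q0 : (0 <= nu_form nu D g)%E.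
  rewrite (nu_formE n_gt0 nu_density mD mg).
  by do 2 (apply: integral_ge0 => ? _); rewrite lee_fin; exact: form_integrand_ge0.
have LM40 : 0 <= 4 * (L * M) by rewrite mulr_ge0// mulr_ge0.
have formA' : (nu_form nu setT (extension Omega eps phi g) <=
    (2 * c)%:E * nu_form nu D g + (4 * (L * M * K1))%:E * L2_sqr D g)%E.
  apply: (le_trans formA); apply: leeD; first by rewrite EFinM muleA.
  have -> : 4 * (L * M * K1) = 4 * (L * M) * K1 by rewrite mulrA.
  rewrite [X in (_ <= X * _)%E]EFinM -muleA.
  by apply: lee_wpmul2l.
apply: (le_trans (leeD (le_trans L2A hL2) formA')).
apply: lee_weighted_sum => //; rewrite mulr_ge0// mulr_ge0// mulr_ge0//.
Qed.

End extension_bound.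

(** * Continuity of the extension operator *)

Lemma extension_linear (R : realType) (n : nat) (Omega : set 'rV[R]_n) eps
    (phi : 'rV[R]_n -> R) (a : R) g h :
  extension Omega eps phi (fun x => a * g x + h x) =
  (fun x => a * extension Omega eps phi g x + extension Omega eps phi h x).
Proof.
apply/funext => x; rewrite /extension; case: ifP => // _; case: ifP => _.
  by rewrite mulrDl mulrA.
by rewrite mulr0 addr0.
Qed.

Lemma collar_width_bounds (R : realType) (r lambda delta : R) :
  0 < r -> 0 <= lambda -> 0 < delta ->
  0 < collar_width r lambda delta /\ collar_width r lambda delta <= r.
Proof.
move=> r0 l0 d0; have d3 : 0 < delta / 3 by rewrite divr_gt0.
rewrite /collar_width; case: eqVneq => [_|ln0].
  by rewrite lt_min r0 d3 ge_min lexx.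
have l1 : 0 < (6 * lambda)^-1.
  by rewrite invr_gt0 mulr_gt0// lt_def ln0.
by rewrite !lt_min r0 l1 d3 !ge_min lexx.
Qed.

Lemma bounded_continuous (R : realType) (n : nat)
    (nu : {measure set 'rV[R]_n -> \bar R}) (D1 D2 : set 'rV[R]_n)
    (F : ('rV[R]_n -> R) -> 'rV[R]_n -> R) (K : R) :
  measurable D1 -> 0 <= K ->
  (forall (a : R) g h, F (fun x => a * g x + h x) = (fun x => a * F g x + F h x)) ->
  (forall g, measurable_fun D1 g -> measurable_fun D2 (F g) /\
     (L2_sqr D2 (F g) + nu_form nu D2 (F g) <=
      K%:E * (L2_sqr D1 g + nu_form nu D1 g))%E) ->
  continuous_operator nu D1 D2 F.
Proof.
move=> mD1 K0 lin bnd.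
have L0 (D : set 'rV[R]_n) u : (0 <= L2_sqr D u)%E.
  by apply: integral_ge0 => x _; rewrite lee_fin sqr_ge0.
have Q0 (D : set 'rV[R]_n) u : (0 <= nu_form nu D u)%E.
  apply: integral_ge0 => x _; apply: integral_ge0.
    by apply: measurable_rVD => //; exact: measurable_cst.
  by move=> y _; rewrite lee_fin sqr_ge0.
split; last first.
- move=> g0 [mg0 _ _] e e0.
  exists (e / (Num.sqrt K + 1)).
    by rewrite divr_gt0// ltr_wpDl// sqrtr_ge0.
  move=> g [mg _ _].
  have -> : (fun x => F g x - F g0 x) = F (fun x => g x - g0 x).
    have -> : (fun x => g x - g0 x) = (fun x => -1 * g0 x + g x).
      by apply/funext => x; rewrite mulN1r addrC.
    by rewrite lin; apply/funext => x; rewrite mulN1r addrC.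
  have mgg : measurable_fun D1 (fun x => g x - g0 x) by exact: measurable_funB.
  have [_ le] := bnd _ mgg.
  rewrite /H_norm; set N := (L2_sqr D1 _ + _)%E in le *.
  have N0 : (0 <= N)%E by rewrite adde_ge0.
  move=> lt; apply: (@le_lt_trans _ _ (sqrte (K%:E * N))).
    by rewrite lee_sqrt// mule_ge0// lee_fin.
  rewrite sqrteM ?lee_fin//=.
  have sK := sqrtr_ge0 K.
  case: (sqrte N) (sqrte_ge0 N) lt => [t||]; rewrite ?lee_fin ?lte_fin//.
  move=> t0; rewrite ltr_pdivlMr ?ltr_wpDl// => lt.
  by move: (Num.sqrt K) sK lt => w sK lt; nra.
- by move=> a g h Hg Hh; exact: lin.
move=> g [mg Lg Qg]; have [mF le] := bnd g mg.
have fin : (L2_sqr D2 (F g) + nu_form nu D2 (F g) < +oo)%E.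
  apply: (le_lt_trans le); apply: lte_mul_pinfty; rewrite ?lee_fin//.
  exact: lte_add_pinfty.
split => //; apply: le_lt_trans fin; first exact: leeDl.
exact: leeDr.
Qed.

Theorem theorem6p10 (R : realType) (n : nat) (Omega : set 'rV[R]_n)
    (r lambda delta alpha : R) (phi : 'rV[R]_n -> R)
    (nu : {measure set 'rV[R]_n -> \bar R}) (rho : R -> R)
    (n_gt0 : (0 < n)%N)
    (r_gt0 : 0 < r) (Omega_C11 : C11_domain Omega (2 * r))
    (lambda_ge0 : 0 <= lambda) (delta_gt0 : 0 < delta)
    (Omega_charts : C11_charts Omega lambda delta)
    (alpha_ge1 : 1 <= alpha)
    (alpha_lipschitz : forall x y : 'rV[R]_n,
      collar Omega (collar_width r lambda delta) x ->
      collar Omega (collar_width r lambda delta) y ->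
      enorm (reflection Omega x - reflection Omega y) <= alpha * enorm (x - y))
    (phi_cutoff : cutoff Omega (collar_width r lambda delta) phi)
    (nu_levy : levy_measure nu) (nu_density : isotropic_density nu rho)
    (rho_doubling : exists C : R, forall beta t : R,
      Num.min alpha^-1 (1 / 3) <= beta <= alpha -> 0 < t ->
      rho (beta * t) <= C * rho t) :
  continuous_operator nu (~` Omega) [set: 'rV[R]_n]
    (extension Omega (collar_width r lambda delta) phi).
Proof.
have [oO bO _ tangents] := Omega_C11.
have [eps0 eps_r] := collar_width_bounds r_gt0 lambda_ge0 delta_gt0.
have [K K0 bnd] := extension_bound n_gt0 oO bO tangents eps0 eps_r alpha_ge1
  alpha_lipschitz phi_cutoff nu_levy nu_density rho_doubling.
apply: (bounded_continuous (measurable_exterior oO) K0 _ bnd).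
by move=> a g h; exact: extension_linear.
Qed.
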